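(* Let $\mathcal{H}$ be a complex Hilbert space of dimension $\aleph_1$, let $\mathcal{J}$ be the ideal of bounded operators on $\mathcal{H}$ whose range has dimension $< \aleph_1$, and let $\mathcal{K}$ be the ideal of compact operators on $\mathcal{H}$. If the Continuum Hypothesis holds, then the C*-algebra $\mathcal{J}/\mathcal{K}$ has $2^{\aleph_1}$-many outer automorphisms.
   Context: Dimension is Hilbert space dimension (cardinality of an orthonormal basis); the dimension of the range of an operator means the Hilbert space dimension of the closure of its range. For nonseparable $\mathcal{H}$, $\mathcal{J}$ is a norm-closed two-sided $*$-ideal of the algebra $\mathcal{B}(\mathcal{H})$ of bounded operators, and $\mathcal{K} \subset \mathcal{J}$. Automorphisms are $*$-automorphisms. An automorphism is inner if it is implemented by conjugation $a \mapsto uau^*$ by a unitary $u$, and outer otherwise; since $\mathcal{J}/\mathcal{K}$ has no unit, the unitary $u$ is taken in the multiplier algebra of $\mathcal{J}/\mathcal{K}$. *)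

(* Defs.v *)
From HB Require Import structures.
From mathcomp Require Import all_boot all_order all_algebra.
From mathcomp Require Import generic_quotient ring_quotient.
From mathcomp Require Import all_classical all_reals all_analysis.
From mathcomp Require Import complex sesquilinear.

Set Implicit Arguments.
Unset Strict Implicit.
Unset Printing Implicit Defensive.

Import Order.TTheory GRing.Theory Num.Theory.
Import numFieldNormedType.Exports.

Local Open Scope classical_set_scope.
Local Open Scope card_scope.
Local Open Scope ring_scope.
Local Open Scope quotient_scope.

Definition card_lt (T U : Type) (A : set T) (B : set U) : Prop :=
  A #<= B /\ ~ (B #<= A).

Definition is_aleph1 (T : Type) (A : set T) : Prop :=
  ~ countable A /\
  forall (U : Type) (B : set U), ~ countable B -> A #<= B.

(* 2^aleph_0 = aleph_1, with 2^aleph_0 the cardinal of the power set of nat *)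
Definition CH : Prop := is_aleph1 [set: set nat].

(* [hdot] is linear in its first argument and conjugate-linear in its second *)
HB.mixin Record CompleteNormedModule_isHilbert (R : realType) H
    of CompleteNormedModule R[i] H := {
  hdot : {dot H for Num.conj};
  sqr_norm_hdot : forall x : H, `|x| ^+ 2 = hdot x x
}.

#[short(type="hilbertType")]
HB.structure Definition Hilbert (R : realType) :=
  {H of CompleteNormedModule_isHilbert R H & CompleteNormedModule R[i] H}.

Section HilbertDimension.
Context {R : realType} {H : hilbertType R}.

Definition lin_span (E : set H) : set H :=
  [set x | exists (n : nat) (c : 'I_n -> R[i]) (e : 'I_n -> H),
     (forall i, E (e i)) /\ x = \sum_i c i *: e i].

Definition orthonormal_basis (M E : set H) : Prop :=
  [/\ E `<=` M,
      {in E &, forall x y, hdot x y = (x == y)%:R} &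
      closure (lin_span E) = M].

Definition hdim_eq (M : set H) (T : Type) (A : set T) : Prop :=
  exists2 E, orthonormal_basis M E & E #= A.

Definition hdim_lt (M : set H) (T : Type) (A : set T) : Prop :=
  exists2 E, orthonormal_basis M E & card_lt E A.

End HilbertDimension.

Section BoundedOperators.
Context {R : realType} (H : hilbertType R).

Definition bounded_linear : {pred H -> H} :=
  [pred f : H -> H |
    `[< linear f /\ exists M : R, forall x, `|f x| <= M%:C%C * `|x| >]].

Lemma bounded_linearP (f : H -> H) :
  reflect (linear f /\ exists M : R, forall x, `|f x| <= M%:C%C * `|x|)
    (f \in bounded_linear).
Proof. by rewrite inE; exact: asboolP. Qed.

Lemma bounded_linear_submod_closed : submod_closed bounded_linear.
Proof.
split.
  apply/bounded_linearP; split.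
    move=> a u v; rewrite [LHS]/GRing.zero /=.
    by rewrite -[RHS]/(a *: (0 : H) + 0) scaler0 addr0.
  by exists 0 => x; rewrite -[X in `|X|]/(0 : H) normr0 mul0r.
move=> c f g /bounded_linearP[lf [M Mf]] /bounded_linearP[lg [N Ng]].
apply/bounded_linearP; split.
  move=> a u v; rewrite !fctE lf lg !scalerDr !scalerA (mulrC c a).
  by rewrite addrACA.
exists (complex.Re `|c| * M + N) => x; rewrite !fctE.
have -> : (complex.Re `|c| * M + N)%:C%C = `|c| * M%:C%C + N%:C%C :> R[i].
  by rewrite rmorphD rmorphM; congr (_ * _ + _); apply: RRe_real;
    exact: normr_real.
rewrite (le_trans (ler_normD _ _))// normrZ mulrDl lerD//.
by rewrite -mulrA ler_wpM2l.
Qed.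

HB.instance Definition _ := GRing.isSubmodClosed.Build _ _ bounded_linear
  bounded_linear_submod_closed.

Record BH := MkBH { opfun :> H -> H ; _ : opfun \in bounded_linear }.

HB.instance Definition _ := [isSub for opfun].
HB.instance Definition _ := [Choice of BH by <:].
HB.instance Definition _ := [SubChoice_isSubLmodule of BH by <:].

End BoundedOperators.

Section BoundedOperatorsTheory.
Context {R : realType} {H : hilbertType R}.
Implicit Types a b : BH H.

Lemma opfun_linear a : linear a.
Proof. by have /bounded_linearP[] := valP a. Qed.

HB.instance Definition _ a :=
  GRing.isLinear.Build R[i] H H *:%R (opfun a) (opfun_linear a).

Lemma opfun_bounded a :
  exists2 M : R, 0 < M & forall x, `|a x| <= M%:C%C * `|x|.
Proof.
have /bounded_linearP[_ [M Ma]] := valP a.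
exists (Num.max M 1); first by rewrite lt_max ltr01 orbT.
move=> x; rewrite (le_trans (Ma x))// ler_wpM2r// lecR.
by rewrite le_max lexx.
Qed.

Lemma opfun_continuous a : continuous a.
Proof.
have [M M0 aM] := opfun_bounded a.
apply: (@bounded_linear_continuous _ _ _ (opfun a)).
apply/bounded_funP => r; exists (M%:C%C * r) => x xr.
by rewrite (le_trans (aM x))// ler_wpM2l// lecR ltW.
Qed.

Lemma bh_comp_subproof a b : a \o b \in @bounded_linear R H.
Proof.
apply/bounded_linearP; split; first by move=> c u v /=; rewrite !linearP.
have [M M0 aM] := opfun_bounded a; have [N _ bN] := opfun_bounded b.
exists (M * N) => x /=; rewrite rmorphM -mulrA.
by rewrite (le_trans (aM _))// ler_wpM2l// lecR ltW.
Qed.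

Definition bh_comp a b : BH H := MkBH (bh_comp_subproof a b).

(* the adjoint of a, which exists and is unique as H is complete; the default
   value 0 of xget is never used *)
Definition bh_adj a : BH H :=
  xget 0 [set b : BH H | forall x y : H, hdot (a x) y = hdot x (b y)].

Definition bh_norm a : R :=
  sup [set complex.Re `|a x| | x in [set x : H | `|x| <= 1]].

End BoundedOperatorsTheory.

Section CompactOperators.
Context {R : realType} (H : hilbertType R).
Implicit Types a b : BH H.

Let unit_ball : set H := [set x | `|x| <= 1].

Definition compact_op : {pred BH H} :=
  [pred a : BH H | `[< precompact (a @` [set x : H | `|x| <= 1]) >]].

Let compact_opP a :
  reflect (exists2 A, compact A & a @` unit_ball `<=` A) (a \in compact_op).
Proof.
have cE : reflect (precompact (a @` unit_ball)) (a \in compact_op).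
  by rewrite inE; exact: asboolP.
apply: (iffP cE) => [|[A cA aA]].
  rewrite precompactE => ca; exists (closure (a @` unit_ball)) => //.
  exact: subset_closure.
apply: (precompact_subset aA); rewrite precompact_closed//.
by apply: compact_closed => //; exact: norm_hausdorff.
Qed.

Lemma compact_op_submod_closed : submod_closed compact_op.
Proof.
split.
  apply/compact_opP; exists [set 0]; first exact: compact_set1.
  by move=> _ [x _ <-].
move=> c a b /compact_opP[A cA aA] /compact_opP[B cB bB].
apply/compact_opP; exists ((fun z : H * H => c *: z.1 + z.2) @` (A `*` B)).
  apply: continuous_compact; last exact: compact_setX.
  apply: continuous_subspaceT => z.
  by apply: cvgD; [apply: cvgZr; exact: cvg_fst|exact: cvg_snd].
move=> _ [x x1 <-]; exists (a x, b x) => //.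
by split; [apply: aA; exists x|apply: bB; exists x].
Qed.

HB.instance Definition _ := GRing.isSubmodClosed.Build _ _ compact_op
  compact_op_submod_closed.

Lemma compact_op_compl a b : b \in compact_op -> bh_comp a b \in compact_op.
Proof.
move=> /compact_opP[B cB bB]; apply/compact_opP; exists (a @` B).
  apply: continuous_compact => //; apply: continuous_subspaceT.
  exact: opfun_continuous.
by move=> _ [x x1 <-]; exists (b x) => //; apply: bB; exists x.
Qed.

Lemma compact_op_compr a b : a \in compact_op -> bh_comp a b \in compact_op.
Proof.
move=> /compact_opP[A cA aA]; have [M M0 bM] := opfun_bounded b.
apply/compact_opP; exists ( *:%R M%:C%C @` A).
  apply: continuous_compact => //; apply: continuous_subspaceT => x.
  by apply: cvgZr; exact: cvg_id.
have MC0 : M%:C%C != 0 :> R[i] by rewrite gt_eqF// ltcR.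
move=> _ [x x1 <-]; exists (a (M%:C%C^-1 *: b x)).
  apply: aA; exists (M%:C%C^-1 *: b x) => //; rewrite /unit_ball /=.
  rewrite normrZ normfV gtr0_norm ?ltcR// ler_pdivrMl ?ltcR//.
  by rewrite (le_trans (bM x))// ler_pM2l ?ltcR.
by rewrite /= linearZ scalerA divff ?scale1r.
Qed.

End CompactOperators.

Section Calkin.
Context {R : realType} (H : hilbertType R).

Definition calkin : Type := Quotient.quot (@compact_op R H).
HB.instance Definition _ := GRing.Zmodule.on calkin.

Definition calkin_pi (a : BH H) : calkin :=
  \pi_(Quotient.quot (@compact_op R H)) a.

Definition calkin_repr (x : calkin) : BH H :=
  repr (x : Quotient.quot (@compact_op R H)).

Lemma calkin_reprK : cancel calkin_repr calkin_pi.
Proof. by move=> x; exact: reprK. Qed.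

Lemma calkin_piP (a b : BH H) :
  calkin_pi a = calkin_pi b <-> a - b \in @compact_op R H.
Proof. by rewrite Quotient.idealrBE; split=> [/eqP|/eqP]. Qed.

Lemma calkin_piB : {morph calkin_pi : a b / a - b}.
Proof. by move=> a b; rewrite /calkin_pi !piE. Qed.

Lemma calkin_piD : {morph calkin_pi : a b / a + b}.
Proof. by move=> a b; rewrite /calkin_pi !piE. Qed.

Definition calkin_scale (c : R[i]) (x : calkin) : calkin :=
  calkin_pi (c *: calkin_repr x).

Lemma calkin_piZ c (a : BH H) :
  calkin_scale c (calkin_pi a) = calkin_pi (c *: a).
Proof.
apply/calkin_piP; rewrite -scalerBr rpredZ//; apply/calkin_piP.
exact: calkin_reprK.
Qed.

Let calkin_scaleA c d x :
  calkin_scale c (calkin_scale d x) = calkin_scale (c * d) x.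
Proof. by rewrite -(calkin_reprK x) !calkin_piZ scalerA. Qed.

Let calkin_scale1 : left_id 1 calkin_scale.
Proof. by move=> x; rewrite -(calkin_reprK x) calkin_piZ scale1r. Qed.

Let calkin_scaleDr : right_distributive calkin_scale +%R.
Proof.
move=> c x y; rewrite -(calkin_reprK x) -(calkin_reprK y).
by rewrite -calkin_piD !calkin_piZ scalerDr calkin_piD.
Qed.

Let calkin_scaleDl x : {morph calkin_scale^~ x : c d / c + d}.
Proof.
by move=> c d; rewrite -(calkin_reprK x) !calkin_piZ scalerDl calkin_piD.
Qed.

HB.instance Definition _ := GRing.Zmodule_isLmodule.Build R[i] calkin
  calkin_scaleA calkin_scale1 calkin_scaleDr calkin_scaleDl.

Definition calkin_mul (x y : calkin) : calkin :=
  calkin_pi (bh_comp (calkin_repr x) (calkin_repr y)).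

Lemma calkin_piM : {morph calkin_pi : a b / bh_comp a b >-> calkin_mul a b}.
Proof.
move=> a b; apply/esym/calkin_piP.
set a' := calkin_repr _; set b' := calkin_repr _.
have -> : bh_comp a' b' - bh_comp a b =
    bh_comp (a' - a) b' + bh_comp a (b' - b).
  apply/val_inj/funext => x /=.
  rewrite -[LHS]/(a' (b' x) - a (b x)).
  rewrite -[RHS]/(a' (b' x) - a (b' x) + a (b' x - b x)).
  by rewrite linearB addrA subrK.
apply: rpredD.
  by apply: compact_op_compr; apply/calkin_piP; exact: calkin_reprK.
by apply: compact_op_compl; apply/calkin_piP; exact: calkin_reprK.
Qed.

(* independent of the representative, as a^* is compact when a is *)
Definition calkin_star (x : calkin) : calkin :=
  calkin_pi (bh_adj (calkin_repr x)).

Definition calkin_norm (x : calkin) : R :=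
  inf [set bh_norm a | a in [set a | calkin_pi a = x]].

(* The dimension of the range is that of its closure. *)
Definition small_range_op (I : Type) : set (BH H) :=
  [set a | hdim_lt (closure (range a)) [set: I]].

(* K is contained in J, so J/K is the image of J in B(H)/K. *)
Definition JmodK (I : Type) : set calkin := calkin_pi @` small_range_op I.

End Calkin.

Section Automorphisms.
Context {R : realType} {A : lmodType R[i]}.
Variables (mul : A -> A -> A) (star : A -> A) (nrm : A -> R) (S : set A).

Definition star_automorphism (f : A -> A) : Prop :=
  [/\ set_bij S S f,
      {in S &, {morph f : x y / x + y}},
      (forall c : R[i], {in S, {morph f : x / c *: x}}),
      {in S &, {morph f : x y / mul x y}} &
      {in S, {morph f : x / star x}}].

Definition bounded_linear_on (T : A -> A) : Prop :=
  [/\ set_fun S S T,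
      {in S &, {morph T : x y / x + y}},
      (forall c : R[i], {in S, {morph T : x / c *: x}}) &
      exists M : R, forall x, S x -> nrm (T x) <= M * nrm x].

(* The elements of the multiplier algebra M(S) are the double centralizers
   (L, R) of S: a multiplier u is the pair of x |-> u x and x |-> x u. Only the
   restrictions of L and R to S matter, hence mult_eq. *)
Definition multiplier : Type := (A -> A) * (A -> A).

Definition is_multiplier (u : multiplier) : Prop :=
  [/\ bounded_linear_on u.1 /\ bounded_linear_on u.2,
      {in S &, forall x y, u.1 (mul x y) = mul (u.1 x) y},
      {in S &, forall x y, u.2 (mul x y) = mul x (u.2 y)} &
      {in S &, forall x y, mul (u.2 x) y = mul x (u.1 y)}].

Definition mult_eq (u v : multiplier) : Prop :=
  {in S, u.1 =1 v.1} /\ {in S, u.2 =1 v.2}.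

Definition mult_one : multiplier := (id, id).

Definition mult_mul (u v : multiplier) : multiplier :=
  (u.1 \o v.1, v.2 \o u.2).

Definition mult_star (u : multiplier) : multiplier :=
  (star \o u.2 \o star, star \o u.1 \o star).

Definition mult_embed (a : A) : multiplier := (mul a, mul^~ a).

Definition mult_unitary (u : multiplier) : Prop :=
  [/\ is_multiplier u,
      mult_eq (mult_mul u (mult_star u)) mult_one &
      mult_eq (mult_mul (mult_star u) u) mult_one].

Definition inner_automorphism (f : A -> A) : Prop :=
  star_automorphism f /\
  exists2 u, mult_unitary u &
    {in S, forall a, mult_eq (mult_embed (f a))
                       (mult_mul (mult_mul u (mult_embed a)) (mult_star u))}.

(* Self-maps of S are represented by their extensions by 0 to A, so that two
   elements of this set are equal iff they agree on S. *)
Definition outer_automorphisms : set (A -> A) :=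
  [set f | [/\ star_automorphism f, ~ inner_automorphism f &
               forall x, ~ S x -> f x = 0]].

End Automorphisms.

(* Main.v *)
(* Index an orthonormal basis by E and let exp(i t), for t : E -> R, also denote
   the corresponding diagonal unitary. An element a of J has countable support,
   so modulo K it is carried by a sequence of finite blocks, and exp(i t)
   commutes with a modulo K as soon as the oscillation of t on these blocks
   tends to 0 ("t is slow for a").

   By CH, J has aleph_1 elements. Enumerate J along a well-order of type omega_1
   and construct phases t_w with t_w - t_v slow for the v-th element whenever
   v < w. Then a |-> exp(i t_w) a exp(-i t_w) is eventually constant modulo K as w
   grows, which defines an automorphism of J/K. Only countably many constraints
   are imposed at each stage, so a diagonal argument allows to go on at limit
   stages, and t_w can also be moved to t_w + k_w, where exp(i k_w) anticommutes
   with an element b_w of a fixed separable corner; adding b_w to the elements to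
   be preserved makes the two choices lead to different automorphisms. This
   gives 2^aleph_1 automorphisms which are pairwise different on the corner.

   An inner automorphism is determined on the corner by the product of the
   implementing multiplier and the unit p of the corner, an element of J/K, so only
   aleph_1 restrictions to the corner come from inner automorphisms. *)
Require Import Defs.
From mathcomp Require Import all_boot all_order all_algebra.
From mathcomp Require Import all_classical all_reals all_analysis.
From mathcomp Require Import finmap complex sesquilinear wochoice.
From mathcomp Require Import ring lra.

Set Implicit Arguments.
Unset Strict Implicit.
Unset Printing Implicit Defensive.

Import Order.TTheory GRing.Theory Num.Theory.
Import numFieldNormedType.Exports.

Local Open Scope classical_set_scope.
Local Open Scope card_scope.
Local Open Scope ring_scope.

(** * Slowly oscillating functions *)

(* A family W consists of the index sets of the finite blocks carrying an
   operator modulo compacts; exp(i f) commutes with that operator modulo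
   compacts when f is slow on W. *)
Section SlowFunctions.
Context {R : realType} {T : choiceType}.
Implicit Types (W : set {fset T}) (f g : T -> R) (e : R) (B v : {fset T}).

(** Phases are real functions rather than unimodular ones because infinitely many corrections k_n
    must be summed at a limit stage: the sum makes sense only after each k_n has been thresholded,
    which uses the order of R. Thresholding changes each k_n on a finite set only, and such changes
    are slow for every locally finite family.

    Stage w asks k_w to be slow on countably many families and yet to grow by pi along a sequence of
    N0. This is possible because ranks in a chain of finite sets are unbounded while their square
    roots have increments tending to 0. The b_w all lie in one corner with N0 countable, since p
    itself must belong to J/K in order to turn a multiplier u into an element u p of J/K.

    No cardinal subtraction is used at the end: the parameter set is split into two halves B and C,
    and Cantor's argument provides a B for which every C gives an outer automorphism. *)

Definition locally_finite W := forall i, finite_set [set v : {fset T} | W v /\ i \in v].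

Definition wide f e : set {fset T} :=
  [set v : {fset T} | exists i j, [/\ i \in v, j \in v & e < `|f i - f j|]].

Definition slow W f := forall e, 0 < e -> finite_set (W `&` wide f e).

Lemma wideP f e v : ~ wide f e v ->
  forall i j, i \in v -> j \in v -> `|f i - f j| <= e.
Proof.
move=> h i j iv jv; rewrite leNgt; apply/negP => ij.
by apply: h; exists i, j.
Qed.

Lemma slow_sub W W' f : W' `<=` W -> slow W f -> slow W' f.
Proof.
by move=> WW' sf e e0; apply: sub_finite_set (sf e e0); exact: setSI.
Qed.

Lemma slow_lip W f g : (forall i j, `|g i - g j| <= `|f i - f j|) ->
  slow W f -> slow W g.
Proof.
move=> gf sf e e0; apply: sub_finite_set (sf e e0) => v [Wv [i [j [iv jv ij]]]].
by split=> //; exists i, j; split=> //; exact: lt_le_trans ij (gf _ _).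
Qed.

Lemma slow0 W : slow W (fun=> 0).
Proof.
move=> e e0; apply: sub_finite_set (finite_set0 {fset T}) => v [_ [i [j [_ _]]]].
by rewrite subrr normr0 => /(lt_trans e0); rewrite ltxx.
Qed.

Lemma slowD W f g : slow W f -> slow W g -> slow W (fun i => f i + g i).
Proof.
move=> sf sg e e0; have e20 : 0 < e / 2 by rewrite divr_gt0.
apply: (@sub_finite_set _ _ ((W `&` wide f (e / 2)) `|` (W `&` wide g (e / 2)))).
  move=> v [Wv [i [j [iv jv ij]]]].
  have [fij|fij] := ltP (e / 2) `|f i - f j|; [left|right]; split=> //;
    exists i, j; split=> //.
  rewrite ltNge; apply/negP => gij; move: ij; apply/negP; rewrite -leNgt.
  rewrite opprD addrACA (le_trans (ler_normD _ _))//.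
  by rewrite (splitr e) lerD.
by rewrite finite_setU; split; [exact: sf|exact: sg].
Qed.

Lemma slowN W f : slow W f -> slow W (fun i => - f i).
Proof. by apply: slow_lip => i j; rewrite -opprD normrN. Qed.

Lemma slow_sum W (F : nat -> T -> R) (n m : nat) :
  (forall k, (n <= k < m)%N -> slow W (F k)) ->
  slow W (fun i => \sum_(n <= k < m) F k i).
Proof.
elim: m => [|m IHm] sF.
  by rewrite (_ : (fun=> _) = (fun=> 0)); [exact: slow0|
    apply/funext => i; rewrite big_geq].
have [nm|mn] := leqP n m; last first.
  by rewrite (_ : (fun=> _) = (fun=> 0)); [exact: slow0|
    apply/funext => i; rewrite big_geq].
rewrite (_ : (fun=> _) = (fun i => \sum_(n <= k < m) F k i + F m i)); last first.
  by apply/funext => i; rewrite big_nat_recr.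
apply: slowD; last by apply: sF; rewrite nm ltnSn.
by apply: IHm => k /andP[nk km]; apply: sF; rewrite nk (ltn_trans km).
Qed.

Lemma locally_finite_meet W B : locally_finite W ->
  finite_set [set v : {fset T} | W v /\ exists2 i, i \in B & i \in v].
Proof.
move=> lfW; apply: (@sub_finite_set _ _
  (\bigcup_(i in [set` B]) [set v : {fset T} | W v /\ i \in v])).
  by move=> v [Wv [i iB iv]]; exists i.
by apply: bigcup_finite => //; exact: finite_fset.
Qed.

Lemma slow_finite_support W f B : locally_finite W ->
  (forall i, i \notin B -> f i = 0) -> slow W f.
Proof.
move=> lfW f0 e e0; apply: sub_finite_set (locally_finite_meet B lfW).
move=> v [Wv [i [j [iv jv ij]]]]; split=> //.
have [iB|iB] := boolP (i \in B); first by exists i.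
have [jB|jB] := boolP (j \in B); first by exists j.
by move: ij; rewrite !f0// subrr normr0 => /(lt_trans e0); rewrite ltxx.
Qed.

Lemma locally_finiteU W W' : locally_finite W -> locally_finite W' ->
  locally_finite (W `|` W').
Proof.
move=> lfW lfW' i; apply: (@sub_finite_set _ _
   ([set v : {fset T} | W v /\ i \in v] `|` [set v : {fset T} | W' v /\ i \in v])).
  by move=> v [[Wv|Wv] iv]; [left|right].
by rewrite finite_setU.
Qed.

(** Its iterates are the chains behind [cutoff] and [slow_split]: leaving a link of such a chain
    through a single block never goes beyond the next link. *)
Lemma locally_finite_star W B : locally_finite W ->
  exists B', {subset B <= B'} /\
    forall v, W v -> (exists2 i, i \in B & i \in v) -> {subset v <= B'}.
Proof.
move=> lfW; have fin := locally_finite_meet B lfW.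
have /finite_fsetP[X XE] : finite_set
    ([set` B] `|` \bigcup_(v in [set v : {fset T} | W v /\ exists2 i, i \in B & i \in v])
       [set` v]).
  rewrite finite_setU; split; first exact: finite_fset.
  by apply: bigcup_finite => // v _; exact: finite_fset.
exists X; split=> [i iB|v Wv vB i iv].
  by have : [set` X] i by rewrite -XE; left.
by have : [set` X] i by rewrite -XE; right; exists v.
Qed.

Lemma finite_wide_bound W f e : slow W f -> 0 < e ->
  exists B, forall v, W v -> wide f e v -> {subset v <= B}.
Proof.
move=> sf e0.
have /finite_fsetP[X XE] : finite_set
    (\bigcup_(v in W `&` wide f e) [set` v]).
  by apply: bigcup_finite; [exact: sf|move=> v _; exact: finite_fset].
exists X => v Wv fv i iv.
by have : [set` X] i by rewrite -XE; exists v.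
Qed.

Lemma fset_bound f B : exists2 M, 0 <= M & forall i, i \in B -> `|f i| <= M.
Proof.
exists (\sum_(i <- B) `|f i|); first exact: sumr_ge0.
move=> i iB; rewrite (big_fsetD1 i)//= lerDl; exact: sumr_ge0.
Qed.

(** The value at i is e times the number of sets, among N successive enlargements of B by [h], that
    contain i. A block reaches at most one enlargement further, so the count varies by at most 1 on
    it. *)
Lemma cutoff W B e (M : R) : locally_finite W -> 0 < e -> 0 <= M ->
  exists psi : T -> R, [/\ forall i, 0 <= psi i,
    forall i, i \in B -> M <= psi i,
    exists B', forall i, i \notin B' -> psi i = 0 &
    forall v i j, W v -> i \in v -> j \in v -> `|psi i - psi j| <= e].
Proof.
move=> lfW e0 M0.
have [h hP] := choice (fun B => locally_finite_star B lfW).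
pose F n := iter n h B.
pose N := (Num.truncn (M / e)).+1.
have MN : M <= e * N%:R.
  rewrite mulrC -ler_pdivrMr// ltW//; apply: Num.Theory.truncnS_gt.
pose psi i := e * (\sum_(n < N) (i \in F n))%:R.
have FS n i : i \in F n -> i \in F n.+1 by move=> iF; apply: (hP (F n)).1.
have Fle m n i : (m <= n)%N -> i \in F m -> i \in F n.
  move=> /subnK <-; elim: (n - m)%N => // k IHk iF.
  by rewrite addSn; apply: FS; exact: IHk.
exists psi; split.
- by move=> i; rewrite mulr_ge0// ltW.
- move=> i iB; rewrite (le_trans MN)// ler_pM2l// ler_nat.
  rewrite (eq_bigr (fun=> 1%N)) ?sum1_card ?card_ord// => n _.
  by rewrite (Fle 0 n i _ iB).
- exists (F N) => i iFN; rewrite /psi big1 ?mulr0// => n _.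
  have [iF|//] := boolP (i \in F n); move: iFN; rewrite (Fle n)//.
  exact/ltnW/ltn_ord.
- have key v i j : W v -> i \in v -> j \in v ->
     (\sum_(n < N) (i \in F n) <= \sum_(n < N) (j \in F n) + 1)%N.
    move=> Wv iv jv.
    apply: (@leq_trans (\sum_(n < N) (j \in F n.+1))).
      apply: leq_sum => n _; have [iF|//] := boolP (i \in F n).
      by rewrite (_ : j \in F n.+1)//; apply: (hP (F n)).2 jv => //; exists i.
    have E : ((j \in F 0) + \sum_(n < N) (j \in F n.+1) =
        \sum_(n < N) (j \in F n) + (j \in F N))%N.
      transitivity (\sum_(n < N.+1) (j \in F n))%N.
        by rewrite big_ord_recl.
      by rewrite big_ord_recr.
    rewrite -(leq_add2l (j \in F 0)) E addnCA leq_add2l.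
    by case: (j \in F N) => //; rewrite addn1.
  move=> v i j Wv iv jv; rewrite /psi -mulrBr normrM gtr0_norm//.
  rewrite -[leRHS]mulr1 ler_pM2l//.
  have := key v i j Wv iv jv; have := key v j i Wv jv iv.
  rewrite -!(ler_nat R) !natrD ler_norml => h1 h2.
  by apply/andP; split; lra.
Qed.

(* Soft thresholding of t at level s; the level will vary from point to point. *)
Definition shrink (s t : R) : R :=
  if s < t then t - s else if t < - s then t + s else 0.

Lemma shrink_lip (s t s' t' : R) : 0 <= s -> 0 <= s' ->
  `|shrink s t - shrink s' t'| <= `|t - t'| + `|s - s'|.
Proof.
move=> s0 s0'; rewrite /shrink.
have A := ler_norm (t - t'); have B := ler_norm (s - s').
have C := ler_norm (t' - t); have D := ler_norm (s' - s).
rewrite distrC in C; rewrite distrC in D.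
rewrite ler_norml; apply/andP.
by case: ltP => ?; try case: ltP => ?; try case: ltP => ?; try case: ltP => ?;
   split; lra.
Qed.

Lemma shrink0 (t : R) : shrink 0 t = t.
Proof. by rewrite /shrink oppr0 addr0; case: ltgtP. Qed.

Lemma shrink_eq0 (s t : R) : `|t| <= s -> shrink s t = 0.
Proof. by rewrite ler_norml /shrink => /andP[? ?]; case: ltP => ?; [lra|case: ltP => ?; lra]. Qed.

End SlowFunctions.
Lemma countable_enum {T : Type} (t0 : T) (A : set T) : countable A ->
  exists g : nat -> T,
    (forall m, A (g m) \/ g m = t0) /\ forall i, A i -> exists m, g m = i.
Proof.
move/countable_injP => [h hinj].
exists (fun m => if pselect (exists2 i, A i & h i = m) is left P
                 then sval (cid2 P) else t0); split=> [m|i Ai].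
  by case: pselect => [P|_]; [left; case: cid2|right].
exists (h i); case: pselect => [P|]; last by case; exists i.
by case: cid2 => /= j Aj hj; exact: hinj (mem_set Aj) (mem_set Ai) hj.
Qed.

(** * Limits of slow functions along increasing sequences of families *)

Section SlowFamilies.
Context {R : realType} {T : choiceType}.
Implicit Types (W : set {fset T}) (B : {fset T}).

(* The sum of the k_n need not make sense, so k_n is replaced by its shrinking
   k'_n at a finitely supported level: k'_n vanishes on the first n points of
   the union of the families, oscillates by at most 2^-n on the members of W_n,
   and differs from k_n on a finite set only. *)
Lemma slow_limit (W : nat -> set {fset T}) (k : nat -> T -> R) :
  (forall n, locally_finite (W n)) -> (forall n, countable (W n)) ->
  (forall m n, (m <= n)%N -> W m `<=` W n) -> (forall n, slow (W n) (k n)) ->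
  exists f : T -> R, forall n, slow (W n) (fun i => f i - \sum_(0 <= m < n) k m i).
Proof.
move=> lfW cW mW sk.
have [T0|/set0P[t0 _]] := eqVneq [set: T] set0.
  exists (fun=> 0) => n e e0; apply: sub_finite_set (finite_set0 {fset T}).
  by move=> v [_ [i _]]; have : [set: T] i by []; rewrite T0.
have [g gP] : exists g : nat -> T,
    forall n v i, W n v -> i \in v -> exists m, g m = i.
  pose A := \bigcup_n \bigcup_(v in W n) [set` v].
  have cA : countable A.
    apply: bigcup_countable => // n _; exact: bigcup_countable.
  have [g [_ gA]] := countable_enum t0 cA.
  by exists g => n v i Wv iv; apply: gA; exists n => //; exists v.
pose F n : {fset T} := [fset g (val m) | m in 'I_n.+1]%fset.
have FP m n : (m <= n)%N -> g m \in F n.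
  by move=> mn; apply/imfsetP; exists (Ordinal (mn : (m < n.+1)%N)).
have step n : exists psi : T -> R, [/\ forall i, 0 <= psi i,
    forall i, i \in F n -> `|k n i| <= psi i,
    exists B', forall i, i \notin B' -> psi i = 0 &
    forall v i j, W n v -> i \in v -> j \in v ->
      `|shrink (psi i) (k n i) - shrink (psi j) (k n j)| <= 2^-1 ^+ n].
  have e0 : 0 < (2^-1 ^+ n.+1 : R) by rewrite exprn_gt0.
  have [X XP] := finite_wide_bound (sk n) e0.
  have [M M0 MP] := fset_bound (k n) (X `|` F n)%fset.
  have [psi [p0 pM [B' pB'] po]] := cutoff (X `|` F n)%fset (lfW n) e0 M0.
  exists psi; split=> //.
  - move=> i iF; have iXF : i \in (X `|` F n)%fset by rewrite inE iF orbT.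
    by apply: le_trans (MP i iXF) (pM i iXF).
  - by exists B'.
  - move=> v i j Wv iv jv.
    (* Either v is one of the finitely many wide blocks, contained in X, where the level is at least
       [|k n|] and the shrunk function vanishes, or [k n] and the level each oscillate by at most
       half of 2^-n. *)
    have [wv|wv] := pselect (wide (k n) (2^-1 ^+ n.+1) v).
      have inX l : l \in v -> shrink (psi l) (k n l) = 0.
        move=> lv; have lXF : l \in (X `|` F n)%fset by rewrite inE (XP v Wv wv).
        by rewrite shrink_eq0// (le_trans (MP l lXF))// pM.
      by rewrite !inX// subrr normr0 exprn_ge0.
    rewrite (le_trans (shrink_lip _ _ _ _))//.
    have -> : (2^-1 ^+ n : R) = 2^-1 ^+ n.+1 + 2^-1 ^+ n.+1.
      by rewrite exprS; lra.
    by rewrite lerD//; [apply: (wideP wv)|apply: (po v)].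
have [psi psiP] := choice step; pose k' n i := shrink (psi n i) (k n i).
have k'0 m n : (m <= n)%N -> k' n (g m) = 0.
  move=> mn; rewrite /k' shrink_eq0//.
  by have [_ + _ _] := psiP n; apply; exact: FP.
(* Pointwise a finite sum, since [k' n] vanishes at [g m] for n >= m; [fE] shows that the index
   picked for i does not matter. *)
pose f i := if pselect (exists m, g m = i) is left P
            then \sum_(0 <= n < sval (cid P)) k' n i else 0.
have fE m n : (m <= n)%N -> f (g m) = \sum_(0 <= l < n) k' l (g m).
  move=> mn; rewrite /f; case: pselect => [P|[]]; last by exists m.
  case: cid => /= m' gm'.
  have aux p q : g p = g m -> (p <= q)%N -> \sum_(0 <= l < q) k' l (g m) =
      \sum_(0 <= l < p) k' l (g m).
    move=> gp pq; rewrite (big_cat_nat (n := p))//= [X in _ + X]big1_seq ?addr0// => l.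
    by move=> /andP[_]; rewrite mem_index_iota => /andP[pl _]; rewrite -gp k'0.
  by rewrite -(aux m' (maxn m' n)) ?leq_maxl// (aux m)// ?(aux m n)// ?leq_max ?mn ?orbT.
have k'k n m : slow (W n) (fun i => k' m i - k m i).
  have [_ _ [B' pB'] _] := psiP m.
  by apply: (slow_finite_support (B := B')) => // i /pB' E; rewrite /k' E shrink0 subrr.
have k's n m : (n <= m)%N -> slow (W n) (k' m).
  move=> nm; rewrite (_ : k' m = (fun i => (k' m i - k m i) + k m i)).
    by apply: slowD (k'k n m) _; exact: slow_sub (mW _ _ nm) (sk m).
  by apply/funext => i; rewrite subrK.
exists f => n e e0.
(* From p on, the terms oscillate by at most 2^-p + 2^-(p+1) + ... = 2 * 2^-p in total on a block of
   [W n]. Below p there are finitely many terms, and each is slow up to the subtracted [k m]. *)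
have [p np pe] : exists2 p, (n <= p)%N & (2^-1 ^+ p * 2 : R) < e / 2.
  have := @cvg_geometric R 2 (2^-1); rewrite ger0_norm ?invr_ge0//.
  rewrite invf_lt1 ?ltr1n// => /(_ isT) /cvgrPdist_lt /(_ (e / 2)).
  rewrite divr_gt0// => /(_ isT) [N _ NP].
  exists (maxn n N); first exact: leq_maxl.
  have := NP (maxn n N) (leq_maxr _ _); rewrite sub0r normrN.
  by rewrite /geometric /= ger0_norm ?mulr_ge0 ?exprn_ge0 ?invr_ge0// mulrC.
pose h i := \sum_(0 <= m < n) (k' m i - k m i) + \sum_(n <= m < p) k' m i.
have sh : slow (W n) h.
  apply: slowD; first by apply: slow_sum.
  by apply: slow_sum => m /andP[nm _]; exact: k's.
have e20 : 0 < e / 2 by rewrite divr_gt0.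
apply: sub_finite_set (sh _ e20) => v [Wv [i [j [iv jv ij]]]]; split=> //.
exists i, j; split=> //.
have [mi gi] := gP n v i Wv iv; have [mj gj] := gP n v j Wv jv.
pose q := maxn p (maxn mi mj).
have pq : (p <= q)%N by rewrite leq_maxl.
have fh l m : g m = l -> (m <= q)%N -> f l - \sum_(0 <= m < n) k m l =
    h l + \sum_(p <= m < q) k' m l.
  move=> <- mq; rewrite (fE _ _ mq) /h sumrB.
  rewrite (big_cat_nat (n := n))//=; last exact: leq_trans np pq.
  by rewrite (big_cat_nat (n := p) (m := n))//=; ring.
move: ij; rewrite (fh i mi)// ?(fh j mj)// /q ?leq_max ?leqnn ?orbT// -/q.
rewrite opprD addrACA -sumrB => ij.
have tail : `|\sum_(p <= m < q) (k' m i - k' m j)| <= 2^-1 ^+ p * 2.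
  rewrite (le_trans (ler_norm_sum _ _ _))//.
  have tb : \sum_(p <= m < q) `|k' m i - k' m j| <= \sum_(p <= m < q) 2^-1 ^+ m.
    apply: ler_sum_nat => m /andP[pm _]; have [_ _ _ +] := psiP m.
    by apply; [exact: mW (leq_trans np pm) _ Wv|exact: iv|exact: jv].
  rewrite (le_trans tb)//.
  have -> : \sum_(p <= m < q) (2^-1 : R) ^+ m =
      2^-1 ^+ p * 2 - 2^-1 ^+ q * 2.
    elim: (q) pq => [|q' IH]; first by rewrite leqn0 => /eqP->; rewrite big_geq// subrr.
    rewrite leq_eqVlt => /orP[/eqP->|]; first by rewrite big_geq// subrr.
    rewrite ltnS => pq'; rewrite big_nat_recr//= IH// exprS; lra.
  by rewrite gerBl mulr_ge0// exprn_ge0.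
have := ler_normD (h i - h j) (\sum_(p <= m < q) (k' m i - k' m j)).
move=> /(lt_le_trans ij) ij'; lra.
Qed.

End SlowFamilies.
(* f is pi times the square root of the rank of a point in a chain of finite
   sets F_n such that a member of W_n meeting F_n is contained in F_(n+1). *)
Lemma slow_split {R : realType} {T : choiceType} (W : nat -> set {fset T})
    (N0 : set T) :
  (forall n, locally_finite (W n)) ->
  (forall m n, (m <= n)%N -> W m `<=` W n) -> infinite_set N0 ->
  exists (f : T -> R) (z : nat -> T), [/\ forall n, slow (W n) f,
    injective z, forall n, N0 (z n) & forall n, f (z n) = pi * n.+1%:R].
Proof.
move=> lfW mW N0inf.
have step (nB : nat * {fset T}) : exists Bx : {fset T} * T,
    [/\ {subset nB.2 <= Bx.1}, N0 Bx.2 /\ Bx.2 \notin nB.2, Bx.2 \in Bx.1 &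
     forall v, W nB.1 v -> (exists2 i, i \in nB.2 & i \in v) ->
       {subset v <= Bx.1}].
  case: nB => n B /=; have [B' [BB' B'v]] := locally_finite_star B (lfW n).
  have /infinite_setN0[x [N0x xB]] := infinite_setD N0inf (finite_fset B).
  exists ((x |` B')%fset, x) => /=; split.
  - by move=> i iB; rewrite !inE BB' ?orbT.
  - by split=> //; apply/negP.
  - by rewrite !inE eqxx.
  - by move=> v Wv vB i iv; rewrite !inE (B'v v) ?orbT.
have [h hP] := choice step.
pose F := fix F n := if n is m.+1 then (h (m, F m)).1 else (fset0 : {fset T}).
pose x n := (h (n, F n)).2.
have Fle m n : (m <= n)%N -> {subset F m <= F n}.
  move=> /subnK <-; elim: (n - m)%N => // k IH i /IH.
  by have [+ _ _ _] := hP ((k + m)%N, F (k + m)%N); apply.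
have xF n : x n \notin F n /\ x n \in F n.+1.
  by have [_ [_ ? ?] _] := hP (n, F n).
have Fv k n v : (k <= n)%N -> W k v -> (exists2 i, i \in F n & i \in v) ->
    {subset v <= F n.+1}.
  by move=> kn Wv; have [_ _ _] := hP (n, F n); apply; exact: mW Wv.
(* The rank of i in the chain, 0 off the chain. As [F 0] is empty, points of the chain have rank at
   least 1. *)
pose r i := if pselect (exists n, i \in F n) is left P then ex_minn P else 0%N.
have rP i n : i \in F n -> (r i <= n)%N /\ i \in F (r i).
  move=> iF; rewrite /r; case: pselect => [P|[]]; last by exists n.
  by case: ex_minnP => m iFm mmin; split=> //; exact: mmin.
have rx n : r (x n) = n.+1.
  have [xn xn1] := xF n; have [r1 r2] := rP _ _ xn1.
  apply/eqP; rewrite eqn_leq r1 ltnNge /=; apply/negP => rn.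
  by move/negP: xn; apply; exact: Fle rn _ r2.
(* The rank of [x m] is m + 1, so this index gives [z n] the rank (n+1)^2, whose root is n + 1. *)
pose z n := x (n.+1 ^ 2).-1.
pose f i : R := pi * Num.sqrt (r i)%:R.
have zr n : r (z n) = (n.+1 ^ 2)%N by rewrite rx prednK// expn_gt0.
have pi0 := pi_gt0 R.
exists f, z; split; last 3 first.
- move=> m n /(congr1 r); rewrite !zr => /eqP.
  by rewrite eqn_exp2r// => /eqP[].
- by move=> n; have [_ [? _] _ _] := hP ((n.+1 ^ 2).-1, F (n.+1 ^ 2).-1).
- by move=> n; rewrite /f zr natrX sqrtr_sqr ger0_norm.
move=> k e e0.
(* Beyond rank N consecutive square roots s <= t differ by at most 1 / s <= e / pi; N >= k makes the
   chain respect the blocks of [W k]. *)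
pose N := maxn k (Num.truncn ((pi / e) ^+ 2)).+1.
have small a b : (N <= a)%N -> (a <= b)%N -> (b <= a.+1)%N ->
    pi * Num.sqrt b%:R - pi * Num.sqrt a%:R <= e.
  move=> Na ab ba; rewrite -mulrBr -ler_pdivlMl// mulrC.
  set s := Num.sqrt a%:R; set t := Num.sqrt b%:R.
  have s0 : 0 <= s by exact: sqrtr_ge0.
  have st : s <= t by rewrite ler_sqrt ?ler_nat// ?ler0n.
  have s2 : s ^+ 2 = a%:R by rewrite sqr_sqrtr.
  have t2 : t ^+ 2 = b%:R by rewrite sqr_sqrtr.
  have sbig : pi / e <= s.
    have c0 : 0 <= pi / e by rewrite divr_ge0// ltW.
    rewrite -(@ler_pXn2r _ 2)// s2.
    apply/ltW/(lt_le_trans (Num.Theory.truncnS_gt _)).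
    by rewrite ler_nat (leq_trans _ Na)//; exact: leq_maxr.
  have : b%:R <= a%:R + 1 :> R by rewrite natr1 ler_nat.
  rewrite -s2 -t2 => tts.
  have -> : e / pi = (pi / e)^-1 by rewrite invf_div.
  have c0 : 0 < pi / e by rewrite divr_gt0.
  rewrite -[leRHS]mul1r ler_pdivlMr//.
  nra.
(* A block that avoids [F N] is either disjoint from the chain, where f is 0, or contained in it
   with ranks at least N that differ by at most 1. *)
apply: sub_finite_set (locally_finite_meet (F N) (lfW k)).
move=> v [Wv [i [j [iv jv ij]]]]; split=> //.
apply: contrapT => vN.
have big l : l \in v -> (exists n, l \in F n) -> (N <= r l)%N.
  move=> lv [n lF]; have [_ lFr] := rP _ _ lF.
  rewrite leqNgt; apply/negP => rN; apply: vN; exists l => //.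
  exact: Fle (ltnW rN) _ lFr.
have nxt l l' : l \in v -> l' \in v -> (exists n, l \in F n) ->
    (r l' <= (r l).+1)%N /\ exists n, l' \in F n.
  move=> lv lv' lF; have Nl := big l lv lF; case: lF => n lF.
  have [_ lFr] := rP _ _ lF.
  have l'F : l' \in F (r l).+1.
    apply: (Fv k (r l) v) => //; last by exists l.
    by apply: leq_trans Nl; rewrite leq_max leqnn.
  by split; [have [] := rP _ _ l'F|exists (r l).+1].
have [iF|iF] := pselect (exists n, i \in F n).
  have [rji jF] := nxt i j iv jv iF; have [rij _] := nxt j i jv iv jF.
  move: ij; rewrite /f; apply/negP; rewrite -leNgt.
  have [rr|rr] := leqP (r i) (r j).
    rewrite distrC ger0_norm ?small ?big//.
    by rewrite subr_ge0 ler_pM2l// ler_sqrt ?ler_nat// ?ler0n.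
  rewrite ger0_norm ?small ?big ?(ltnW rr)//.
  by rewrite subr_ge0 ler_pM2l// ler_sqrt ?ler_nat// ?ler0n// ltnW.
have jF : ~ exists n, j \in F n.
  by move=> jF; apply: iF; have [] := nxt j i jv iv jF.
have r0 l : ~ (exists n, l \in F n) -> r l = 0%N.
  by rewrite /r; case: pselect.
move: ij; rewrite /f !r0// subrr normr0 => /(lt_trans e0).
by rewrite ltxx.
Qed.

Section Upto.
Context {R : realType} {T : choiceType}.
Implicit Types (W : nat -> set {fset T}).

(** Makes an arbitrary sequence of families increasing, as [slow_limit] and [slow_split] require. *)
Definition upto W n : set {fset T} := \bigcup_(k in `I_n.+1) W k.

Lemma sub_upto W m n : (m <= n)%N -> W m `<=` upto W n.
Proof. by move=> mn v Wv; exists m. Qed.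

Lemma upto_mono W m n : (m <= n)%N -> upto W m `<=` upto W n.
Proof. by move=> mn v [k km Wv]; exists k => //; exact: (leq_trans km (mn : (m.+1 <= n.+1)%N)). Qed.

Lemma locally_finite_upto W n :
  (forall n, locally_finite (W n)) -> locally_finite (upto W n).
Proof.
move=> lfW i; apply: (@sub_finite_set _ _
   (\bigcup_(k in `I_n.+1) [set v : {fset T} | W k v /\ i \in v])).
  by move=> v [[k kn Wv] iv]; exists k.
by apply: bigcup_finite => [|k _]; [exact: finite_II|exact: lfW].
Qed.

Lemma countable_upto W n : (forall n, countable (W n)) -> countable (upto W n).
Proof. by move=> cW; apply: bigcup_countable. Qed.

Lemma slow_upto W n (f : T -> R) :
  (forall k, (k <= n)%N -> slow (W k) f) -> slow (upto W n) f.
Proof.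
move=> sf e e0; apply: (@sub_finite_set _ _ (\bigcup_(k in `I_n.+1) (W k `&` wide f e))).
  by move=> v [[k kn Wv] wv]; exists k.
by apply: bigcup_finite => [|k kn]; [exact: finite_II|exact: sf].
Qed.

End Upto.

(** * Orthonormal sets in a Hilbert space *)

Section RealNorm.
Context {R : realType}.
Local Open Scope complex_scope.

(* The norm of a complex normed module takes its values in R[i]. *)
Definition nm {V : normedZmodType R[i]} (x : V) : R := complex.Re `|x|.

Section NormedZmodule.
Context {V : normedZmodType R[i]}.
Implicit Types x y : V.

Lemma nmE x : `|x| = (nm x)%:C.
Proof. by rewrite /nm RRe_real// normr_real. Qed.

Lemma nm_ge0 x : 0 <= nm x.
Proof. by rewrite -ler0c -nmE. Qed.

Lemma nm0 : nm (0 : V) = 0.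
Proof. by rewrite /nm normr0. Qed.

Lemma nm_eq0 x : nm x = 0 -> x = 0.
Proof. by move=> x0; apply/eqP; rewrite -normr_eq0 nmE x0. Qed.

Lemma nmN x : nm (- x) = nm x.
Proof. by rewrite /nm normrN. Qed.

Lemma nmBC x y : nm (x - y) = nm (y - x).
Proof. by rewrite -nmN opprB. Qed.

Lemma nmD x y : nm (x + y) <= nm x + nm y.
Proof. by rewrite -lecR rmorphD /= -!nmE ler_normD. Qed.

Lemma nmB x y z : nm (x - z) <= nm (x - y) + nm (y - z).
Proof. by rewrite (le_trans _ (nmD _ _))// addrA subrK. Qed.

End NormedZmodule.

Lemma nmZ {V : normedModType R[i]} (c : R[i]) (x : V) : nm (c *: x) = nm c * nm x.
Proof. by apply/complexI; rewrite -nmE normrZ !nmE rmorphM. Qed.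

Lemma nmM (c d : R[i]) : nm (c * d) = nm c * nm d.
Proof. by apply/complexI; rewrite -nmE normrM !nmE rmorphM. Qed.

Lemma nmC (c : R) : nm c%:C = `|c|.
Proof. by rewrite /nm normc_def /= expr0n /= addr0 sqrtr_sqr. Qed.

Lemma nm1 : nm (1 : R[i]) = 1.
Proof. by rewrite (nmC 1) normr1. Qed.

Lemma sqr_nm (c : R[i]) : (nm c ^+ 2)%:C = c * c^*%C.
Proof. by rewrite rmorphXn /= -nmE sqr_normc. Qed.

Lemma nm_bounded_linear {V : normedModType R[i]} (f : V -> V) (M : R) :
  (forall x, nm (f x) <= M * nm x) <-> (forall x, `|f x| <= M%:C * `|x|).
Proof.
by split=> h x; move: (h x); rewrite !nmE -rmorphM lecR.
Qed.

End RealNorm.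

Section InnerProduct.
Context {R : realType} {H : hilbertType R}.
Implicit Types (x y z : H) (E : set H) (F G : {fset H}).
Local Open Scope complex_scope.

Lemma hdotJ x y : hdot x y = (hdot y x)^*.
Proof. by rewrite hermC /= expr0 mul1r. Qed.

Lemma hdotxx x : hdot x x = (nm x ^+ 2)%:C.
Proof. by rewrite -sqr_norm_hdot nmE rmorphXn. Qed.

Lemma hdotDl x y z : hdot (x + y) z = hdot x z + hdot y z.
Proof. by rewrite linearDl. Qed.
Lemma hdotDr x y z : hdot x (y + z) = hdot x y + hdot x z.
Proof. by rewrite linearDr. Qed.
Lemma hdotBl x y z : hdot (x - y) z = hdot x z - hdot y z.
Proof. by rewrite linearBl. Qed.
Lemma hdotBr x y z : hdot x (y - z) = hdot x y - hdot x z.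
Proof. by rewrite linearBr. Qed.
Lemma hdotZl c x y : hdot (c *: x) y = c * hdot x y.
Proof. by rewrite linearZl_LR. Qed.
Lemma hdotZr c x y : hdot x (c *: y) = c^*%C * hdot x y.
Proof. by rewrite linearZr_LR. Qed.
Lemma hdot0l y : hdot 0 y = 0. Proof. by rewrite linear0l. Qed.
Lemma hdot0r y : hdot y 0 = 0. Proof. by rewrite linear0r. Qed.

Lemma hdot_suml (s : seq H) (u : H -> H) y :
  hdot (\sum_(f <- s) u f) y = \sum_(f <- s) hdot (u f) y.
Proof.
by elim/big_rec2: _ => [|f x z _ <-]; rewrite ?hdot0l// hdotDl.
Qed.

Lemma hdot_sumr (s : seq H) (u : H -> H) y :
  hdot y (\sum_(f <- s) u f) = \sum_(f <- s) hdot y (u f).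
Proof.
by elim/big_rec2: _ => [|f x z _ <-]; rewrite ?hdot0r// hdotDr.
Qed.

Lemma nm_pythagoras x y : hdot x y = 0 -> nm (x + y) ^+ 2 = nm x ^+ 2 + nm y ^+ 2.
Proof.
move=> xy; apply/complexI; rewrite rmorphD /= -!hdotxx hdotDl !hdotDr xy.
by rewrite (hdotJ y x) xy conjc0 addr0 add0r.
Qed.

Lemma cauchy_schwarz x y : nm (hdot x y) <= nm x * nm y.
Proof.
have [->|y0] := eqVneq y 0; first by rewrite hdot0r !nm0 mulr0.
have ny0 : 0 < nm y.
  by rewrite lt_neqAle nm_ge0 andbT eq_sym; apply: contra_neq y0; exact: nm_eq0.
have yy0 : hdot y y != 0.
  by rewrite hdotxx; apply/negP => /eqP /complexI/eqP; rewrite sqrf_eq0 gt_eqF.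
pose p := (hdot x y / hdot y y) *: y.
have pxp : hdot (x - p) p = 0.
  rewrite hdotBl /p !hdotZr !hdotZl -mulrBr.
  by rewrite divfK// subrr mulr0.
have px : nm p ^+ 2 <= nm x ^+ 2.
  by rewrite -[in leRHS](subrK p x) nm_pythagoras// lerDr sqr_ge0.
have pE : nm p = nm (hdot x y) / nm y.
  rewrite /p nmZ nmM hdotxx.
  have -> : nm ((nm y ^+ 2)%:C^-1) = (nm y ^+ 2)^-1.
    by rewrite -fmorphV /= nmC ger0_norm// invr_ge0 sqr_ge0.
  by field; rewrite gt_eqF.
move: px; rewrite ler_pXn2r ?nnegrE ?nm_ge0// pE ler_pdivrMr//.
Qed.

Lemma nm_converges (u : nat -> H) :
  (forall e, 0 < e -> exists N, forall n m, (N <= n)%N -> (N <= m)%N ->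
     nm (u n - u m) < e) ->
  exists x, forall e, 0 < e -> exists N, forall n, (N <= n)%N -> nm (x - u n) < e.
Proof.
move=> uc.
have : cvg (u @ \oo).
  apply: cauchy_cvg; apply: cauchy_exP => e e0.
  have e0' : 0 < complex.Re e by move: e0; rewrite ltcE => /andP[].
  have eE : e = (complex.Re e)%:C by rewrite RRe_real// gtr0_real.
  have [N NP] := uc _ e0'.
  exists (u N), N => // n /= Nn.
  by rewrite -ball_normE /= nmE eE ltcR; exact: NP.
move=> /cvg_ex[x /cvgrPdist_lt ux]; exists x => e e0.
have /ux[N _ NP] : 0 < e%:C :> R[i] by rewrite ltcR.
by exists N => n /NP; rewrite nmE ltcR.
Qed.

Definition orthonormal_set E := {in E &, forall x y, hdot x y = (x == y)%:R}.

Definition total_set E := forall x, (forall e, E e -> hdot x e = 0) -> x = 0.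

Definition fsub F E := forall e, e \in F -> E e.

(** The orthogonal projection on the span of F when F is orthonormal; infinite expansions are always
    handled through finite F. *)
Definition proj F x := \sum_(f <- F) hdot x f *: f.

Definition energy F (c : H -> R[i]) : R := \sum_(f <- F) nm (c f) ^+ 2.

Lemma energy_ge0 F c : 0 <= energy F c.
Proof. by apply: sumr_ge0 => f _; rewrite sqr_ge0. Qed.

Lemma eq_energy F c d : (forall f, f \in F -> c f = d f) -> energy F c = energy F d.
Proof. by move=> cd; apply: eq_big_seq => f /cd->. Qed.

Lemma le_energy F c d : (forall f, f \in F -> nm (c f) <= nm (d f)) ->
  energy F c <= energy F d.
Proof.
move=> cd; rewrite /energy !big_seq; apply: ler_sum => f /cd.
by rewrite ler_pXn2r ?nnegrE ?nm_ge0.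
Qed.

Section Orthonormal.
Variables (E : set H) (oE : orthonormal_set E).

Lemma big_fsub (V : nmodType) F G (u : H -> V) : {subset F <= G} ->
  \sum_(f <- G) u f =
  \sum_(f <- F) u f + \sum_(f <- G) (if f \in F then 0 else u f).
Proof.
move=> FG; rewrite (bigID (fun f => f \in F))/=; congr (_ + _); last first.
  by rewrite big_mkcond /=; apply: eq_bigr => f _; case: (f \in F).
rewrite -big_filter; apply/perm_big/uniq_perm; rewrite ?filter_uniq ?fset_uniq// => f.
by rewrite mem_filter; apply: andb_idr => /FG.
Qed.

Lemma hdot_comb F c e : fsub F E -> E e ->
  hdot (\sum_(f <- F) c f *: f) e = if e \in F then c e else 0.
Proof.
move=> FE Ee; rewrite hdot_suml.
have dot f : f \in F -> hdot f e = (f == e)%:R.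
  by move=> /FE Ef; rewrite oE// mem_set.
case: ifPn => eF.
  rewrite (big_fsetD1 e)//= hdotZl dot// eqxx mulr1 big_seq big1 ?addr0// => f.
  by rewrite !inE => /andP[fe fF]; rewrite hdotZl dot// (negbTE fe) mulr0.
rewrite big_seq big1// => f fF; rewrite hdotZl dot//.
by case: eqP => [fe|_]; [rewrite fe (negbTE eF) in fF|rewrite mulr0].
Qed.

Lemma nm_comb F c : fsub F E -> nm (\sum_(f <- F) c f *: f) ^+ 2 = energy F c.
Proof.
move=> FE; apply/complexI; rewrite -hdotxx hdot_sumr /energy rmorph_sum /=.
apply: eq_big_seq => f fF; rewrite hdotZr hdot_comb//; last exact: FE.
by rewrite fF sqr_nm mulrC.
Qed.

Lemma hdot_proj F x e : fsub F E -> E e ->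
  hdot (proj F x) e = if e \in F then hdot x e else 0.
Proof. by move=> FE Ee; rewrite hdot_comb. Qed.

(** Pythagoras, since x - [proj F x] is orthogonal to every f in F; in particular no combination
    over F is closer to x than the projection. *)
Lemma nm_sub_comb F c x : fsub F E ->
  nm (x - \sum_(f <- F) c f *: f) ^+ 2 =
  nm (x - proj F x) ^+ 2 + energy F (fun f => hdot x f - c f).
Proof.
move=> FE; rewrite -nm_comb// -nm_pythagoras.
  have -> : \sum_(f <- F) (hdot x f - c f) *: f =
      proj F x - \sum_(f <- F) c f *: f.
    by rewrite -sumrB; apply: eq_bigr => f _; rewrite scalerBl.
  by rewrite addrA subrK.
rewrite hdot_sumr big_seq big1// => f fF; have Ef := FE f fF.
by rewrite hdotZr hdotBl hdot_proj// fF subrr mulr0.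
Qed.

Lemma nm_sub_proj F x : fsub F E ->
  nm x ^+ 2 = nm (x - proj F x) ^+ 2 + energy F (hdot x).
Proof.
move=> FE; have := @nm_sub_comb F (fun=> 0) x FE.
rewrite [X in x - X]big1 ?subr0; last by move=> f _; rewrite scale0r.
by move=> ->; congr (_ + _); apply: eq_energy => f _; rewrite subr0.
Qed.

Lemma bessel F x : fsub F E -> energy F (hdot x) <= nm x ^+ 2.
Proof. by move=> FE; rewrite [leRHS](nm_sub_proj x FE) lerDr sqr_ge0. Qed.

Lemma nm_proj F x : fsub F E -> nm (proj F x) <= nm x.
Proof.
move=> FE; rewrite -(@ler_pXn2r _ 2) ?nnegrE ?nm_ge0// nm_comb//; exact: bessel.
Qed.

(** Finite sets whose energy comes within (n+1)^-2 of the supremum give a Cauchy sequence: a finite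
    set containing [F n] adds less than that energy. *)
Lemma riesz_fischer (c : H -> R[i]) (M : R) :
  (forall F, fsub F E -> energy F c <= M) ->
  exists x, (forall e, E e -> hdot x e = c e) /\
    forall e, 0 < e -> exists2 F, fsub F E & nm (x - \sum_(f <- F) c f *: f) < e.
Proof.
move=> cM; pose A : set R := [set energy F c | F in [set F | fsub F E]].
have fsub0 : fsub fset0 E by move=> e; rewrite inE.
have supA : has_sup A.
  split; first by exists (energy fset0 c), fset0.
  by exists M => _ [F FE <-]; exact: cM.
have near n : exists F, fsub F E /\ sup A - (n.+1%:R^-1) ^+ 2 < energy F c.
  have d0 : 0 < (n.+1%:R^-1 : R) ^+ 2 by rewrite exprn_gt0// invr_gt0.
  by have [_ [F FE <-] lt] := sup_adherent d0 supA; exists F.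
have {near}[F FP] := choice near.
have FE n : fsub (F n) E := (FP n).1.
pose u n := \sum_(f <- F n) c f *: f.
have fin n G : fsub G E -> {subset F n <= G} ->
    nm (\sum_(f <- G) c f *: f - u n) < n.+1%:R^-1.
  move=> GE FG; rewrite -(@ltr_pXn2r _ 2) ?nnegrE ?nm_ge0 ?invr_ge0//.
  have -> : \sum_(f <- G) c f *: f - u n =
      \sum_(f <- G) (if f \in F n then 0 else c f) *: f.
    rewrite (big_fsub _ FG) [LHS]addrAC subrr add0r.
    by apply: eq_bigr => f _; case: ifP; rewrite ?scale0r.
  rewrite nm_comb//.
  have le : energy G c <= sup A by apply: sup_upper_bound => //; exists G.
  have -> : energy G (fun f => if f \in F n then 0 else c f) =
      energy G c - energy (F n) c.
    rewrite /energy [X in _ = X - _](big_fsub _ FG) [RHS]addrAC subrr add0r.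
    by apply: eq_bigr => f _; case: ifP; rewrite ?nm0 ?expr0n.
  by rewrite ltrBlDl; apply: le_lt_trans le _; rewrite -ltrBlDr (FP n).2.
have fsubU G G' : fsub G E -> fsub G' E -> fsub (G `|` G')%fset E.
  by move=> GE GE' e; rewrite inE => /orP[/GE|/GE'].
have [x xu] : exists x, forall e, 0 < e ->
    exists N, forall n, (N <= n)%N -> nm (x - u n) < e.
  apply: nm_converges => e e0.
  have [N] : exists N : nat, N.+1%:R^-1 < e / 2.
    have e20 : 0 < e / 2 by rewrite divr_gt0.
    exists (Num.truncn (e / 2)^-1); rewrite invf_plt ?posrE//.
    exact: Num.Theory.truncnS_gt.
  move=> Ne; exists N => n m Nn Nm.
  have h1 := fin n (F n `|` F m)%fset (fsubU _ _ (FE n) (FE m)).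
  have h2 := fin m (F n `|` F m)%fset (fsubU _ _ (FE n) (FE m)).
  have {}h1 := h1 (fun e eF => introT (fsetUP _ _ _) (or_introl eF)).
  have {}h2 := h2 (fun e eF => introT (fsetUP _ _ _) (or_intror eF)).
  rewrite nmBC in h1.
  apply: (le_lt_trans (nmB _ _ _)); apply: (lt_trans (ltrD h1 h2)).
  rewrite (splitr e); apply: ltrD; apply: le_lt_trans Ne.
    by rewrite lef_pV2 ?posrE// ler_nat ltnS.
  by rewrite lef_pV2 ?posrE// ler_nat ltnS.
exists x; split; last first.
  by move=> e /xu[N NP]; exists (F N); [exact: FE|exact: NP].
move=> e Ee; apply/eqP; rewrite -subr_eq0; apply/eqP/nm_eq0.
apply: le_anti; rewrite nm_ge0 andbT; apply/ler_addgt0Pl => d d0; rewrite addr0.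
have d20 : 0 < d / 2 by rewrite divr_gt0.
have [N NP] := xu _ d20.
have [K Kd] : exists K : nat, K.+1%:R^-1 < d / 2.
  exists (Num.truncn (d / 2)^-1); rewrite invf_plt ?posrE//.
  exact: Num.Theory.truncnS_gt.
pose n := maxn N K.
have ne : nm e = 1.
  apply/eqP; rewrite -(@eqrXn2 _ 2) ?nm_ge0// expr1n; apply/eqP/complexI.
  by rewrite -hdotxx oE ?eqxx// mem_set.
have A1 : nm (hdot x e - hdot (u n) e) < d / 2.
  rewrite -hdotBl (le_lt_trans (cauchy_schwarz _ _))// ne mulr1.
  by apply: NP; rewrite leq_maxl.
have A2 : nm (hdot (u n) e - c e) < d / 2.
  apply: le_lt_trans Kd; apply: (@le_trans _ _ n.+1%:R^-1); last first.
    by rewrite lef_pV2 ?posrE// ler_nat ltnS leq_maxr.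
  rewrite hdot_comb//; case: ifPn => eF; first by rewrite subrr nm0 invr_ge0.
  (* A coefficient outside [F n] is itself below 1/(n+1): adjoin e to [F n]. *)
  have h := fin n (e |` F n)%fset; apply: ltW; apply: le_lt_trans (h _ _).
  - rewrite big_fsetU1//= /u addrK nmZ ne mulr1 sub0r nmN//.
  - by move=> f; rewrite !inE => /orP[/eqP->//|]; exact: FE.
  - by move=> f fF; rewrite !inE fF orbT.
apply: (le_trans (nmB _ (hdot (u n) e) _)); lra.
Qed.

(** [lin_span] allows repeated vectors; the induction merges their coefficients into one combination
    over a finite set. *)
Lemma closure_span_approx x :
  closure (lin_span E) x <->
  forall e, 0 < e -> exists2 F, fsub F E &
    exists c, nm (x - \sum_(f <- F) c f *: f) < e.
Proof.
split=> [cx e e0|h].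
  have ballx : nbhs x (ball x e%:C) by apply: nbhsx_ballx; rewrite ltcR.
  have [y [[n [c [g [gE ->]]]]]] := cx _ ballx.
  rewrite -ball_normE /= nmE ltcR => xe.
  suff [F FE [d dE]] : exists2 F, fsub F E & exists d,
      \sum_(i < n) c i *: g i = \sum_(f <- F) d f *: f.
    by exists F => //; exists d; rewrite -dE.
  clear xe; elim: n c g gE => [|n IHn] c g gE.
    by exists fset0 => [f|]; rewrite ?inE//; exists (fun=> 0); rewrite big_ord0 big_seq_fset0.
  have [F FE [d dE]] := IHn (c \o widen_ord (leqnSn n)) _
    (fun i => gE (widen_ord (leqnSn n) i)).
  exists (g ord_max |` F)%fset => [f|].
    by rewrite !inE => /orP[/eqP->//|]; exact: FE.
  exists (fun f => (if f \in F then d f else 0) + (if f == g ord_max then c ord_max else 0)).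
  rewrite big_ord_recr /= dE (eq_bigr _ (fun f _ => scalerDl _ _ _)) big_split /=.
  congr (_ + _).
    have FF : {subset F <= g ord_max |` F}%fset by move=> f; rewrite !inE orbC => ->.
    rewrite (big_fsub _ FF) [X in _ = _ + X]big1 ?addr0.
      by apply: eq_big_seq => f ->.
    by move=> f _; case: (f \in F) => //=; rewrite scale0r.
  rewrite (big_fsetD1 (g ord_max)) ?fset1U1//= eqxx big_seq big1 ?addr0// => f.
  by rewrite !inE => /andP[/negbTE-> _]; rewrite scale0r.
move=> B /nbhs_ballP[e /= e0 eB].
have e0' : 0 < complex.Re e by move: e0; rewrite ltcE => /andP[].
have eE : e = (complex.Re e)%:C by rewrite RRe_real// gtr0_real.
have [F FE [c xe]] := h _ e0'.
exists (\sum_(f <- F) c f *: f); split; last first.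
  by apply: eB; rewrite -ball_normE /= nmE eE ltcR.
exists (size F), (fun i => c (tnth (in_tuple F) i)), (tnth (in_tuple F)).
by split=> [i|]; [apply: FE; exact: mem_tnth|rewrite big_tnth].
Qed.

End Orthonormal.
End InnerProduct.

Section UnitCircle.
Context {R : realType}.
Local Open Scope complex_scope.
Implicit Types t : R.

Definition expi t : R[i] := cos t +i* sin t.

Lemma expiD s t : expi (s + t) = expi s * expi t.
Proof. by rewrite /expi cosD sinD; congr Complex; rewrite addrC. Qed.

Lemma expi0 : expi 0 = 1.
Proof. by rewrite /expi cos0 sin0. Qed.

Lemma expiN t : expi (- t) = (expi t)^*.
Proof. by rewrite /expi cosN sinN. Qed.

Lemma nm_expi t : nm (expi t) = 1.
Proof. by rewrite /nm normc_def /= cos2Dsin2 sqrtr1. Qed.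

Lemma expi_pi : expi pi = -1.
Proof. by rewrite /expi cospi sinpi; apply/eqP; rewrite eq_complex /= oppr0 !eqxx. Qed.

Lemma expi_near1 e : 0 < e -> exists2 d : R, 0 < d &
  forall t, `|t| <= d -> nm (expi t - 1) <= e.
Proof.
move=> e0; have e20 : 0 < e / 2 by rewrite divr_gt0.
have /cvgrPdist_lt/(_ _ e20)/nbhs_ballP[d1 /= d10 c1] := @continuous_cos R 0.
have /cvgrPdist_lt/(_ _ e20)/nbhs_ballP[d2 /= d20 c2] := @continuous_sin R 0.
exists (Num.min d1 d2 / 2) => [|t td]; first by rewrite divr_gt0// lt_min d10.
have tm : `|t| < Num.min d1 d2.
  by rewrite (le_lt_trans td)// ltr_pdivrMr// ltr_pMr ?ltr1n// lt_min d10.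
move: tm; rewrite lt_min => /andP[t1 t2].
have := c1 t; rewrite -ball_normE /= sub0r normrN cos0 => /(_ t1) h1.
have := c2 t; rewrite -ball_normE /= sub0r normrN sin0 sub0r normrN => /(_ t2) h2.
have -> : expi t - 1 = (cos t - 1)%:C + 'i%C * (sin t)%:C.
  by rewrite /expi; simpc.
rewrite (le_trans (nmD _ _))// nmM !nmC.
have -> : nm ('i%C : R[i]) = 1.
  by rewrite /nm normc_def /= expr0n expr1n add0r sqrtr1.
by rewrite mul1r (splitr e) lerD ?ltW// distrC.
Qed.

End UnitCircle.

(** * Operators given by their matrix coefficients, and adjoints *)

Section Operators.
Context {R : realType} {H : hilbertType R}.
Implicit Types (x y z : H) (F G : {fset H}) (a b : BH H).
Local Open Scope complex_scope.

Lemma opfun_nm a : exists2 M : R, 0 < M & forall x, nm (a x) <= M * nm x.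
Proof.
by have [M M0 aM] := opfun_bounded a; exists M => //; apply/nm_bounded_linear.
Qed.

Lemma opfunD a b x : (a + b) x = a x + b x. Proof. by []. Qed.
Lemma opfunN a x : (- a) x = - a x. Proof. by []. Qed.
Lemma opfunB a b x : (a - b) x = a x - b x. Proof. by []. Qed.
Lemma opfunZ c a x : (c *: a) x = c *: a x. Proof. by []. Qed.
Lemma bh_compE a b x : bh_comp a b x = a (b x). Proof. by []. Qed.

Lemma opP a b : (forall x, a x = b x) -> a = b.
Proof. by move=> ab; apply/val_inj/funext. Qed.

(** A vector orthogonal to E is at distance at least its own norm from every combination over E, so
    density of the span makes it zero. *)
Lemma basis_orthonormal E : orthonormal_basis [set: H] E ->
  orthonormal_set E /\ total_set E.
Proof.
move=> [_ oE cE]; split=> // x xE; apply/nm_eq0/le_anti; rewrite nm_ge0 andbT.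
apply/ler_addgt0Pl => e e0; rewrite addr0.
have /closure_span_approx xc : closure (lin_span E) x by rewrite cE.
have [F FE [c xe]] := xc _ e0; apply/ltW/(le_lt_trans _ xe).
rewrite -(@ler_pXn2r _ 2) ?nnegrE ?nm_ge0// (nm_sub_comb oE)//.
have -> : proj F x = 0.
  by rewrite /proj big_seq big1// => f /FE/xE->; rewrite scale0r.
by rewrite subr0 lerDl energy_ge0.
Qed.

Section Basis.
Variables (E : set H) (oE : orthonormal_set E) (tE : total_set E).

Lemma total_approx x e : 0 < e -> exists2 F, fsub F E & nm (x - proj F x) < e.
Proof.
move=> e0; have [y [yx yF]] := riesz_fischer oE (fun F => @bessel _ _ _ oE F x).
have yx' : y = x.
  by apply/eqP; rewrite -subr_eq0; apply/eqP/tE => f Ef; rewrite hdotBl yx ?subrr.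
by have [F FE] := yF _ e0; rewrite yx'; exists F.
Qed.

Lemma nm_le_energy x (C : R) : 0 <= C ->
  (forall F, fsub F E -> energy F (hdot x) <= C ^+ 2) -> nm x <= C.
Proof.
move=> C0 h; apply/ler_addgt0Pr => e e0.
have [F FE xF] := total_approx x e0.
rewrite -[X in nm X](subrK (proj F x) x) (le_trans (nmD _ _))// addrC lerD//; last exact: ltW.
by rewrite -(@ler_pXn2r _ 2) ?nnegrE ?nm_ge0// (nm_comb oE)// h.
Qed.

Lemma hdot_ext x y : (forall e, E e -> hdot x e = hdot y e) -> x = y.
Proof.
move=> xy; apply/eqP; rewrite -subr_eq0; apply/eqP/tE => f Ef.
by rewrite hdotBl xy ?subrr.
Qed.

(** Source of the adjoints and of the weighted shifts: the energy bound provides, by Riesz-Fischer,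
    the vectors with the given coefficients, and then the norm estimate. *)
Lemma op_of_coef (c : H -> H -> R[i]) (M : R) : 0 <= M ->
  (forall e, E e -> forall k x y, c (k *: x + y) e = k * c x e + c y e) ->
  (forall F x, fsub F E -> energy F (c x) <= (M * nm x) ^+ 2) ->
  exists a : BH H, forall x e, E e -> hdot (a x) e = c x e.
Proof.
move=> M0 lc cM.
have ex x : exists y, forall e, E e -> hdot y e = c x e.
  have [y [yc _]] := riesz_fischer oE (fun F FE => cM F x FE).
  by exists y.
have [f fc] := choice ex.
have fbl : f \in @bounded_linear R H.
  apply/bounded_linearP; split.
    move=> k x y; apply: hdot_ext => e Ee.
    by rewrite fc// lc// hdotDl hdotZl !fc.
  exists M; apply/nm_bounded_linear => x; apply: nm_le_energy.
    by rewrite mulr_ge0// nm_ge0.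
  move=> F FE; rewrite (@eq_energy _ _ F _ (c x)) ?cM// => e /FE; exact: fc.
by exists (MkBH fbl).
Qed.

Lemma adj_unique a b : (forall x y, hdot (a x) y = hdot x (b y)) -> bh_adj a = b.
Proof.
move=> ab; have : [set b : BH H | forall x y, hdot (a x) y = hdot x (b y)] (bh_adj a).
  exact: (xgetI _ ab).
move=> /= h; apply: opP => y; apply: hdot_ext => e _.
by rewrite hdotJ [RHS]hdotJ -h ab.
Qed.

Lemma hdot_adj a x y : hdot (a x) y = hdot x (bh_adj a y).
Proof.
have [M M0 aM] := opfun_nm a.
suff [b bP] : exists b : BH H, forall x y, hdot (a x) y = hdot x (b y).
  by rewrite (adj_unique bP).
have [||b bP] := @op_of_coef (fun y e => hdot y (a e)) M (ltW M0).
- by move=> e _ k u v; rewrite hdotDl hdotZl.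
(* For this test vector, [hdot y (a z)] is the square of the norm of z, and it is at most M times
   the norms of y and z. *)
- move=> F {}y FE; pose z := \sum_(f <- F) hdot y (a f) *: f.
  have zE : nm z ^+ 2 = energy F (fun e => hdot y (a e)) by rewrite (nm_comb oE).
  have yz : hdot y (a z) = (nm z ^+ 2)%:C.
    rewrite /z linear_sum hdot_sumr zE /energy rmorph_sum /=.
    by apply: eq_bigr => f _; rewrite linearZ hdotZr sqr_nm mulrC.
  rewrite -zE; have [->|z0] := eqVneq (nm z) 0; first by rewrite expr0n sqr_ge0.
  rewrite ler_pXn2r ?nnegrE ?nm_ge0 ?(mulr_ge0 (ltW M0)) ?nm_ge0//.
  have z0' : 0 < nm z by rewrite lt_neqAle eq_sym z0 nm_ge0.
  have := cauchy_schwarz y (a z); rewrite yz nmC ger0_norm ?sqr_ge0// => h.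
  have {}h := le_trans h (ler_wpM2l (nm_ge0 y) (aM z)).
  by rewrite -(ler_pM2r z0') -expr2 (le_trans h)// mulrA (mulrC M).
exists b => {}x {}y; rewrite hdotJ [RHS]hdotJ; congr (_^*)%C.
apply/eqP; rewrite -subr_eq0; apply/eqP/nm_eq0/le_anti; rewrite nm_ge0 andbT.
have [N N0 bN] := opfun_nm b.
apply/ler_addgt0Pl => e e0; rewrite addr0.
(* By construction b satisfies the adjoint relation against vectors of E; finite projections and the
   bounds M, N carry it over to x. *)
have c0 : 0 < nm y * (M + N) + 1.
  by rewrite ltr_wpDl// mulr_ge0 ?nm_ge0// addr_ge0// ltW.
have [F FE xF] := total_approx x (divr_gt0 e0 c0).
set p := proj F x in xF.
have yp : hdot y (a p) = hdot (b y) p.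
  rewrite /p linear_sum !hdot_sumr; apply: eq_big_seq => f /FE Ef.
  by rewrite linearZ !hdotZr bP.
have -> : hdot y (a x) - hdot (b y) x = hdot y (a (x - p)) - hdot (b y) (x - p).
  by rewrite linearB !hdotBr yp opprB addrA subrK.
apply: (le_trans (nmD _ _)); rewrite nmN.
have h1 := le_trans (cauchy_schwarz y _) (ler_wpM2l (nm_ge0 y) (aM (x - p))).
have h2 := le_trans (cauchy_schwarz (b y) (x - p)) (ler_wpM2r (nm_ge0 _) (bN y)).
apply: (le_trans (lerD h1 h2)).
rewrite mulrA [N * _]mulrC -mulrDl -mulrDr.
apply: (@le_trans _ _ ((nm y * (M + N) + 1) * nm (x - p))).
  by rewrite ler_wpM2r ?nm_ge0// lerDl.
by rewrite mulrC -ler_pdivlMr// ltW.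
Qed.

Lemma adjK a : bh_adj (bh_adj a) = a.
Proof. by apply: adj_unique => x y; rewrite hdotJ -hdot_adj -hdotJ. Qed.

Lemma adjB a b : bh_adj (a - b) = bh_adj a - bh_adj b.
Proof. by apply: adj_unique => x y; rewrite !opfunB hdotBl hdotBr !hdot_adj. Qed.

Lemma adj_comp a b : bh_adj (bh_comp a b) = bh_comp (bh_adj b) (bh_adj a).
Proof. by apply: adj_unique => x y; rewrite !bh_compE !hdot_adj. Qed.

(** Distinct e of nonzero weight read distinct coordinates [s e], so Bessel's inequality bounds the
    result. *)
Lemma weighted_shift (m : H -> R[i]) (s : H -> H) :
  (forall e, E e -> nm (m e) <= 1) ->
  (forall e, E e -> m e != 0 -> E (s e)) ->
  (forall e e', E e -> E e' -> m e != 0 -> m e' != 0 -> s e = s e' -> e = e') ->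
  exists a : BH H, forall x e, E e -> hdot (a x) e = m e * hdot x (s e).
Proof.
move=> m1 sE sinj; apply: (@op_of_coef _ 1) => //.
  by move=> e _ k x y; rewrite hdotDl hdotZl mulrDr mulrCA.
move=> F x FE; rewrite mul1r.
pose G := [fset s f | f in [fset f in F | m f != 0]]%fset.
have GE : fsub G E.
  by move=> e /imfsetP[f /=]; rewrite !inE => /andP[/FE Ef mf] ->; exact: sE.
apply: le_trans (bessel oE x GE); rewrite /energy.
rewrite big_imfset /=; last first.
  move=> f f'; rewrite !inE => /andP[/FE Ef mf] /andP[/FE Ef' mf']; exact: sinj.
rewrite (bigID (fun f => m f != 0)) /= [X in _ + X]big1 ?addr0; last first.
  by move=> f /negPn/eqP->; rewrite mul0r nm0 expr0n.
rewrite big_fset /= [leRHS]big_seq_cond [leLHS]big_seq_cond; apply: ler_sum => f /andP[/FE Ef _].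
rewrite nmM ler_pXn2r ?nnegrE ?mulr_ge0 ?nm_ge0//.
by rewrite ler_piMl ?nm_ge0// m1.
Qed.

(** Defined by [xget] so that m carries no proof of its bound; [hdot_diag] rules out the default 0
    when the values of m have norm at most 1. *)
Definition diag (m : H -> R[i]) : BH H :=
  xget 0 [set a : BH H | forall x e, E e -> hdot (a x) e = m e * hdot x e].

Lemma hdot_diag m x e : (forall e, nm (m e) <= 1) -> E e ->
  hdot (diag m x) e = m e * hdot x e.
Proof.
move=> m1 Ee; have [//|//|a aP] := @weighted_shift m id (fun e _ => m1 e).
by apply: (@xgetI _ (0 : BH H)
  [set a : BH H | forall x e, E e -> hdot (a x) e = m e * hdot x e] a aP).
Qed.

End Basis.
End Operators.

(** * Compact operators *)

Section CompactOperators.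
Context {R : realType} {H : hilbertType R}.
Implicit Types (x y z : H) (F G : {fset H}) (a b : BH H).
Local Open Scope complex_scope.

Lemma nm_hilbert_adherent y (A : set H) e : closure A y -> 0 < e ->
  exists2 z, A z & nm (y - z) < e.
Proof.
move=> cy e0; have ballx : nbhs y (ball y e%:C) by apply: nbhsx_ballx; rewrite ltcR.
have [z [Az]] := cy _ ballx; rewrite -ball_normE /= nmE ltcR; by exists z.
Qed.

Lemma continuous_real_scale (x : H) : continuous (fun s : R => s%:C *: x).
Proof.
move=> s; apply/cvgrPdist_lt => e e0.
have e0' : 0 < complex.Re e by move: e0; rewrite ltcE => /andP[].
have eE : e = (complex.Re e)%:C by rewrite RRe_real// gtr0_real.
have c0 : 0 < nm x + 1 by rewrite ltr_wpDl ?nm_ge0.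
near=> t; rewrite -scalerBl -rmorphB /= nmE eE ltcR nmZ nmC.
apply: (@le_lt_trans _ _ (`|s - t| * (nm x + 1))); first by rewrite ler_wpM2l// lerDl.
rewrite -ltr_pdivlMr//; near: t.
by apply: (@nbhsx_ballx _ _ s); rewrite divr_gt0.
Unshelve. all: by end_near. Qed.

(** Replaces the compactness of bounded sets in finite dimension: each coefficient ranges over a
    square of real and imaginary parts, a product of two segments. *)
Lemma bounded_combinations_compact (s : seq H) (M : R) : exists2 K : set H,
  compact K & forall c, (forall f, nm (c f) <= M) -> K (\sum_(f <- s) c f *: f).
Proof.
elim: s => [|f s [K cK KP]].
  by exists [set 0]; [exact: compact_set1|move=> c _; rewrite big_nil].
pose I := [set` `[(- M), M]%R] : set R.
pose g (w : H * (R * R)) := w.1 + (w.2.1%:C *: f + w.2.2%:C *: ('i%C *: f)).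
exists (g @` (K `*` (I `*` I))).
  apply: continuous_compact.
    apply: continuous_subspaceT => w; rewrite /g.
    apply: cvgD; first exact: cvg_fst.
    apply: cvgD.
      apply: (@continuous_comp _ _ _ (fun w : H * (R * R) => w.2.1)
        (fun t : R => t%:C *: f)); last exact: continuous_real_scale.
      apply: (@continuous_comp _ _ _ (@snd H (R * R)) (@fst R R)); [exact: cvg_snd|exact: cvg_fst].
    apply: (@continuous_comp _ _ _ (fun w : H * (R * R) => w.2.2)
      (fun t : R => t%:C *: ('i%C *: f))); last exact: continuous_real_scale.
    apply: (@continuous_comp _ _ _ (@snd H (R * R)) (@snd R R)); exact: cvg_snd.
  apply: compact_setX => //; apply: compact_setX; exact: segment_compact.
move=> c cM; exists (\sum_(f <- s) c f *: f, (complex.Re (c f), complex.Im (c f))).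
  split; first exact: KP.
  have := cM f; rewrite /nm normc_def /= => h.
  have sq (u v : R) : `|u| <= Num.sqrt (u ^+ 2 + v ^+ 2).
    by rewrite -sqrtr_sqr ler_sqrt ?addr_ge0 ?sqr_ge0// lerDl sqr_ge0.
  split=> /=; rewrite /I /= in_itv /= -ler_norml.
    exact: le_trans (sq _ _) h.
  by apply: le_trans h; rewrite addrC.
by rewrite /g /= big_cons addrC; congr (_ + _); rewrite scalerA -scalerDl mulrC -complexE.
Qed.

Section Basis.
Variables (E : set H) (oE : orthonormal_set E) (tE : total_set E).

Lemma projB F x y : proj F (x - y) = proj F x - proj F y.
Proof.
rewrite /proj -sumrB; apply: eq_bigr => f _.
by rewrite hdotBl scalerBl.
Qed.

Lemma projD F x y : proj F (x + y) = proj F x + proj F y.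
Proof.
rewrite /proj -big_split; apply: eq_bigr => f _.
by rewrite hdotDl scalerDl.
Qed.

Lemma projN F x : proj F (- x) = - proj F x.
Proof.
by rewrite /proj -sumrN; apply: eq_bigr => f _; rewrite -scaleN1r hdotZl mulN1r scaleNr.
Qed.

Lemma sub_projD F x y :
  x + y - proj F (x + y) = x - proj F x + (y - proj F y).
Proof. by rewrite projD opprD addrACA. Qed.

Lemma hdot_sub_proj F x y : fsub F E -> hdot (x - proj F x) y = hdot x (y - proj F y).
Proof.
move=> FE; rewrite hdotBl hdotBr; congr (_ - _).
rewrite hdot_suml hdot_sumr; apply: eq_bigr => f _.
by rewrite hdotZl hdotZr -hdotJ mulrC.
Qed.

Lemma nm_sub_proj_le F x : fsub F E -> nm (x - proj F x) <= nm x.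
Proof.
move=> FE; rewrite -(@ler_pXn2r _ 2) ?nnegrE ?nm_ge0//.
by rewrite [leRHS](nm_sub_proj oE x FE) lerDl energy_ge0.
Qed.

Lemma nm_sub_proj_mono F G x : fsub G E -> {subset F <= G} ->
  nm (x - proj G x) <= nm (x - proj F x).
Proof.
move=> GE FG; rewrite -(@ler_pXn2r _ 2) ?nnegrE ?nm_ge0//.
have -> : proj F x = \sum_(f <- G) (if f \in F then hdot x f else 0) *: f.
  rewrite (big_fsub _ FG) [X in _ + X]big1 ?addr0.
    by apply: eq_big_seq => f ->.
  by move=> f _; case: (f \in F) => //=; rewrite scale0r.
by rewrite [leRHS](nm_sub_comb oE)// lerDl energy_ge0.
Qed.

Lemma fsubU F G : fsub F E -> fsub G E -> fsub (F `|` G)%fset E.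
Proof. by move=> FE GE e; rewrite inE => /orP[/FE|/GE]. Qed.

Lemma approx_image (u : H -> H) F e : 0 < e ->
  exists2 G, fsub G E & forall f, f \in F -> nm (u f - proj G (u f)) <= e.
Proof.
move=> e0; elim/finSet_rect: F => F IH.
have [->|[f fF]] := fset_0Vmem F; first by exists fset0 => [f|f]; rewrite inE.
have [G GE GP] := IH _ (fproperD1 fF).
have [G' GE' GP'] := total_approx oE tE (u f) e0.
exists (G `|` G')%fset; first exact: fsubU.
move=> h hF; have [->|hf] := eqVneq h f.
  apply: le_trans (ltW GP'); apply: nm_sub_proj_mono; first exact: fsubU.
  by move=> k kG; rewrite inE kG orbT.
have hF' : h \in (F `\ f)%fset by rewrite !inE hf.
apply: le_trans (GP _ hF'); apply: nm_sub_proj_mono; first exact: fsubU.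
by move=> k kG; rewrite inE kG.
Qed.

(** On the span of F the operator has finite rank, so it is enough that G nearly contains the images
    of the vectors of F. *)
Lemma op_tail a F e : fsub F E -> 0 < e -> exists G,
  [/\ fsub G E, {subset F <= G} &
    forall x, nm (a (proj F x) - proj G (a (proj F x))) <= e * nm x].
Proof.
move=> FE e0; pose n : R := (size F).+1%:R.
have d0 : 0 < e / n by rewrite divr_gt0// ltr0Sn.
have [G GE GP] := approx_image a F d0.
exists (F `|` G)%fset; split; [exact: fsubU|by move=> f fF; rewrite inE fF|].
move=> x; apply: (le_trans (@nm_sub_proj_mono G _ _ _ _)); first exact: fsubU.
  by move=> f fG; rewrite inE fG orbT.
have -> : a (proj F x) - proj G (a (proj F x)) =
    \sum_(f <- F) hdot x f *: (a f - proj G (a f)).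
  have -> : proj G (a (proj F x)) = \sum_(f <- F) hdot x f *: proj G (a f).
    rewrite [in LHS]/proj [in RHS]/proj linear_sum.
    under eq_bigr do rewrite hdot_suml scaler_suml.
    rewrite exchange_big /=; apply: eq_bigr => f _.
    rewrite scaler_sumr; apply: eq_bigr => g _.
    by rewrite linearZ hdotZl scalerA.
  rewrite linear_sum -sumrB; apply: eq_bigr => f _.
  by rewrite linearZ scalerBr.
have nsum (s : seq H) (u : H -> H) : nm (\sum_(f <- s) u f) <= \sum_(f <- s) nm (u f).
  elim: s => [|f s IH]; first by rewrite !big_nil nm0.
  by rewrite !big_cons (le_trans (nmD _ _))// lerD2l.
apply: (le_trans (nsum _ _)).
apply: (@le_trans _ _ (\sum_(f <- F) (nm x * (e / n)))).
  rewrite big_seq [leRHS]big_seq; apply: ler_sum => f fF.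
  rewrite nmZ ler_pM ?nm_ge0//; last exact: GP.
  rewrite (le_trans (cauchy_schwarz _ _))// ler_piMr ?nm_ge0//.
  rewrite -(@ler_pXn2r _ 2) ?nnegrE ?nm_ge0// expr1n.
  by rewrite -lecR -hdotxx oE ?eqxx// mem_set//; exact: FE.
rewrite big_const_seq count_predT iter_addr_0 -mulr_natr -mulrA [leRHS]mulrC.
rewrite ler_wpM2l ?nm_ge0// -mulrA ler_piMr ?(ltW e0)//.
by rewrite mulrC ler_pdivrMr ?ltr0Sn// mul1r ler_nat.
Qed.

(** Duality: the square of the norm of the vector z on the left is [hdot (a z - proj F (a z)) y]. *)
Lemma adj_tail a F e :
  fsub F E -> (forall x, nm (a x - proj F (a x)) <= e * nm x) ->
  forall y, nm (bh_adj a (y - proj F y)) <= e * nm y.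
Proof.
move=> FE aF y; set z := bh_adj a _.
have [z0|z0] := eqVneq (nm z) 0; first by rewrite z0 (le_trans (nm_ge0 _) (aF y)).
have z0' : 0 < nm z by rewrite lt_neqAle eq_sym z0 nm_ge0.
rewrite -(ler_pM2l z0') -expr2.
have -> : nm z ^+ 2 = nm (hdot (a z - proj F (a z)) y).
  rewrite hdot_sub_proj// (hdot_adj oE tE) -/z hdotxx nmC ger0_norm ?sqr_ge0//.
rewrite (le_trans (cauchy_schwarz _ _))// [leRHS]mulrCA mulrA.
by rewrite ler_wpM2r ?nm_ge0.
Qed.

(** Compactness tested on the basis: a is a norm limit of its cut-downs to finitely many rows. *)
Definition approximately_finite a := forall e, 0 < e ->
  exists2 F, fsub F E & forall x, nm (a x - proj F (a x)) <= e * nm x.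

Lemma compact_approximately_finite a :
  a \in @compact_op R H -> approximately_finite a.
Proof.
rewrite inE => /asboolP; rewrite precompactE => cA e e0.
set B := [set x : H | `|x| <= 1] in cA.
move: (cA); rewrite compact_cover.
(* By totality, the open sets of points closer than e to the span of a finite F cover H; the union
   of the index sets of a finite subcover is the required set. *)
move=> /(_ {fset H} [set F | fsub F E] (fun F => [set y | nm (y - proj F y) < e])).
case.
- move=> F /= FE; rewrite openE => y /= ye.
  apply/nbhs_ballP; exists (e - nm (y - proj F y))%:C => /=.
    by rewrite ltcR subr_gt0.
  move=> z; rewrite -ball_normE /= nmE ltcR ltrBrDr => yz.
  apply: le_lt_trans yz; rewrite [nm (y - z)]nmBC.
  have -> : z - proj F z = (z - y) - proj F (z - y) + (y - proj F y).
    by rewrite -[RHS]sub_projD subrK.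
  by rewrite (le_trans (nmD _ _))// lerD2r nm_sub_proj_le.
- by move=> y _; have [F FE yF] := total_approx oE tE y e0; exists F.
move=> D DE cov.
pose G := (\bigcup_(F <- enum_fset D) F)%fset.
have DG F : F \in D -> {subset F <= G}.
  by move=> FD f fF; apply/bigfcupP; exists F; rewrite ?FD.
have GE : fsub G E.
  move=> f /bigfcupP[F /andP[FD _] fF].
  by have /set_mem := DE F FD; apply.
have unit x : nm x <= 1 -> nm (a x - proj G (a x)) <= e.
  move=> x1; have : closure (a @` B) (a x).
    by apply: subset_closure; exists x => //; rewrite /B /= nmE -[1]/((1 : R)%:C) lecR.
  move=> /cov[F /= FD axF]; apply: le_trans (ltW axF).
  by apply: nm_sub_proj_mono => //; exact: DG.
exists G => // x; have [x0|x0] := eqVneq (nm x) 0.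
  rewrite (nm_eq0 x0) linear0 /proj big1 ?subr0 ?nm0 ?mulr0// => f _.
  by rewrite hdot0l scale0r.
have x0' : 0 < nm x by rewrite lt_neqAle eq_sym x0 nm_ge0.
have /unit : nm ((nm x)^-1%:C *: x) <= 1.
  by rewrite nmZ nmC ger0_norm ?invr_ge0 ?nm_ge0// mulVf.
have -> : a ((nm x)^-1%:C *: x) - proj G (a ((nm x)^-1%:C *: x)) =
   (nm x)^-1%:C *: (a x - proj G (a x)).
  rewrite linearZ scalerBr; congr (_ - _); rewrite scaler_sumr.
  by apply: eq_bigr => f _; rewrite hdotZl scalerA.
by rewrite nmZ nmC ger0_norm ?invr_ge0 ?nm_ge0// ler_pdivrMl// mulrC.
Qed.

(** An ultrafilter on the closure of the image is Cauchy: its points are within e/2 of their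
    projections on a finite F, and these projections lie in a compact set. *)
Lemma approximately_finite_compact a :
  approximately_finite a -> a \in @compact_op R H.
Proof.
move=> aF; rewrite inE; apply/asboolP; rewrite precompactE.
set A := closure _.
have [M M0 aM] := opfun_nm a.
have near y d : A y -> 0 < d -> exists2 x, nm x <= 1 & nm (y - a x) < d.
  move=> Ay d0; have [z [x /= x1 <-] yz] := nm_hilbert_adherent Ay d0.
  by exists x => //; rewrite -lecR -nmE.
have AM y : A y -> nm y <= M.
  move=> Ay; apply/ler_addgt0Pr => d d0; have [x x1 yx] := near y d Ay d0.
  rewrite -[y](subrK (a x)) (le_trans (nmD _ _))// addrC lerD//; last exact: ltW.
  by rewrite (le_trans (aM x))// ler_piMr// ltW.
rewrite compact_ultra => U UU UA.
have UF : ProperFilter U by exact: ultra_proper.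
suff cU : cvg U.
  have [l Ul] : exists l : H, U --> l by apply/cvg_ex.
  exists l; split=> //; apply: closed_closure => B lB.
  have UB : U B := Ul _ lB.
  by have [y [Ay By]] := @filter_ex _ U UF _ (filterI UA UB); exists y.
apply: cauchy_cvg; apply: cauchy_exP => e' e0'.
pose e := complex.Re e'.
have e0 : 0 < e by move: e0'; rewrite ltcE => /andP[].
have eE : e' = e%:C by rewrite RRe_real// gtr0_real.
have e40 : 0 < e / 4 by rewrite divr_gt0.
have [F FE Fa] := aF _ e40.
have Ftail y : A y -> nm (y - proj F y) <= e / 2.
  move=> Ay; have [x x1 yx] := near y _ Ay e40.
  have -> : y - proj F y = (y - a x) - proj F (y - a x) + (a x - proj F (a x)).
    by rewrite -[RHS]sub_projD subrK.
  rewrite (le_trans (nmD _ _))//.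
  have h1 := nm_sub_proj_le (y - a x) FE.
  have h2 := Fa x; have h3 : e / 4 * nm x <= e / 4 by rewrite ler_piMr// ltW.
  lra.
have [K cK KP] := bounded_combinations_compact F M.
have KA y : A y -> K (proj F y).
  move=> Ay; pose c f := if f \in F then hdot y f else 0.
  have -> : proj F y = \sum_(f <- F) c f *: f by apply: eq_big_seq => f fF; rewrite /c fF.
  apply: KP => f; rewrite /c; case: ifPn => [fF|_]; last by rewrite nm0 ltW.
  rewrite (le_trans (cauchy_schwarz _ _))// (le_trans _ (AM y Ay))//.
  rewrite ler_piMr ?nm_ge0// -(@ler_pXn2r _ 2) ?nnegrE ?nm_ge0// expr1n.
  by rewrite -lecR -hdotxx oE ?eqxx// mem_set//; exact: FE.
have [p [Kp clp]] := cK (proj F @ U) _ (filterS KA UA).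
exists p; pose S := [set y : H | nm (proj F y - p) < e / 2].
have US : U S.
  have [//|UnS] := in_ultra_setVsetC S UU.
  have pU : (proj F @ U) [set z | ~ (nm (z - p) < e / 2)] by [].
  have bp : nbhs p (ball p (e / 2)%:C) by apply: nbhsx_ballx; rewrite ltcR divr_gt0.
  have [z [/= zp]] := clp _ _ pU bp.
  by rewrite -ball_normE /= nmE ltcR nmBC.
apply: filterS (filterI UA US) => y [Ay /= yS].
rewrite -ball_normE /= nmE eE ltcR nmBC (le_lt_trans (nmB _ (proj F y) _))//.
by rewrite (splitr e); apply: ler_ltD; [exact: Ftail|exact: yS].
Qed.

Lemma compact_opP a : a \in @compact_op R H <-> approximately_finite a.
Proof.
by split; [exact: compact_approximately_finite|exact: approximately_finite_compact].
Qed.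

(** Cut x along a finite F that works for a: the part outside F becomes small under the adjoint by
    duality, and on the part inside the adjoint has finite rank. *)
Lemma compact_adj a : a \in @compact_op R H -> bh_adj a \in @compact_op R H.
Proof.
move=> /compact_opP aF; apply/compact_opP => e e0.
have e20 : 0 < e / 2 by rewrite divr_gt0.
have [F FE Fa] := aF _ e20.
have [G [GE _ GP]] := op_tail (bh_adj a) FE e20.
exists G => // x; have h := adj_tail FE Fa x.
have -> : bh_adj a x - proj G (bh_adj a x) =
   (bh_adj a (proj F x) - proj G (bh_adj a (proj F x))) +
   (bh_adj a (x - proj F x) - proj G (bh_adj a (x - proj F x))).
  by rewrite -[RHS]sub_projD -linearD [_ + (x - _)]addrC subrK.
rewrite (le_trans (nmD _ _))// (splitr e) mulrDl lerD//.
exact: le_trans (nm_sub_proj_le _ GE) h.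
Qed.

End Basis.
End CompactOperators.

(** * Operators of small range *)

Section SmallRange.
Context {R : realType} {H : hilbertType R}.
Implicit Types (x y z : H) (F G : {fset H}) (a b : BH H).
Local Open Scope complex_scope.

Lemma small_invn (e : R) : 0 < e -> exists n : nat, n.+1%:R^-1 < e.
Proof.
move=> e0; exists (Num.truncn e^-1); rewrite invf_plt ?posrE//.
exact: Num.Theory.truncnS_gt.
Qed.

Lemma nm_orthonormal (E : set H) e : orthonormal_set E -> E e -> nm e = 1.
Proof.
move=> oE Ee; apply/eqP; rewrite -(@eqrXn2 _ 2) ?nm_ge0// expr1n; apply/eqP/complexI.
by rewrite -hdotxx oE ?eqxx// mem_set.
Qed.

Lemma countable_coefs (E : set H) x : orthonormal_set E ->
  countable [set e | E e /\ hdot x e != 0].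
Proof.
move=> oE; have [y [yx yF]] := riesz_fischer oE (fun F => @bessel _ _ _ oE F x).
have near n : exists F, fsub F E /\
    nm (y - \sum_(f <- F) hdot x f *: f) < n.+1%:R^-1.
  have [|F FE lt] := yF n.+1%:R^-1; first by rewrite invr_gt0.
  by exists F.
have [F FP] := choice near.
apply: (@sub_countable _ _ _ (\bigcup_n [set` F n])); last first.
  by apply: bigcup_countable => // n _; exact: countable_fset.
apply: subset_card_le => e [Ee xe]; apply: contrapT => eF.
move/negP: xe; apply; apply/eqP/nm_eq0/le_anti; rewrite nm_ge0 andbT.
apply/ler_addgt0Pr => d d0; rewrite add0r.
have [n nd] := small_invn d0; apply: le_trans (ltW nd).
have [FE lt] := FP n; rewrite -yx//.
have -> : hdot y e = hdot (y - \sum_(f <- F n) hdot x f *: f) e.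
  rewrite hdotBl (hdot_comb oE)//; case: ifPn => [eFn|]; last by rewrite subr0.
  by exfalso; apply: eF; exists n.
rewrite (le_trans (cauchy_schwarz _ _))// (nm_orthonormal oE Ee) mulr1.
exact: ltW.
Qed.

(** Membership in J read on the basis E, when I has cardinal aleph_1; easier to check on sums and
    products than the dimension of a closed range. *)
Definition countable_rows (E : set H) a : Prop :=
  countable [set e | E e /\ exists x, hdot (a x) e != 0].

Lemma aleph1_countable (I T : Type) (A : set T) :
  is_aleph1 [set: I] -> card_lt A [set: I] <-> countable A.
Proof.
move=> [Iunc Imin]; split=> [[_ nIA]|cA].
  by apply: contrapT => /Imin.
split; last by move=> /sub_countable h; apply: Iunc; exact: h.
apply: card_le_trans cA _; apply/infiniteP => fI.
exact/Iunc/finite_set_countable.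
Qed.

Lemma small_range_countable_rows (I : Type) (E : set H) a : is_aleph1 [set: I] ->
  orthonormal_set E -> small_range_op I a -> countable_rows E a.
Proof.
move=> I1 oE [E' [E'M oE' cE'] /(aleph1_countable _ I1) cntE'].
pose B := \bigcup_(e' in E') [set e | E e /\ hdot e' e != 0].
have cB : countable B.
  by apply: bigcup_countable => // e' _; exact: countable_coefs.
apply: sub_countable cB; apply: subset_card_le => e [Ee [x xe]].
apply: contrapT => eB; move/negP: xe; apply.
apply/eqP/nm_eq0/le_anti; rewrite nm_ge0 andbT.
apply/ler_addgt0Pr => d d0; rewrite add0r.
have : closure (range a) (a x) by apply: subset_closure; exists x.
rewrite -cE' => /closure_span_approx/(_ _ d0)[F FE [c lt]].
apply: le_trans (ltW lt).
have -> : hdot (a x) e = hdot (a x - \sum_(f <- F) c f *: f) e.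
  rewrite hdotBl hdot_suml big_seq big1 ?subr0// => f /FE fE'.
  rewrite hdotZl; have [->|fe] := eqVneq (hdot f e) 0; first by rewrite mulr0.
  by exfalso; apply: eB; exists f.
by rewrite (le_trans (cauchy_schwarz _ _))// (nm_orthonormal oE Ee) mulr1.
Qed.

Lemma closure_rangeP a y : closure (range a) y <->
  forall e, 0 < e -> exists x, nm (y - a x) < e.
Proof.
split=> [cy e e0|h B /nbhs_ballP[e /= e0 eB]].
  by have [_ [x _ <-] lt] := nm_hilbert_adherent cy e0; exists x.
have e0' : 0 < complex.Re e by move: e0; rewrite ltcE => /andP[].
have eE : e = (complex.Re e)%:C by rewrite RRe_real// gtr0_real.
have [x lt] := h _ e0'; exists (a x); split; first by exists x.
by apply: eB; rewrite -ball_normE /= nmE eE ltcR.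
Qed.

Lemma closure_range_linear a c x y : closure (range a) x -> closure (range a) y ->
  closure (range a) (c *: x + y).
Proof.
move=> /closure_rangeP hx /closure_rangeP hy; apply/closure_rangeP => e e0.
have c0 : 0 < nm c + 1 by rewrite ltr_wpDl ?nm_ge0.
have e20 : 0 < e / 2 by rewrite divr_gt0.
have [u xu] := hx _ (divr_gt0 e20 c0); have [v yv] := hy _ e20.
exists (c *: u + v).
have -> : c *: x + y - a (c *: u + v) = c *: (x - a u) + (y - a v).
  by rewrite linearP opprD addrACA scalerBr.
rewrite (le_lt_trans (nmD _ _))// (splitr e) ler_ltD// nmZ.
rewrite ltr_pdivlMr// in xu.
apply: le_trans (ltW xu); rewrite [leRHS]mulrC ler_wpM2r ?nm_ge0// lerDl//.
Qed.

Lemma closure_range_comb a F c : fsub F (closure (range a)) ->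
  closure (range a) (\sum_(f <- F) c f *: f).
Proof.
suff h (s : seq H) : (forall f, f \in s -> closure (range a) f) ->
    closure (range a) (\sum_(f <- s) c f *: f) by exact: h.
elim: s => [|f s IH] FM.
  by rewrite big_nil; apply: subset_closure; exists 0; rewrite ?linear0.
rewrite big_cons; apply: closure_range_linear; first by apply: FM; rewrite inE eqxx.
by apply: IH => e es; apply: FM; rewrite inE es orbT.
Qed.

Lemma closure_closure_range a y :
  (forall e, 0 < e -> exists2 z, closure (range a) z & nm (y - z) < e) ->
  closure (range a) y.
Proof.
move=> h; apply/closure_rangeP => e e0.
have e20 : 0 < e / 2 by rewrite divr_gt0.
have [z /closure_rangeP/(_ _ e20)[x zx] yz] := h _ e20; exists x.
by rewrite (le_lt_trans (nmB _ z _))// (splitr e) ltrD.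
Qed.

(** A maximal orthonormal subset of M has dense span: otherwise the difference between a vector and
    its projection, normalized, would enlarge it. The projection exists by Riesz-Fischer and stays
    in M, a closed subspace. *)
Lemma closure_range_basis a : exists E', orthonormal_basis (closure (range a)) E'.
Proof.
set M := closure (range a).
have [F Fsub|E' [[E'M oE'] maxE']] :=
    @Zorn_bigcup H (fun X => X `<=` M /\ orthonormal_set X).
  move=> tF; split; first by move=> x [X /Fsub[XM _] /XM].
  move=> x y /set_mem[X FX Xx] /set_mem[Y FY Yy].
  have [XY|YX] := tF _ _ FX FY.
    by apply: (Fsub Y FY).2; rewrite mem_set//; exact: XY.
  by apply: (Fsub X FX).2; rewrite mem_set//; exact: YX.
exists E'; split=> //; apply/seteqP; split=> x.
  move=> /closure_span_approx h; apply: closure_closure_range => e /h[F FE' [c lt]].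
  by exists (\sum_(f <- F) c f *: f) => //; apply: closure_range_comb => f /FE'/E'M.
move=> Mx; have [y [yx yF]] := riesz_fischer oE' (fun F => @bessel _ _ _ oE' F x).
have My : M y.
  apply: closure_closure_range => e /yF[F FE' lt].
  by exists (\sum_(f <- F) hdot x f *: f) => //; apply: closure_range_comb => f /FE'/E'M.
suff xy : x = y.
  apply/closure_span_approx => e /yF[F FE' lt]; exists F => //.
  by exists (hdot x); rewrite {1}xy.
apply: contrapT => xy; pose w := x - y.
have nw : nm w != 0.
  by apply/eqP => /nm_eq0/eqP; rewrite subr_eq0 => /eqP.
have wE' e : E' e -> hdot w e = 0 by move=> E'e; rewrite hdotBl yx ?subrr.
have Mw : M w.
  by rewrite /w addrC -scaleN1r; exact: closure_range_linear.
pose v := (nm w)^-1%:C *: w.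
have vv : hdot v v = 1.
  rewrite hdotxx /v nmZ nmC ger0_norm ?invr_ge0 ?nm_ge0// mulVf//.
  by rewrite expr1n.
have vE' e : E' e -> hdot v e = 0 by move=> /wE' we; rewrite hdotZl we mulr0.
apply: (maxE' (v |` E')).
  split; first by move=> e E'e; right.
  move=> sub; have := sub v (or_introl erefl) => /vE'.
  by rewrite vv => /eqP; rewrite oner_eq0.
split.
  move=> e [->|/E'M//]; rewrite -[v]addr0; apply: closure_range_linear => //.
  by apply: subset_closure; exists 0; rewrite ?linear0.
have vnE' e : E' e -> v == e = false.
  move=> E'e; apply/negP => /eqP ve; have := vE' e E'e; rewrite -ve vv.
  by move/eqP; rewrite oner_eq0.
move=> e f /set_mem[->|E'e] /set_mem[->|E'f].
- by rewrite vv eqxx.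
- by rewrite vE'// vnE'.
- by rewrite hdotJ vE'// eq_sym vnE'// conjc0.
- by apply: oE'; rewrite mem_set.
Qed.

(** Each vector of a basis of the closed range has a nonzero coefficient on some nonzero row, and
    each row meets only countably many vectors of that basis. *)
Lemma countable_rows_small_range (I : Type) (E : set H) a : is_aleph1 [set: I] ->
  orthonormal_set E -> total_set E -> countable_rows E a -> small_range_op I a.
Proof.
move=> I1 oE tE ca; have [E' bE'] := closure_range_basis a.
exists E' => //; apply/aleph1_countable => //.
have [E'M oE' _] := bE'.
pose A := [set e | E e /\ exists x, hdot (a x) e != 0].
have {}ca : countable A by [].
apply: (@sub_countable _ _ _ (\bigcup_(e in A) [set e' | E' e' /\ hdot e e' != 0])).
  apply: subset_card_le => e' E'e'; apply: contrapT => e'A.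
  have : e' = 0.
    apply: tE => e Ee; apply: contrapT => /eqP e'e; apply: e'A.
    have : exists x, hdot (a x) e != 0.
      have /closure_rangeP/(_ (nm (hdot e' e)))[|x lt] := E'M e' E'e'.
        by rewrite lt_neqAle nm_ge0 andbT eq_sym; apply: contra_neq e'e; exact: nm_eq0.
      exists x; apply/negP => /eqP ax0.
      have := cauchy_schwarz (e' - a x) e; rewrite hdotBl ax0 subr0.
      by rewrite (nm_orthonormal oE Ee) mulr1 leNgt lt.
    move=> ex; exists e => //; split=> //; rewrite hdotJ; apply/negP => /eqP.
    by move/(congr1 conjc); rewrite conjcK conjc0 => /eqP; exact/negP.
  move=> e'0; have := nm_orthonormal oE' E'e'; rewrite e'0 nm0 => /eqP.
  by rewrite eq_sym oner_eq0.
by apply: bigcup_countable => // e _; exact: countable_coefs.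
Qed.

End SmallRange.

(** * Conjugation by diagonal unitaries *)

Section DiagonalConjugation.
Context {R : realType} {H : hilbertType R}.
Implicit Types (x y z : H) (F G : {fset H}) (a b : BH H) (t : H -> R).
Local Open Scope complex_scope.
Variables (E : set H) (oE : orthonormal_set E) (tE : total_set E).

Definition dg t : BH H := diag E (fun e => expi (t e)).

Lemma hdot_dg t x e : E e -> hdot (dg t x) e = expi (t e) * hdot x e.
Proof. by move=> Ee; apply: hdot_diag => // f; rewrite nm_expi. Qed.

Lemma dg0 x : dg (fun=> 0) x = x.
Proof. by apply: (hdot_ext tE) => e Ee; rewrite hdot_dg// expi0 mul1r. Qed.

Lemma dgD t t' x : dg (fun e => t e + t' e) x = dg t (dg t' x).
Proof. by apply: (hdot_ext tE) => e Ee; rewrite !hdot_dg// expiD mulrA. Qed.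

Lemma dgNK t x : dg (fun e => - t e) (dg t x) = x.
Proof.
rewrite -dgD -[RHS]dg0; congr (dg _ x).
by apply/funext => e; rewrite addNr.
Qed.

Lemma dg_basis t e : E e -> dg t e = expi (t e) *: e.
Proof.
move=> Ee; apply: (hdot_ext tE) => f Ef; rewrite hdot_dg// hdotZl oE ?mem_set//.
by case: eqP => [->|]; rewrite ?mulr0.
Qed.

Lemma adj_dg t : bh_adj (dg t) = dg (fun e => - t e).
Proof.
apply: opP => y; apply: (hdot_ext tE) => e Ee.
by rewrite hdot_dg// hdotJ -(hdot_adj oE tE) -hdotJ dg_basis// hdotZr expiN.
Qed.

Lemma nm_dg t x : nm (dg t x) <= nm x.
Proof.
apply: (nm_le_energy oE tE); rewrite ?nm_ge0// => F FE.
apply: le_trans (bessel oE x FE); apply: le_energy => f /FE Ef.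
by rewrite hdot_dg// nmM nm_expi mul1r.
Qed.

Lemma proj_dg t F x : fsub F E -> proj F (dg t x) = dg t (proj F x).
Proof.
move=> FE; apply: (hdot_ext tE) => e Ee.
rewrite (hdot_proj oE)// !hdot_dg// (hdot_proj oE)//.
by case: ifP; rewrite ?mulr0.
Qed.

Definition Ad t a : BH H := bh_comp (bh_comp (dg t) a) (dg (fun e => - t e)).

Lemma AdE t a x : Ad t a x = dg t (a (dg (fun e => - t e) x)).
Proof. by []. Qed.

Lemma proj_dg_near1 t F x c d : fsub F E -> 0 <= d ->
  (forall e, e \in F -> nm (expi (t e) - c) <= d) ->
  nm (proj F (dg t x - c *: x)) <= d * nm x.
Proof.
move=> FE d0 h; rewrite -(@ler_pXn2r _ 2) ?nnegrE ?mulr_ge0 ?nm_ge0//.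
rewrite (nm_comb oE)//.
rewrite (@eq_energy _ _ F _ (fun e => (expi (t e) - c) * hdot x e)); last first.
  by move=> e /FE Ee; rewrite hdotBl hdot_dg// hdotZl mulrBl.
rewrite exprMn; apply: (@le_trans _ _ (d ^+ 2 * energy F (hdot x))).
  rewrite /energy mulr_sumr big_seq [leRHS]big_seq; apply: ler_sum => e eF.
  rewrite nmM exprMn ler_wpM2r ?sqr_ge0//.
  by rewrite ler_pXn2r ?nnegrE ?nm_ge0// h.
by rewrite ler_wpM2l ?sqr_ge0// (bessel oE).
Qed.

(** Conjugation does not change when a constant is added to t, so t may be normalized at a point of
    V; both unitaries are then within d of the identity on V. Each side contributes once, whence the
    factor 2. *)
Lemma Ad_near a t (Q V : {fset H}) x d (M : R) : fsub Q E -> fsub V E ->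
  {subset Q <= V} -> 0 <= d -> 0 <= M -> (forall x, nm (a x) <= M * nm x) ->
  (forall i j, i \in V -> j \in V -> nm (expi (t i - t j) - 1) <= d) ->
  nm (proj Q ((Ad t a - a) (proj V x))) <= 2 * d * M * nm (proj V x).
Proof.
move=> QE VE QV d0 M0 aM tV.
have [->|[i iV]] := fset_0Vmem V.
  have -> : proj fset0 x = 0 by rewrite /proj big_seq_fset0.
  rewrite linear0 nm0 mulr0 /proj big1 ?nm0// => f _.
  by rewrite hdot0l scale0r.
set y := proj V x.
pose t' e := t e - t i.
have yV : proj V y = y.
  apply: (hdot_ext tE) => e Ee; rewrite (hdot_proj oE)//.
  by case: ifPn => // eV; rewrite (hdot_proj oE)// (negbTE eV).
rewrite opfunB; have -> : Ad t a y = Ad t' a y.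
  rewrite !AdE; apply: (hdot_ext tE) => e Ee; rewrite !hdot_dg// /t'.
  have -> : dg (fun e => - (t e - t i)) y = expi (t i) *: dg (fun e => - t e) y.
    apply: (hdot_ext tE) => f Ef; rewrite hdotZl !hdot_dg// mulrA -expiD.
    by rewrite opprB.
  by rewrite linearZ hdotZl mulrA -expiD subrK.
have -> : proj Q (Ad t' a y - a y) =
    proj Q (dg t' (a (dg (fun e => - t' e) y)) - 1 *: a (dg (fun e => - t' e) y)) +
    proj Q (a (dg (fun e => - t' e) y - 1 *: y)).
  rewrite -projD; congr proj.
  by rewrite AdE !scale1r linearB addrA subrK.
rewrite (le_trans (nmD _ _))// -!mulrA [2 * _]mulrC mulr_natr mulr2n lerD//.
  apply: (le_trans (proj_dg_near1 _ QE d0 _)).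
    by move=> e /QV eV; exact: tV.
  rewrite ler_wpM2l// (le_trans (aM _))// ler_wpM2l//; exact: nm_dg.
rewrite (le_trans (nm_proj oE _ QE))// (le_trans (aM _))// mulrCA ler_wpM2l//.
have -> : dg (fun e => - t' e) y - 1 *: y =
    proj V (dg (fun e => - t' e) y - 1 *: y).
  by rewrite projB proj_dg// scale1r yV.
apply: proj_dg_near1 => // e eV; rewrite /t' opprB; exact: tV.
Qed.

End DiagonalConjugation.

(** * Almost block tridiagonal form and compact commutators *)

Section BandStructure.
Context {R : realType} {H : hilbertType R}.
Implicit Types (x y z : H) (F G : {fset H}) (a b : BH H) (t : H -> R).
Local Open Scope complex_scope.
Variables (E : set H) (oE : orthonormal_set E) (tE : total_set E).

Lemma energy_fsetD F G (c : H -> R[i]) : {subset F <= G} ->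
  energy (G `\` F)%fset c = energy G c - energy F c.
Proof.
move=> FG; rewrite /energy [X in _ = X - _](big_fsub _ FG) [RHS]addrAC subrr add0r.
have sub : {subset (G `\` F)%fset <= G} by move=> f; rewrite inE => /andP[].
rewrite (big_fsub _ sub) [X in _ = _ + X]big1_seq ?addr0.
  by apply: eq_big_seq => f; rewrite inE => /andP[/negbTE->].
move=> f /andP[_ fG]; case: ifPn => //; rewrite inE fG andbT negbK.
by move=> ->.
Qed.

Lemma subset_energy F G (c : H -> R[i]) : {subset F <= G} -> energy F c <= energy G c.
Proof. by move=> FG; rewrite -subr_ge0 -energy_fsetD// energy_ge0. Qed.

Lemma fsubD F G : fsub G E -> fsub (G `\` F)%fset E.
Proof. by move=> GE f; rewrite inE => /andP[_ /GE]. Qed.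

Lemma proj_fsetD F G x : fsub G E -> {subset F <= G} ->
  proj (G `\` F)%fset x = proj G x - proj F x.
Proof.
move=> GE FG; have FE : fsub F E by move=> f /FG/GE.
apply: (hdot_ext tE) => e Ee; rewrite hdotBl !(hdot_proj oE)//; last exact: fsubD.
rewrite inE; have [/FG->|eF] := boolP (e \in F); first by rewrite /= subrr.
by rewrite subr0.
Qed.

Lemma nm_proj_mono F G x : fsub G E -> {subset F <= G} -> nm (proj F x) <= nm (proj G x).
Proof.
move=> GE FG; have FE : fsub F E by move=> f /FG/GE.
rewrite -(@ler_pXn2r _ 2) ?nnegrE ?nm_ge0// !(nm_comb oE)//.
exact: subset_energy.
Qed.

Lemma nm_proj_away F G x : fsub F E -> fsub G E ->
  (forall e, e \in F -> e \notin G) -> nm (proj F x) <= nm (x - proj G x).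
Proof.
move=> FE GE FG; apply: le_trans (nm_proj oE (x - proj G x) FE).
rewrite -(@ler_pXn2r _ 2) ?nnegrE ?nm_ge0// !(nm_comb oE)// le_energy// => f fF.
by rewrite hdotBl (hdot_proj oE) ?(negbTE (FG f fF)) ?subr0//; exact: FE.
Qed.

(** Dual form of [op_tail]: what the adjoint does to the span of F controls the rows of a in F. *)
Lemma head_tail a F G e : fsub F E -> fsub G E ->
  (forall x, nm (bh_adj a (proj F x) - proj G (bh_adj a (proj F x))) <= e * nm x) ->
  forall x, nm (proj F (a (x - proj G x))) <= e * nm x.
Proof.
move=> FE GE h x; set v := a _; set u := proj F v.
have [u0|u0] := eqVneq (nm u) 0; first by rewrite u0 (le_trans (nm_ge0 _) (h x)).
have u0' : 0 < nm u by rewrite lt_neqAle eq_sym u0 nm_ge0.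
have uu : proj F u = u.
  apply: (hdot_ext tE) => f Ef; rewrite (hdot_proj oE)//.
  by case: ifPn => // fF; rewrite (hdot_proj oE)// (negbTE fF).
have uv : hdot u u = hdot v u.
  apply/eqP; rewrite -subr_eq0 -hdotBl -opprB -scaleN1r hdotZl.
  by rewrite (hdot_sub_proj _ _ FE) uu subrr hdot0r mulr0.
rewrite -(ler_pM2r u0') -expr2.
have -> : nm u ^+ 2 = nm (hdot v u) by rewrite -uv hdotxx nmC ger0_norm ?sqr_ge0.
rewrite /v (hdot_adj oE tE) (hdot_sub_proj _ _ GE).
rewrite (le_trans (cauchy_schwarz _ _))// -mulrA [leRHS]mulrCA.
rewrite ler_wpM2l ?nm_ge0//.
by have := h u; rewrite uu.
Qed.

(** Applying [op_tail] to a and to its adjoint at each step makes a block tridiagonal along the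
    increments of the chain, up to errors 2^-n. *)
Lemma band_chain a : countable_rows E a -> exists F : nat -> {fset H},
  [/\ forall n, fsub (F n) E, forall n, {subset F n <= F n.+1},
      forall e, E e -> (forall n, e \notin F n) -> forall x, hdot (a x) e = 0,
      forall n x, nm (a (proj (F n) x) - proj (F n.+1) (a (proj (F n) x))) <=
        2^-1 ^+ n * nm x &
      forall n x, nm (proj (F n) (a (x - proj (F n.+1) x))) <= 2^-1 ^+ n * nm x].
Proof.
move=> ca; have [g [_ gP]] := countable_enum (0 : H) ca.
have step (p : nat * {fset H}) : exists G, fsub p.2 E ->
    [/\ fsub G E, {subset p.2 <= G}, (E (g p.1) -> g p.1 \in G),
      forall x, nm (a (proj p.2 x) - proj G (a (proj p.2 x))) <= 2^-1 ^+ p.1 * nm x &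
      forall x, nm (proj p.2 (a (x - proj G x))) <= 2^-1 ^+ p.1 * nm x].
  case: p => n F /=; have [FE|FE] := pselect (fsub F E); last by exists F.
  have d0 : 0 < 2^-1 ^+ n :> R by rewrite exprn_gt0// invr_gt0.
  have [G1 [G1E FG1 G1P]] := op_tail oE tE a FE d0.
  have [G2 [G2E FG2 G2P]] := op_tail oE tE (bh_adj a) FE d0.
  (* Adds the n-th nonzero row, so that the chain exhausts them; the test discards the default 0 of
     the enumeration. *)
  pose G3 : {fset H} := if pselect (E (g n)) then [fset g n]%fset else fset0.
  have G3E : fsub G3 E.
    by move=> f; rewrite /G3; case: pselect => //= Eg; rewrite inE => /eqP->.
  pose G := (G1 `|` (G2 `|` G3))%fset.
  have GE : fsub G E by do 2 ?apply: fsubU.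
  exists G => _; split=> //.
  - by move=> f /FG1; rewrite inE => ->.
  - by move=> Eg; rewrite !inE /G3; case: pselect => //= _; rewrite inE eqxx !orbT.
  - move=> x; apply: le_trans (G1P x); apply: (nm_sub_proj_mono oE) => // f fG.
    by rewrite inE fG.
  - apply: head_tail => // x; apply: le_trans (G2P x).
    by apply: (nm_sub_proj_mono oE) => // f fG; rewrite !inE fG orbT.
have [h hP] := choice step.
pose F := fix F n := if n is m.+1 then h (m, F m) else (fset0 : {fset H}).
have FE n : fsub (F n) E.
  by elim: n => [|n IH]; [move=> f; rewrite inE|have [] := hP (n, F n) IH].
exists F; split=> //.
- by move=> n; have [] := hP (n, F n) (FE n).
- move=> e Ee eF x; apply: contrapT => /eqP xe.
  have [n ge] : exists n, g n = e by apply: gP; split=> //; exists x.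
  have := eF n.+1; have [_ _ gG _ _] := hP (n, F n) (FE n).
  by rewrite -ge /= gG ?ge.
- by move=> n; have [] := hP (n, F n) (FE n).
- by move=> n; have [] := hP (n, F n) (FE n).
Qed.

(** The points of the chain lying in the finitely many wide blocks all belong to one [F K], whereas
    for m >= K the block number m avoids [F m] and hence [F K]. *)
Lemma slow_chain (F : nat -> {fset H}) t e :
  (forall n, {subset F n <= F n.+1}) ->
  slow (range (fun m => (F m.+3 `\` F m)%fset)) t -> 0 < e ->
  exists K, forall m i j, (K <= m)%N -> i \in (F m.+3 `\` F m)%fset ->
    j \in (F m.+3 `\` F m)%fset -> `|t i - t j| <= e.
Proof.
move=> FS st e0; have Fle m n : (m <= n)%N -> {subset F m <= F n}.
  by move=> /subnK <-; elim: (n - m)%N => // k IHk f fF; exact/FS/IHk.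
have [B BP] := finite_wide_bound st e0.
have [K KP] : exists K, forall i, i \in B -> (exists n, i \in F n) -> i \in F K.
  elim/finSet_rect: B {BP} => B IH.
  have [->|[f fB]] := fset_0Vmem B; first by exists 0%N => i; rewrite inE.
  have [K KP] := IH _ (fproperD1 fB).
  have [[n fn]|fn] := pselect (exists n, f \in F n).
    exists (maxn K n) => i iB iF; have [->|fi] := eqVneq i f.
      by apply: Fle fn; rewrite leq_maxr.
    by apply: (Fle K); [rewrite leq_maxl|apply: KP; rewrite ?inE ?fi].
  exists K => i iB iF; apply: KP => //; rewrite !inE iB andbT.
  by apply/eqP => if'; apply: fn; rewrite -if'.
exists K => m i j Km iV jV; rewrite leNgt; apply/negP => ij.
have wV : wide t e (F m.+3 `\` F m)%fset by exists i, j.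
have iB : i \in B by apply: BP wV _ iV; exists m.
move: iV; rewrite inE => /andP[/negP iFm iFm3]; apply: iFm.
by apply: (Fle K) => //; apply: KP => //; exists m.+3.
Qed.

Lemma chain_family (F : nat -> {fset H}) (V := fun m => (F m.+3 `\` F m)%fset) :
  (forall n, {subset F n <= F n.+1}) -> locally_finite (range V) /\ countable (range V).
Proof.
move=> FS; have Fle m n : (m <= n)%N -> {subset F m <= F n}.
  by move=> /subnK <-; elim: (n - m)%N => // k IHk f fF; exact/FS/IHk.
split; last first.
  by apply: (@sub_countable _ _ _ [set: nat]) => //; exact: card_image_le.
move=> i; have [[n iF]|iF] := pselect (exists n, i \in F n).
  apply: (@sub_finite_set _ _ (V @` `I_n)).
    move=> _ [[m _ <-]]; rewrite inE => /andP[iFm _]; exists m => //=.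
    by rewrite ltnNge; apply: contra iFm => nm; exact: Fle iF.
  exact/finite_image/finite_II.
apply: (@sub_finite_set _ _ set0) => // _ [[m _ <-]]; rewrite inE => /andP[_ iFm].
by apply: iF; exists m.+3.
Qed.

(* With Q_m = F_(m+2) \ F_(m+1) and V_m = F_(m+3) \ F_m, the rows of a in Q_m
   are carried by the columns in V_m up to an error O(2^-m), and on V_m the
   function t is almost constant. The V_m overlap at most three times, so the
   squares of the norms of these pieces can be summed. *)
Lemma slow_commutator_compact a : countable_rows E a ->
  exists W : set {fset H}, [/\ locally_finite W, countable W &
    forall t, slow W t -> Ad E t a - a \in @compact_op R H].
Proof.
move=> ca; have [F [FE FS Frow aout ain]] := band_chain ca.
have [lfW cW] := chain_family FS.
have Fle m n : (m <= n)%N -> {subset F m <= F n}.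
  by move=> /subnK <-; elim: (n - m)%N => // k IHk f fF; exact/FS/IHk.
eexists; split; [exact: lfW|exact: cW|move=> t st].
set d := Ad E t a - a.
apply/(compact_opP oE tE) => e e0.
have [M M0 aM] := opfun_nm a.
(* Chosen so that [c1] = 2 * dl * M below equals e / 4. *)
pose dl := e / (8 * M).
have dl0 : 0 < dl by rewrite divr_gt0// mulr_gt0.
have [dt dt0 dtP] := expi_near1 dl0.
have [K0 K0P] := slow_chain FS st dt0.
have e16 : 0 < e / 16 by rewrite divr_gt0.
have [K K0K Ke] : exists2 K, (K0 <= K)%N & (2^-1 : R) ^+ K <= e / 16.
  have := @cvg_geometric R 1 (2^-1); rewrite ger0_norm ?invr_ge0//.
  rewrite invf_lt1 ?ltr1n// => /(_ isT) /cvgrPdist_lt /(_ _ e16) [N _ NP].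
  exists (maxn K0 N); first exact: leq_maxl.
  have := NP (maxn K0 N) (leq_maxr _ _); rewrite sub0r normrN.
  by rewrite /geometric /= mul1r ger0_norm ?exprn_ge0 ?invr_ge0// => /ltW.
have outb m x : nm (d (proj (F m) x) - proj (F m.+1) (d (proj (F m) x))) <=
    2 * 2^-1 ^+ m * nm x.
  pose x' := dg E (fun e => - t e) x.
  have -> : d (proj (F m) x) = dg E t (a (proj (F m) x')) + - a (proj (F m) x).
    by rewrite opfunB AdE /x' (proj_dg oE tE).
  rewrite sub_projD (le_trans (nmD _ _))// -mulrA mulr_natl mulr2n lerD//.
    rewrite (proj_dg oE tE)// -linearB (le_trans (nm_dg oE tE _ _))//.
    rewrite (le_trans (aout _ _))// ler_wpM2l ?exprn_ge0 ?invr_ge0//.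
    exact: nm_dg.
  by rewrite projN -opprD nmN.
have inb m x : nm (proj (F m) (d (x - proj (F m.+1) x))) <= 2 * 2^-1 ^+ m * nm x.
  pose x' := dg E (fun e => - t e) x.
  have -> : d (x - proj (F m.+1) x) = dg E t (a (x' - proj (F m.+1) x')) -
     a (x - proj (F m.+1) x).
    by rewrite opfunB AdE /x' (proj_dg oE tE)// linearB.
  rewrite projB (le_trans (nmD _ _))// nmN -mulrA mulr_natl mulr2n lerD//.
  rewrite (proj_dg oE tE)// (le_trans (nm_dg oE tE _ _))// (le_trans (ain _ _))//.
  by rewrite ler_wpM2l ?exprn_ge0 ?invr_ge0//; exact: nm_dg.
pose V m := (F m.+3 `\` F m)%fset; pose Q m := (F m.+2 `\` F m.+1)%fset.
have VE m : fsub (V m) E by exact: fsubD.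
have QE m : fsub (Q m) E by exact: fsubD.
pose c1 := 2 * dl * M.
(* Split x along [F m], [V m] and the rest: on [V m] the phases are nearly equal, and the other two
   parts reach [Q m] only through the errors of the band structure. *)
have T1 m x : (K <= m)%N ->
    nm (proj (Q m) (d x)) <= c1 * nm (proj (V m) x) + 4 * 2^-1 ^+ m * nm x.
  move=> Km; pose x1 := proj (V m) x; pose x2 := x - proj (F m.+3) x.
  have -> : d x = d x1 + d x2 + d (proj (F m) x).
    rewrite -!linearD /x1 /x2; congr (d _); rewrite /V proj_fsetD//;
      last by apply: Fle; rewrite ?ltnS ?leqW.
    by rewrite [_ - _ + (x - _)]addrC addrA subrK subrK.
  rewrite (projD (Q m) (d x1 + d x2)) (projD _ (d x1)) (le_trans (nmD _ _))//.
  have h1 : nm (proj (Q m) (d x1)) <= c1 * nm x1.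
    apply: Ad_near => //; try exact: ltW.
      move=> f; rewrite !inE => /andP[fF1 fF2]; apply/andP; split.
        by apply: contra fF1; exact: Fle.
      exact: FS.
    by move=> i j iV jV; apply: dtP; apply: (K0P m) => //; exact: leq_trans Km.
  have h2 : nm (proj (Q m) (d x2)) <= 2 * 2^-1 ^+ m.+2 * nm x.
    apply: le_trans (inb m.+2 x); apply: nm_proj_mono => // f.
    by rewrite inE => /andP[].
  have h3 : nm (proj (Q m) (d (proj (F m) x))) <= 2 * 2^-1 ^+ m * nm x.
    apply: le_trans (outb m x); apply: nm_proj_away => // f.
    by rewrite inE => /andP[].
  have h4 : 2 * 2^-1 ^+ m.+2 * nm x <= 2 * 2^-1 ^+ m * nm x.
    have q0 : 0 <= (2^-1 : R) ^+ m by rewrite exprn_ge0 ?invr_ge0.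
    by rewrite ler_wpM2r ?nm_ge0// !exprS; lra.
  have h5 := nmD (proj (Q m) (d x1)) (proj (Q m) (d x2)).
  apply: (le_trans (lerD (le_trans h5 (lerD h1 (le_trans h2 h4))) h3)).
  by rewrite -/x1 -addrA lerD2l; lra.
have c10 : 0 <= c1 by apply: mulr_ge0 (ltW M0); apply: mulr_ge0 (ltW dl0); rewrite ler0n.
(* By (u + v)^2 <= 2 u^2 + 2 v^2; here 32 = 2 * 4^2. *)
have T2 m x : (K <= m)%N -> energy (Q m) (hdot (d x)) <=
    2 * c1 ^+ 2 * energy (V m) (hdot x) + 32 * (2^-1 ^+ m) ^+ 2 * nm x ^+ 2.
  move=> Km; rewrite -!(nm_comb oE)// -/(proj _ _) -/(proj _ _).
  have := T1 m x Km; set p := nm _; set q := nm (proj (V m) x); set r := nm x.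
  set s := 2^-1 ^+ m => h.
  have p0 : 0 <= p by exact: nm_ge0.
  have : p ^+ 2 <= (c1 * q + 4 * s * r) ^+ 2.
    by rewrite ler_pXn2r ?nnegrE// (le_trans p0 h).
  move=> /le_trans; apply.
  have := sqr_ge0 (c1 * q - 4 * s * r); rewrite -subr_ge0 => h'; nra.
(* The two sums contribute 3/8 and 1/4 of e^2 times the square of the norm of x. *)
have T3 L x : (K <= L)%N -> \sum_(K <= m < L) energy (Q m) (hdot (d x)) <= (e * nm x) ^+ 2.
  move=> KL; set X := nm x ^+ 2; have X0 : 0 <= X by exact: sqr_ge0.
  apply: (@le_trans _ _ (\sum_(K <= m < L)
      (2 * c1 ^+ 2 * energy (V m) (hdot x) + 32 * (2^-1 ^+ m) ^+ 2 * X))).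
    by apply: ler_sum_nat => m /andP[Km _]; exact: T2.
  rewrite big_split /= -mulr_sumr -mulr_suml -mulr_sumr.
  have b1 : \sum_(K <= m < L) energy (V m) (hdot x) <= 3 * X.
    have -> : \sum_(K <= m < L) energy (V m) (hdot x) =
        energy (F L) (hdot x) + energy (F L.+1) (hdot x) + energy (F L.+2) (hdot x) -
        (energy (F K) (hdot x) + energy (F K.+1) (hdot x) + energy (F K.+2) (hdot x)).
      elim: L KL => [|L IH]; first by rewrite leqn0 => /eqP->; rewrite big_geq// subrr.
      rewrite leq_eqVlt => /orP[/eqP->|]; first by rewrite big_geq// subrr.
      rewrite ltnS => KL; rewrite big_nat_recr//= IH// /V energy_fsetD;
      last by apply: Fle; rewrite ?ltnS ?leqW.
      lra.
    have := bessel oE x (FE L); have := bessel oE x (FE L.+1).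
    have := bessel oE x (FE L.+2); rewrite -/X.
    have := energy_ge0 (F K) (hdot x); have := energy_ge0 (F K.+1) (hdot x).
    have := energy_ge0 (F K.+2) (hdot x); lra.
  have b2 : \sum_(K <= m < L) (2^-1 ^+ m) ^+ 2 <= 2 * (2^-1 ^+ K) ^+ 2 :> R.
    (* Subtracting the tail makes the induction work: the sum is 4/3 (4^-K - 4^-L). *)
    suff : \sum_(K <= m < L) (2^-1 ^+ m) ^+ 2 <=
        2 * (2^-1 ^+ K) ^+ 2 - 4 / 3 * (2^-1 ^+ L) ^+ 2 :> R.
      by have := sqr_ge0 ((2^-1 : R) ^+ L); lra.
    elim: L KL {b1} => [|L IH].
      by rewrite leqn0 => /eqP->; rewrite big_geq//; have := sqr_ge0 ((2^-1 : R) ^+ 0); lra.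
    rewrite leq_eqVlt => /orP[/eqP->|].
      by rewrite big_geq//; have := sqr_ge0 ((2^-1 : R) ^+ L.+1); lra.
    rewrite ltnS => KL; rewrite big_nat_recr//=; have := IH KL.
    have -> : (2^-1 ^+ L.+1) ^+ 2 = (2^-1 ^+ L) ^+ 2 / 4 :> R.
      by rewrite (exprS _ L) exprMn mulrC; congr (_ * _); rewrite exprVn -natrX.
    have := sqr_ge0 ((2^-1 : R) ^+ L); lra.
  have c1E : c1 = e / 4 by rewrite /c1 /dl; field; rewrite gt_eqF.
  have q0 : 0 <= (2^-1 : R) ^+ K by rewrite exprn_ge0// invr_ge0.
  have b3 : (2^-1 ^+ K) ^+ 2 <= (e / 16) ^+ 2 :> R.
    by rewrite ler_pXn2r ?nnegrE// ltW.
  rewrite c1E [leRHS]exprMn -/X.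
  have b4 : 2 * (e / 4) ^+ 2 * (\sum_(K <= m < L) energy (V m) (hdot x)) <=
     2 * (e / 4) ^+ 2 * (3 * X) by rewrite ler_wpM2l// mulr_ge0// sqr_ge0.
  have b5 : 32 * (\sum_(K <= m < L) (2^-1 ^+ m) ^+ 2) * X <= 32 * (2 * (e / 16) ^+ 2) * X.
    by rewrite ler_wpM2r// ler_wpM2l// (le_trans b2)// ler_wpM2l.
  apply: (le_trans (lerD b4 b5)).
  have eX : 0 <= e ^+ 2 * X by rewrite mulr_ge0// sqr_ge0.
  nra.
(* The sets [Q m] with m >= K cover the chain beyond [F K.+1]; rows off the chain vanish for a and
   for its conjugate. *)
exists (F K.+1) => // x; apply: (nm_le_energy oE tE).
  by rewrite mulr_ge0 ?nm_ge0// ltW.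
move=> G GE.
have [L KL LP] : exists2 L, (K <= L)%N &
    forall f, f \in G -> (exists n, f \in F n) -> f \in F L.+1.
  elim/finSet_rect: G {GE} => G IH.
  have [->|[f fG]] := fset_0Vmem G; first by exists K => // i; rewrite inE.
  have [L KL LP] := IH _ (fproperD1 fG).
  have [[n fn]|fn] := pselect (exists n, f \in F n).
    exists (maxn L n) => [|i iG iF]; first by rewrite leq_max KL.
    have [->|fi] := eqVneq i f.
      by apply: Fle fn; rewrite leqW// leq_maxr.
    by apply: (Fle L.+1); [rewrite ltnS leq_maxl|apply: LP; rewrite ?inE ?fi].
  exists L => // i iG iF; apply: LP => //; rewrite !inE iG andbT.
  by apply/eqP => if'; apply: fn; rewrite -if'.
apply: le_trans (T3 L x KL).
have -> : \sum_(K <= m < L) energy (Q m) (hdot (d x)) =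
    energy (F L.+1 `\` F K.+1)%fset (hdot (d x)).
  rewrite energy_fsetD;
      last by apply: Fle; rewrite ?ltnS ?leqW.
  elim: L KL {LP} => [|L IH]; first by rewrite leqn0 => /eqP->; rewrite big_geq// subrr.
  rewrite leq_eqVlt => /orP[/eqP->|]; first by rewrite big_geq// subrr.
  rewrite ltnS => KL; rewrite big_nat_recr//= IH// /Q energy_fsetD;
      last by apply: Fle; rewrite ?ltnS ?leqW.
  lra.
pose c f := if f \in (F L.+1 `\` F K.+1)%fset then hdot (d x) f else 0.
have -> : energy G (hdot (d x - proj (F K.+1) (d x))) = energy G c.
  apply: eq_energy => f fG; have Ef := GE f fG.
  rewrite hdotBl (hdot_proj oE)// /c inE.
  have [fK|fK] /= := boolP (f \in F K.+1); first by rewrite subrr.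
  rewrite subr0; case: ifPn => // fL.
  have frow n : f \notin F n.
    by apply: contra fL => fn; apply: LP => //; exists n.
  suff : hdot (Ad E t a x - a x) f = 0 by [].
  by rewrite hdotBl AdE hdot_dg// !Frow// mulr0 subrr.
have GU : {subset G <= (G `|` (F L.+1 `\` F K.+1))%fset} by move=> f fG; rewrite inE fG.
apply: le_trans (subset_energy c GU) _.
have FU : {subset (F L.+1 `\` F K.+1)%fset <= (G `|` (F L.+1 `\` F K.+1))%fset}.
  by move=> f fG; rewrite inE fG orbT.
rewrite /energy (big_fsub _ FU) [X in _ + X]big1 ?addr0; last first.
  by move=> f _; case: ifPn => // /negbTE fF; rewrite /c fF nm0 expr0n.
by rewrite big_seq [leRHS]big_seq; apply: ler_sum => f fF; rewrite /c fF.
Qed.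

End BandStructure.

(** * The algebra J/K *)

Section CalkinAlgebra.
Context {R : realType} {H : hilbertType R}.
Implicit Types (x y z : calkin H) (a b : BH H) (t : H -> R) (F : {fset H}).
Local Open Scope complex_scope.

Lemma calkin_ind (P : calkin H -> Prop) : (forall a, P (calkin_pi a)) -> forall x, P x.
Proof. by move=> h x; rewrite -(calkin_reprK x). Qed.

Lemma calkin_pi0 : calkin_pi (0 : BH H) = 0.
Proof. by rewrite -(subrr (0 : BH H)) calkin_piB subrr. Qed.

Lemma calkin_piN a : calkin_pi (- a) = - calkin_pi a.
Proof. by rewrite -sub0r calkin_piB calkin_pi0 sub0r. Qed.

Lemma calkin_pi_scale k a : calkin_pi (k *: a) = k *: calkin_pi a.
Proof. by rewrite -calkin_piZ. Qed.

Lemma calkin_mulA : associative (@calkin_mul R H).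
Proof.
by elim/calkin_ind=> a; elim/calkin_ind=> b; elim/calkin_ind=> c;
  rewrite -!calkin_piM; congr calkin_pi; apply: opP.
Qed.

Lemma calkin_mulDl : left_distributive (@calkin_mul R H) +%R.
Proof.
elim/calkin_ind=> a; elim/calkin_ind=> b; elim/calkin_ind=> c.
by rewrite -calkin_piD -!calkin_piM -calkin_piD; congr calkin_pi; apply: opP.
Qed.

Lemma calkin_mulDr : right_distributive (@calkin_mul R H) +%R.
Proof.
elim/calkin_ind=> a; elim/calkin_ind=> b; elim/calkin_ind=> c.
rewrite -calkin_piD -!calkin_piM -calkin_piD; congr calkin_pi; apply: opP => x.
by rewrite /= linearD.
Qed.

Lemma calkin_mulZl k x y : calkin_mul (k *: x) y = k *: calkin_mul x y.
Proof.
elim/calkin_ind: x => a; elim/calkin_ind: y => b.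
by rewrite -calkin_piM -!calkin_pi_scale -!calkin_piM; congr calkin_pi; apply: opP.
Qed.

Lemma calkin_mulZr k x y : calkin_mul x (k *: y) = k *: calkin_mul x y.
Proof.
elim/calkin_ind: x => a; elim/calkin_ind: y => b.
rewrite -calkin_piM -!calkin_pi_scale -!calkin_piM; congr calkin_pi; apply: opP => x.
by rewrite /= linearZ.
Qed.

Section Basis.
Variables (E : set H) (oE : orthonormal_set E) (tE : total_set E).

Lemma calkin_star_pi a : calkin_star (calkin_pi a) = calkin_pi (bh_adj a).
Proof.
apply/calkin_piP; rewrite -(adjB oE tE); apply: (compact_adj oE tE).
by apply/calkin_piP; rewrite calkin_reprK.
Qed.

Lemma calkin_starK : involutive (@calkin_star R H).
Proof. by elim/calkin_ind=> a; rewrite !calkin_star_pi (adjK oE tE). Qed.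

Lemma calkin_starM x y :
  calkin_star (calkin_mul x y) = calkin_mul (calkin_star y) (calkin_star x).
Proof.
elim/calkin_ind: x => a; elim/calkin_ind: y => b.
by rewrite -calkin_piM !calkin_star_pi -calkin_piM (adj_comp oE tE).
Qed.

Definition AD t x : calkin H :=
  calkin_mul (calkin_mul (calkin_pi (dg E t)) x) (calkin_pi (dg E (fun e => - t e))).

Lemma AD_pi t a : AD t (calkin_pi a) = calkin_pi (Ad E t a).
Proof. by rewrite /AD -!calkin_piM. Qed.

Lemma ADD t x y : AD t (x + y) = AD t x + AD t y.
Proof. by rewrite /AD calkin_mulDr calkin_mulDl. Qed.

Lemma ADZ t k x : AD t (k *: x) = k *: AD t x.
Proof. by rewrite /AD calkin_mulZr calkin_mulZl. Qed.

Lemma ADM t x y : AD t (calkin_mul x y) = calkin_mul (AD t x) (AD t y).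
Proof.
elim/calkin_ind: x => a; elim/calkin_ind: y => b.
rewrite -calkin_piM !AD_pi -calkin_piM; congr calkin_pi; apply: opP => u /=.
by rewrite (dgNK oE tE).
Qed.

Lemma AD_star t x : AD t (calkin_star x) = calkin_star (AD t x).
Proof.
elim/calkin_ind: x => a; rewrite AD_pi !calkin_star_pi AD_pi; congr calkin_pi.
rewrite /Ad !(adj_comp oE tE) !(adj_dg oE tE).
have -> : (fun e => - - t e) = t by apply/funext => e; rewrite opprK.
exact: opP.
Qed.

Lemma AD_add t t' x : AD (fun e => t e + t' e) x = AD t (AD t' x).
Proof.
elim/calkin_ind: x => a; rewrite !AD_pi; congr calkin_pi; apply: opP => u /=.
rewrite (dgD oE tE) -(dgD oE tE (fun e => - t' e)).
by have -> : (fun e => - (t e + t' e)) = (fun e => - t' e + - t e)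
  by apply/funext => e; rewrite opprD addrC.
Qed.

Lemma AD0 x : AD (fun=> 0) x = x.
Proof.
elim/calkin_ind: x => a; rewrite AD_pi; congr calkin_pi; apply: opP => u /=.
rewrite (dg0 oE tE).
have -> : (fun=> - 0) = (fun=> 0) :> (H -> R) by apply/funext => e; rewrite oppr0.
by rewrite (dg0 oE tE).
Qed.

Variables (I : Type) (I1 : is_aleph1 [set: I]).
Let S : set (calkin H) := JmodK I.

Lemma JmodKP x : S x <-> exists2 a, countable_rows E a & calkin_pi a = x.
Proof.
split=> [[a Ja <-]|[a ca <-]].
  by exists a => //; exact: small_range_countable_rows Ja.
by exists a => //; exact: (countable_rows_small_range I1 oE tE).
Qed.

(** If row f of the adjoint is nonzero then so is a f, hence some nonzero row e of a has a nonzero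
    entry at f; each e meets countably many f. *)
Lemma countable_rows_adj a : countable_rows E a -> countable_rows E (bh_adj a).
Proof.
move=> ca; pose A := [set e | E e /\ exists u, hdot (a u) e != 0].
apply: (@sub_countable _ _ _
    (\bigcup_(e in A) [set f | E f /\ hdot (bh_adj a e) f != 0])); last first.
  by apply: bigcup_countable => // e _; exact: countable_coefs.
apply: subset_card_le => f [Ef [u uf]]; apply: contrapT => fA.
have af0 : a f = 0.
  apply: tE => e Ee; apply: contrapT => /eqP afe; apply: fA.
  exists e; first by split=> //; exists f.
  split=> //; rewrite hdotJ -(hdot_adj oE tE); apply/negP => /eqP.
  by move/(congr1 conjc); rewrite conjcK conjc0 => /eqP; exact/negP.
move: uf; rewrite hdotJ -(hdot_adj oE tE) af0 hdot0l conjc0.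
by rewrite eqxx.
Qed.

Lemma JmodK_add x y : S x -> S y -> S (x + y).
Proof.
move=> /JmodKP[a ca <-] /JmodKP[b cb <-]; apply/JmodKP.
exists (a + b); last by rewrite calkin_piD.
pose U := [set e | E e /\ exists u, hdot (a u) e != 0] `|`
  [set e | E e /\ exists u, hdot (b u) e != 0].
apply: (@sub_countable _ _ _ U); last first.
  rewrite /U -bigcup2E; apply: bigcup_countable => // -[|[|i]] _ //=.
apply: subset_card_le => e [Ee [u]]; rewrite opfunD hdotDl => ue.
have [ae|ae] := eqVneq (hdot (a u) e) 0; last by left; split=> //; exists u.
by right; split=> //; exists u; move: ue; rewrite ae add0r.
Qed.

Lemma JmodK_mul x y : S x -> S (calkin_mul x y).
Proof.
move=> /JmodKP[a ca <-]; elim/calkin_ind: y => b; apply/JmodKP.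
exists (bh_comp a b); last by rewrite calkin_piM.
apply: sub_countable ca; apply: subset_card_le => e [Ee [u ue]].
by split=> //; exists (b u).
Qed.

Lemma JmodK_star x : S x -> S (calkin_star x).
Proof.
move=> /JmodKP[a ca <-]; rewrite calkin_star_pi; apply/JmodKP.
by exists (bh_adj a) => //; exact: countable_rows_adj.
Qed.

Lemma JmodK_scale k x : S x -> S (k *: x).
Proof.
move=> /JmodKP[a ca <-]; apply/JmodKP; exists (k *: a); last by rewrite calkin_pi_scale.
apply: sub_countable ca; apply: subset_card_le => e [Ee [u ue]].
split=> //; exists u; move: ue; rewrite opfunZ hdotZl.
by apply: contraNN => /eqP->; rewrite mulr0.
Qed.

Lemma JmodK_AD t x : S x -> S (AD t x).
Proof.
move=> Sx; apply: JmodK_mul; move: Sx => /JmodKP[a ca <-]; apply/JmodKP.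
exists (bh_comp (dg E t) a); last by rewrite calkin_piM.
apply: sub_countable ca; apply: subset_card_le => e [Ee [u ue]].
split=> //; exists u; move: ue; rewrite bh_compE hdot_dg//.
by apply: contraNN => /eqP->; rewrite mulr0.
Qed.

Lemma AD_slow x : S x -> exists W : set {fset H},
  [/\ locally_finite W, countable W & forall t, slow W t -> AD t x = x].
Proof.
move=> /JmodKP[a ca <-].
have [W [lfW cW WP]] := slow_commutator_compact oE tE ca.
by exists W; split=> // t /WP h; rewrite AD_pi; apply/calkin_piP.
Qed.

Section Corner.
Variables (N0 : set H) (N0E : N0 `<=` E) (cN0 : countable N0) (iN0 : infinite_set N0).

Definition corner : calkin H := calkin_pi (diag E (fun e => (e \in N0)%:R)).

Lemma hdot_corner u e : E e ->
  hdot (diag E (fun e => (e \in N0)%:R) u) e = if e \in N0 then hdot u e else 0.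
Proof.
move=> Ee; rewrite hdot_diag//; first by case: ifP; rewrite ?mul1r ?mul0r.
by move=> f; case: (f \in N0); rewrite ?nm1 ?nm0.
Qed.

Lemma JmodK_corner : S corner.
Proof.
apply/JmodKP; exists (diag E (fun e => (e \in N0)%:R)) => //.
apply: sub_countable cN0; apply: subset_card_le => e [Ee [u]].
by rewrite hdot_corner//; case: ifPn => [/set_mem|_] //; rewrite eqxx.
Qed.

(* x is the class of the shift z_(n+1) |-> z_n, and t increases by pi along each
   of its steps. *)
Lemma split_element (W : nat -> set {fset H}) : (forall n, locally_finite (W n)) ->
  exists x t, [/\ S x, calkin_mul corner x = x /\ calkin_mul x corner = x,
    x != 0, AD t x = - x & forall n, slow (W n) t].
Proof.
move=> lfW; have lfU n : locally_finite (upto W n) by exact: locally_finite_upto.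
have [t [z [st zinj N0z tz]]] := @slow_split R _ _ N0 lfU (@upto_mono _ W) iN0.
have Ez n : E (z n) by exact: N0E.
pose idx e := if pselect (exists n, z n = e) is left P then Some (sval (cid P)) else None.
have idxz n : idx (z n) = Some n.
  rewrite /idx; case: pselect => [P|[]]; last by exists n.
  by case: cid => m /= /zinj->.
have idxP e n : idx e = Some n -> e = z n.
  by rewrite /idx; case: pselect => // P; case: cid => /= m <- [<-].
pose m e : R[i] := if idx e is Some n then 1 else 0.
pose s e := if idx e is Some n then z n.+1 else e.
have [|||b bP] := @weighted_shift _ _ E oE tE m s.
- by move=> e _; rewrite /m; case: (idx e); rewrite ?nm1 ?nm0.
- by move=> e Ee _; rewrite /s; case: (idx e).
- move=> e e' _ _; rewrite /m /s; case eE: (idx e) => [n|]; rewrite ?eqxx//.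
  case eE': (idx e') => [n'|]; rewrite ?eqxx// => _ _ /zinj[nn'].
  by rewrite (idxP _ _ eE) (idxP _ _ eE') nn'.
have bz u n : hdot (b u) (z n) = hdot u (z n.+1).
  by rewrite bP// /m /s idxz mul1r.
have b0 u e : E e -> (forall n, e <> z n) -> hdot (b u) e = 0.
  move=> Ee ez; rewrite bP// /m; case eE: (idx e) => [n|]; rewrite ?mul0r//.
  by case: (ez n); exact: idxP.
have bext (c : BH H) : (forall u n, hdot (c u) (z n) = hdot (b u) (z n)) ->
    (forall u e, E e -> (forall n, e <> z n) -> hdot (c u) e = 0) -> c = b.
  move=> h1 h2; apply: opP => u; apply: (hdot_ext tE) => e Ee.
  have [[n ->]|ez] := pselect (exists n, e = z n); first exact: h1.
  have ez' n : e <> z n by move=> en; apply: ez; exists n.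
  by rewrite h2// b0.
exists (calkin_pi b), t; split.
- apply/JmodKP; exists b => //; apply: sub_countable cN0.
  apply: subset_card_le => e [Ee [u ue]]; apply: contrapT => eN0.
  by move/negP: ue; apply; rewrite b0// => n en; apply: eN0; rewrite en.
- rewrite /corner -!calkin_piM; split; congr calkin_pi; apply: bext => [u n|u e Ee ez].
  + by rewrite bh_compE hdot_corner// mem_set.
  + by rewrite bh_compE hdot_corner//; case: ifP => // _; exact: b0.
  + by rewrite bh_compE !bz hdot_corner// mem_set.
  + by rewrite bh_compE b0.
(* Not compact: b sends the unit vector [z n.+1] to [z n], which lies outside any given finite F for
   some n. *)
- rewrite -calkin_pi0; apply/negP => /eqP/calkin_piP; rewrite subr0 => /(compact_opP oE tE) h.
  have [|F FE bF] := h 2^-1; first by rewrite invr_gt0.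
  have [n nF] : exists n, z n \notin F.
    apply: contrapT => zF; apply: infinite_nat.
    rewrite -(eq_finite_set (inj_card_eq (f := z) (A := [set: nat]) _)).
      apply: sub_finite_set (finite_fset F) => _ [n _ <-] /=.
      by apply: contrapT => nF; apply: zF; exists n; exact/negP.
    by move=> i j _ _; exact: zinj.
  have := bF (z n.+1); rewrite (nm_orthonormal oE (Ez _)) mulr1 leNgt; apply/negP/negPn.
  apply: (@lt_le_trans _ _ (nm (hdot (b (z n.+1) - proj F (b (z n.+1))) (z n)))).
    rewrite hdotBl (hdot_proj oE)// (negbTE nF) subr0 bz oE ?mem_set// eqxx nm1.
    by rewrite invf_lt1 ?ltr1n.
  by rewrite (le_trans (cauchy_schwarz _ _))// (nm_orthonormal oE (Ez _)) mulr1.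
- have tb : - Ad E t b = b.
    apply: bext => [u n|u e Ee ez]; last first.
      by rewrite opfunN AdE -scaleN1r hdotZl hdot_dg// b0// !mulr0.
    rewrite opfunN AdE -scaleN1r hdotZl hdot_dg// !bz hdot_dg// !tz mulrA mulrA.
    rewrite -mulrA -mulrA [expi _ * _]mulrA -expiD.
    have -> : pi * n.+1%:R - pi * n.+2%:R = - pi :> R.
      by rewrite -[n.+2%:R]natr1 mulrDr mulr1 opprD addrA subrr sub0r.
    by rewrite expiN expi_pi rmorphN rmorph1 mulrA mulrNN !mul1r.
  by rewrite AD_pi -[in RHS]tb calkin_piN opprK.
- by move=> n; apply: slow_sub (st n); exact: sub_upto.
Qed.

End Corner.
End Basis.
End CalkinAlgebra.

(** * Cardinalities *)

Section Cardinals.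

Definition inj_into {T U : Type} (f : T -> U) (A : set T) (B : set U) : Prop :=
  (forall x, A x -> B (f x)) /\ (forall x y, A x -> A y -> f x = f y -> x = y).

Lemma inj_into_card_le {T U : Type} (f : T -> U) (A : set T) (B : set U) :
  inj_into f A B -> A #<= B.
Proof.
move=> [fAB finj]; suff /injfunPex[g] : exists2 f : T -> U, set_fun A B f & set_inj A f.
  exact: inj_card_le.
by exists f => // x y /set_mem Ax /set_mem Ay; exact: finj.
Qed.

Lemma card_le_inj_into {T U : Type} (A : set T) (B : set U) (u0 : U) :
  A #<= B -> exists f : T -> U, inj_into f A B.
Proof.
move=> /card_leP[f].
pose g x := if pselect (A x) is left Ax then set_val (f (SigSub (mem_set Ax))) else u0.
exists g; split=> [x Ax|x y Ax Ay].
  by rewrite /g; case: pselect => // Ax'; exact: set_valP.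
rewrite /g; case: pselect => // Ax'; case: pselect => // Ay' /val_inj.
by move=> /(@inj _ _ _ f _ _ (mem_set Logic.I) (mem_set Logic.I)) [].
Qed.

Lemma no_inj_from_powerset {T : Type} (f : set T -> T) : ~ injective f.
Proof.
move=> finj; pose D : set T := [set t | exists2 A, f A = t & ~ A t].
have [Df|Df] := pselect (D (f D)); last by apply: (Df); exists D.
by case: (Df) => A /finj AD nA; apply: nA; rewrite AD.
Qed.

Lemma uncountable_sets_nat : ~ countable [set: set nat].
Proof.
move=> c; have [f [_ fi]] := card_le_inj_into 0%N c.
by apply: (@no_inj_from_powerset nat f) => A B; exact: fi.
Qed.

Lemma countType_powerset_inj (K : countType) : exists f : set K -> set nat, injective f.
Proof.
exists (fun A => choice.pickle @` A) => A B AB.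
apply/seteqP; split=> x Ax.
  have : (choice.pickle @` B) (choice.pickle x) by rewrite -AB; exists x.
  by case=> y By /(pcan_inj choice.pickleK) <-.
have : (choice.pickle @` A) (choice.pickle x) by rewrite AB; exists x.
by case=> y By /(pcan_inj choice.pickleK) <-.
Qed.

(* Transport the order of the shortest uncountable initial segment. *)
Lemma well_order_aleph1 (I : Type) : is_aleph1 [set: I] ->
  exists lt : I -> I -> Prop, [/\ well_founded lt,
    forall x y, [\/ lt x y, x = y | lt y x],
    forall x y z, lt x y -> lt y z -> lt x z &
    forall x, countable [set y | lt y x]].
Proof.
move=> [Iunc Imin].
have [R Rwo] := well_ordering_principle {classic I}.
(* Least elements are unique in a well-order, and x and y would both be least in {x, y}. *)
have anti x y : R x y -> R y x -> x = y.
  move=> xy yx; have /Rwo[z [_ zu]] : nonempty [pred w : {classic I} | (w == x) || (w == y)].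
    by exists x; rewrite inE eqxx.
  have xx : R x x.
    have /Rwo[w [[/eqP wx wl] _]] : nonempty (pred1 (x : {classic I})) by exists x; rewrite inE.
    by have := wl w; rewrite -wx; apply; rewrite inE.
  have yy : R y y.
    have /Rwo[w [[/eqP wx wl] _]] : nonempty (pred1 (y : {classic I})) by exists y; rewrite inE.
    by have := wl w; rewrite -wx; apply; rewrite inE.
  rewrite -(zu x) ?(zu y)//; split; rewrite ?inE ?eqxx ?orbT//.
    by move=> w; rewrite inE => /orP[/eqP->|/eqP->].
  by move=> w; rewrite inE => /orP[/eqP->|/eqP->].
have mini (P : I -> Prop) : (exists x, P x) -> exists2 x, P x & forall y, P y -> R x y.
  move=> [x0 Px0]; have /Rwo[z [[Pz zl] _]] : nonempty [pred w : {classic I} | `[< P w >]].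
    by exists x0; rewrite inE; exact/asboolP.
  exists z; first by move: Pz; rewrite inE => /asboolP.
  by move=> y Py; apply: zl; rewrite inE; exact/asboolP.
pose lt0 x y := R x y /\ x <> y.
have wf0 : well_founded lt0.
  move=> x; apply: contrapT => nA.
  have [z nAz zl] := mini (fun x => ~ Acc lt0 x) (ex_intro _ x nA).
  apply: nAz; constructor=> y [Ryz yz]; apply: contrapT => nAy.
  by apply: yz; apply: anti => //; exact: zl.
have tot0 x y : [\/ lt0 x y, x = y | lt0 y x].
  have [->|xy] := pselect (x = y); first by constructor 2.
  have [z [->|->] zl] := mini (fun w => w = x \/ w = y) (ex_intro _ x (or_introl erefl)).
    by constructor 1; split=> //; apply: zl; right.
  by constructor 3; split=> [|/esym//]; apply: zl; left.
have tr0 x y z : lt0 x y -> lt0 y z -> lt0 x z.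
  move=> [xy nxy] [yz nyz].
  have [w ww wl] := mini (fun w => [\/ w = x, w = y | w = z]) (ex_intro _ x (Or31 _ _ erefl)).
  have wx : w = x.
    have := wl x (Or31 _ _ erefl); have := wl y (Or32 _ _ erefl).
    case: ww => -> // h1 h2; first by apply/esym; exact: anti.
    by case: nyz; exact: anti.
  have xz : R x z by rewrite -wx; apply: wl; constructor 3.
  by split=> // xz'; apply: nxy; apply: anti => //; rewrite xz'.
suff [h [hinj hc]] : exists h : I -> I, injective h /\
    forall x, countable [set y | lt0 y (h x)].
  exists (fun x y => lt0 (h x) (h y)); split.
  - move=> x; have [y yE] : exists y, y = h x by exists (h x).
    elim/(well_founded_ind wf0): y x yE => y IH x yE.
    by constructor=> z zx; apply: (IH (h z)) => //; rewrite yE.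
  - move=> x y; case: (tot0 (h x) (h y)) => [|/hinj|];
      [by constructor 1|by constructor 2|by constructor 3].
  - by move=> x y z; exact: tr0.
  - move=> x; apply: sub_countable (hc x); apply: (@inj_into_card_le _ _ h).
    by split=> // y z _ _ /hinj.
have [hc|hc] := pselect (forall x, countable [set y | lt0 y x]).
  by exists id; split.
(* Points below x0 have countable segments by minimality, and I embeds in the segment of x0 since
   aleph_1 is the least uncountable cardinal. *)
have [x0 x0u x0l] : exists2 x, ~ countable [set y | lt0 y x] &
    forall y, ~ countable [set z | lt0 z y] -> R x y.
  apply: mini; apply: contrapT => nx; apply: hc => x; apply: contrapT => cx.
  by apply: nx; exists x.
have [h [hx0 hi]] := card_le_inj_into x0 (Imin _ _ x0u).
exists h; split=> [x y|x]; first exact: hi.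
apply: contrapT => /x0l Rx0; have [Rh nh] := hx0 x Logic.I.
by apply: nh; exact: anti.
Qed.

End Cardinals.

(** * The cardinality of J/K under the continuum hypothesis *)

Section Counting.
Context {R : realType} {H : hilbertType R}.
Implicit Types (a b : BH H).
Local Open Scope complex_scope.
Variables (I : Type) (I1 : is_aleph1 [set: I]) (ch : CH).

Lemma aleph1_inhabited : exists i : I, True.
Proof.
apply: contrapT => nI; apply: I1.1.
suff -> : [set: I] = set0 by exact: countable0.
by apply/seteqP; split=> // i _; apply: nI; exists i.
Qed.

Lemma aleph1_inj_powerset : exists f : I -> set nat, injective f.
Proof.
have [f [_ fi]] := card_le_inj_into set0 (I1.2 _ _ uncountable_sets_nat).
by exists f => x y; exact: fi.
Qed.

(** The one place where the continuum hypothesis itself is applied: the power set of nat is no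
    larger than the uncountable set I. *)
Lemma powerset_inj_aleph1 (K : countType) : exists f : set K -> I, injective f.
Proof.
have [i0 _] := aleph1_inhabited; have [f fi] := countType_powerset_inj K.
have [g [_ gi]] := card_le_inj_into i0 (ch.2 _ _ I1.1).
by exists (g \o f) => x y /= /gi-/(_ Logic.I Logic.I)/fi.
Qed.

(** A pair of sets of naturals is one set in a disjoint sum, which replaces ordinal arithmetic. *)
Lemma aleph1_pair_inj : exists f : I * I -> I, injective f.
Proof.
have [c ci] := aleph1_inj_powerset.
have [d di] := powerset_inj_aleph1 (nat + nat)%type.
exists (fun p => d [set w | match w with inl k => c p.1 k | inr k => c p.2 k end]).
move=> [x y] [x' y'] /di/= e; congr pair; apply: ci; apply/funext => k.
  exact: (congr1 (fun f => f (inl k)) e).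
exact: (congr1 (fun f => f (inr k)) e).
Qed.

Lemma rat_cut_inj (s t : R) : (forall q : rat, ratr q < s <-> ratr q < t) -> s = t.
Proof.
move=> h; apply: contrapT => /eqP; rewrite neq_lt => /orP[st|ts].
  have [q] := rat_in_itvoo st; rewrite in_itv /= => /andP[sq qt].
  by have := (h q).2 qt; rewrite ltNge ltW.
have [q] := rat_in_itvoo ts; rewrite in_itv /= => /andP[tq qs].
by have := (h q).1 qs; rewrite ltNge ltW.
Qed.

Variables (E : set H) (oE : orthonormal_set E) (tE : total_set E) (EI : E #= [set: I]).

Lemma basis_nonempty : exists e, E e.
Proof.
apply: contrapT => nE; apply: I1.1; apply: (@sub_countable _ _ _ E).
  by move/card_eqPle: EI => [].
suff -> : E = set0 by exact: countable0.
by apply/seteqP; split=> // e Ee; apply: nE; exists e.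
Qed.

Lemma matrix_ext a b :
  (forall e f, E e -> E f -> hdot (a e) f = hdot (b e) f) -> a = b.
Proof.
move=> ab; apply: opP => x; apply: (hdot_ext tE) => f Ef.
rewrite !(hdot_adj oE tE).
suff -> : bh_adj a f = bh_adj b f by [].
apply: (hdot_ext tE) => e Ee; rewrite hdotJ [RHS]hdotJ.
by rewrite -!(hdot_adj oE tE) ab.
Qed.

(** The nonzero columns of a are the nonzero rows of its adjoint, so one enumeration of both kinds
    of rows locates all nonzero entries. *)
Lemma countable_rows_support a : countable_rows E a -> exists g : nat -> H,
  [/\ forall n, E (g n),
     forall e, E e -> (forall n, g n <> e) -> a e = 0 &
     forall f, E f -> (forall n, g n <> f) -> forall x, hdot (a x) f = 0].
Proof.
move=> ca; have [e0 Ee0] := basis_nonempty.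
pose A := [set e | E e /\ exists x, hdot (a x) e != 0].
pose B := [set e | E e /\ exists x, hdot (bh_adj a x) e != 0].
have cAB : countable (A `|` B).
  rewrite -bigcup2E; apply: bigcup_countable => // -[|[|i]] _ //=.
  exact: (countable_rows_adj oE tE).
have [g [gE gP]] := countable_enum e0 cAB.
exists g; split.
- by move=> n; have [[[]|[]]|->] := gE n.
- move=> e Ee ge; apply: tE => f Ef; apply: contrapT => /eqP aef.
  have [|n] := gP e; last exact: ge.
  right; split=> //; exists f; rewrite hdotJ -(hdot_adj oE tE).
  by apply: contraNN aef => /eqP/(congr1 conjc); rewrite conjcK conjc0 => /eqP.
- move=> f Ef gf x; apply: contrapT => /eqP axf.
  by have [|n] := gP f; [left; split=> //; exists x|exact: gf].
Qed.

(* A representative of x is determined by an enumeration of the countably many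
   basis vectors involved and by the rational cuts of its matrix entries. *)
Lemma JmodK_inj : exists f : calkin H -> I, inj_into f (JmodK I) [set: I].
Proof.
have [c0 c0i] := aleph1_inj_powerset.
have [i0 _] := aleph1_inhabited.
have [h [_ hi]] : exists h : H -> I, inj_into h E [set: I].
  by apply: (card_le_inj_into i0); move/card_eqPle: EI => [].
pose c := c0 \o h.
have ci e f : E e -> E f -> c e = c f -> e = f.
  by move=> Ee Ef /c0i; exact: hi.
have rep (x : calkin H) : exists ag : BH H * (nat -> H), JmodK I x ->
    calkin_pi ag.1 = x /\ [/\ forall n, E (ag.2 n),
     forall e, E e -> (forall n, ag.2 n <> e) -> ag.1 e = 0 &
     forall f, E f -> (forall n, ag.2 n <> f) -> forall x, hdot (ag.1 x) f = 0].
  have [Sx|Sx] := pselect (JmodK I x); last by exists (0, fun=> 0).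
  have /(JmodKP oE tE I1)[a ca ax] := Sx.
  by have [g gP] := countable_rows_support ca; exists (a, g).
have [r rP] := choice rep.
have [d di] := powerset_inj_aleph1 (nat * nat + nat * nat * bool * rat)%type.
pose code x : set (nat * nat + nat * nat * bool * rat) := fun w =>
  match w with
  | inl nk => c ((r x).2 nk.1) nk.2
  | inr nmbq => let z := hdot ((r x).1 ((r x).2 nmbq.1.1.1)) ((r x).2 nmbq.1.1.2) in
      ratr nmbq.2 < (if nmbq.1.2 then complex.Re z else complex.Im z)
  end.
exists (d \o code); split=> // x y Sx Sy /di xy.
have [ax [gE gc gr]] := rP x Sx; have [ay [gE' gc' gr']] := rP y Sy.
rewrite -ax -ay; congr calkin_pi.
have gg n : (r x).2 n = (r y).2 n.
  apply: ci => //; apply/funext => k; apply/propext.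
  by have := congr1 (fun f => f (inl (n, k))) xy; rewrite /code /= => ->.
have zz n m : hdot ((r x).1 ((r x).2 n)) ((r x).2 m) =
    hdot ((r y).1 ((r y).2 n)) ((r y).2 m).
  have cut (re : bool) : (if re then complex.Re (hdot ((r x).1 ((r x).2 n)) ((r x).2 m))
      else complex.Im (hdot ((r x).1 ((r x).2 n)) ((r x).2 m))) =
     (if re then complex.Re (hdot ((r y).1 ((r y).2 n)) ((r y).2 m))
      else complex.Im (hdot ((r y).1 ((r y).2 n)) ((r y).2 m))).
    apply: rat_cut_inj => q.
    by have := congr1 (fun f => f (inr (n, m, re, q))) xy; rewrite /code /= => ->.
  by apply/eqP; rewrite eq_complex (cut true) (cut false) !eqxx.
apply: matrix_ext => e f Ee Ef.
have [[n ne]|ne] := pselect (exists n, (r x).2 n = e); last first.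
  rewrite gc// ?gc'// => n; last by move=> E1; apply: ne; exists n.
  by rewrite -gg => E1; apply: ne; exists n.
have [[m mf]|mf] := pselect (exists n, (r x).2 n = f); last first.
  rewrite gr// ?gr'// => m; last by move=> E1; apply: mf; exists m.
  by rewrite -gg => E1; apply: mf; exists m.
by rewrite -ne -mf zz !gg.
Qed.

End Counting.

(** * The tree of coherent phases *)

(** The step receives a total function, with t0 at indices not below w, so that it can come from
    [choice] without dependent types. *)
Lemma well_founded_recursion {I T : Type} (lt : I -> I -> Prop) (t0 : T)
    (G : I -> (I -> T) -> T) : well_founded lt ->
  exists Q : I -> T, forall w, Q w = G w (fun v => if pselect (lt v w) then Q v else t0).
Proof.
move=> wf; pose step w (rec : forall v, lt v w -> T) : T :=
  G w (fun v => if pselect (lt v w) is left l then rec v l else t0).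
exists (Fix wf (fun=> T) step) => w; rewrite Fix_eq.
  by congr (G w _); apply/funext => v; case: pselect.
by move=> v f g fg; congr (G v _); apply/funext => u; case: pselect.
Qed.

Lemma well_founded_minimal {I : Type} (lt : I -> I -> Prop) (P : I -> Prop) :
  well_founded lt -> (exists i, P i) -> exists2 i, P i & forall j, lt j i -> ~ P j.
Proof.
move=> wf [i Pi]; apply: contrapT => nmin; move: i Pi.
apply: (well_founded_ind wf) => i IH Pi; apply: nmin.
by exists i => // j /IH.
Qed.

Section Threads.
Context {R : realType} {T : choiceType} {I : Type}.
Variables (lt : I -> I -> Prop) (wf : well_founded lt).
Hypothesis lt_total : forall x y, [\/ lt x y, x = y | lt y x].
Hypothesis lt_transitive : forall x y z, lt x y -> lt y z -> lt x z.
Hypothesis lt_countable : forall x, countable [set y | lt y x].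
Variable V : I -> set {fset T}.
Hypothesis lfV : forall i, locally_finite (V i).
Hypothesis cV : forall i, countable (V i).

(** Countably many points lie below w, so they have a nondecreasing cofinal sequence [al];
    [slow_limit] sums the differences of h along it. Successor and limit w are treated alike. *)
Lemma slow_coherent_limit w (h : I -> T -> R) :
  (forall u v, lt u v -> lt v w -> slow (V u) (fun i => h v i - h u i)) ->
  exists f, forall v, lt v w -> slow (V v) (fun i => f i - h v i).
Proof.
move=> coh; have [[v0 v0w]|nv] := pselect (exists v, lt v w); last first.
  by exists (fun=> 0) => v vw; case: nv; exists v.
have [g [gw gP]] := countable_enum v0 (lt_countable w).
have {}gw n : lt (g n) w by have [//|->] := gw n.
pose maxI u v := if pselect (lt u v) then v else u.
pose al := fix al n := if n is m.+1 then maxI (al m) (g m.+1) else g 0%N.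
pose le u v := lt u v \/ u = v.
have le_tr u v x : le u v -> le v x -> le u x.
  by move=> [uv|->] [vx|<-]; [left; exact: lt_transitive vx|left|left|right].
have maxl u v : le u (maxI u v) by rewrite /maxI; case: pselect => ?; [left|right].
have maxr u v : le v (maxI u v).
  rewrite /maxI; case: pselect => uv; first by right.
  by have [//|uv'|] := lt_total u v; [right|left].
have alw n : lt (al n) w.
  elim: n => [|n IH]; first exact: gw.
  by rewrite /= /maxI; case: pselect => ?; [exact: gw|exact: IH].
have gal k n : (k <= n)%N -> le (g k) (al n).
  elim: n => [|n IH]; first by rewrite leqn0 => /eqP->; right.
  rewrite leq_eqVlt => /orP[/eqP->|]; first exact: maxr.
  by rewrite ltnS => /IH kn; apply: le_tr kn (maxl _ _).
have coh' u v : le u v -> lt v w -> slow (V u) (fun i => h v i - h u i).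
  move=> [uv|->] vw; first exact: coh.
  rewrite (_ : (fun=> _) = (fun=> 0)); first exact: slow0.
  by apply/funext => i; rewrite subrr.
pose k n i := h (al n.+1) i - h (al n) i.
(* Both [al n] and [al n.+1] dominate g 0, ..., g n, so coherence at each of these makes the
   difference slow. *)
have sk n : slow (upto (V \o g) n) (k n).
  apply: slow_upto => m mn /=.
  rewrite (_ : k n = (fun i => (h (al n.+1) i - h (g m) i) + - (h (al n) i - h (g m) i))).
    by apply: slowD; [|apply: slowN]; apply: coh' => //; apply: gal => //; exact: leqW.
  by apply/funext => i; rewrite /k opprB addrA subrK.
have [|||//|f fP] := @slow_limit R T (upto (V \o g)) k.
- by move=> n; apply: locally_finite_upto => m; exact: lfV.
- by move=> n; apply: countable_upto => m; exact: cV.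
- exact: upto_mono.
exists (fun i => h (al 0%N) i + f i) => v vw.
have [n <-] := gP v vw.
have tele i : \sum_(0 <= m < n) k m i = h (al n) i - h (al 0%N) i.
  by rewrite /k telescope_sumr.
rewrite (_ : (fun=> _) = (fun i => (f i - \sum_(0 <= m < n) k m i) + (h (al n) i - h (g n) i))).
  apply: slowD; last by apply: coh' => //; exact: gal.
  by apply: slow_sub (fP n); exact: (@sub_upto _ (V \o g)).
apply/funext => i; rewrite tele; ring.
Qed.

Variable k : I -> T -> R.
Hypothesis sk : forall v w, lt v w -> slow (V v) (k w).

(** The phase that later stages follow: A decides whether they branch off by [k v] at v. *)
Definition twist (A : set I) (th : I -> T -> R) v i : R :=
  th v i + if pselect (A v) then k v i else 0.

Lemma thread_tree : exists th : set I -> I -> T -> R,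
  (forall A v w, lt v w -> slow (V v) (fun i => th A w i - twist A (th A) v i)) /\
  (forall A B w, (forall v, lt v w -> A v <-> B v) -> th A w = th B w).
Proof.
have step (wh : I * (I -> T -> R)) : exists f,
    (forall u v, lt u v -> lt v wh.1 -> slow (V u) (fun i => wh.2 v i - wh.2 u i)) ->
    forall v, lt v wh.1 -> slow (V v) (fun i => f i - wh.2 v i).
  case: wh => w h /=.
  have [coh|coh] := pselect
    (forall u v, lt u v -> lt v w -> slow (V u) (fun i => h v i - h u i)).
    by have [f fP] := slow_coherent_limit coh; exists f.
  by exists (fun=> 0).
(* L is chosen once for all A; this is why threads whose sets agree below w have the same phase at
   w. *)
have [L LP] := choice step.
have rec (A : set I) := well_founded_recursion (fun=> 0)
  (fun w (th : I -> T -> R) =>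
     L (w, fun v => if pselect (lt v w) then twist A th v else fun=> 0)) wf.
have [th thP] := choice rec.
have thE A w : th A w = L (w, fun v => if pselect (lt v w) then twist A (th A) v else fun=> 0).
  rewrite {1}thP; congr (L (w, _)); apply/funext => v; case: pselect => // vw.
  by apply/funext => i; rewrite /twist; case: pselect.
exists th; split.
  move=> A v w; move: w v; apply: (well_founded_ind wf) => w IH v vw.
  rewrite thE; have := LP (w, fun v => if pselect (lt v w) then twist A (th A) v else fun=> 0).
  move=> /= /(_ _ v vw); case: (pselect (lt v w)) => // ?; apply.
  move=> u x ux xw; case: pselect => // ?; case: pselect => [?|[]]; last exact: lt_transitive xw.
  (* Twisting at x keeps coherence, as [k x] is slow for every family below x. *)
  rewrite (_ : (fun=> _) = (fun i => (th A x i - twist A (th A) u i) +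
      (if pselect (A x) then k x i else 0))).
    apply: slowD; first exact: IH.
    by case: pselect => ?; [exact: sk|exact: slow0].
  by apply/funext => i; rewrite {1}/twist addrAC.
move=> A B w; move: w; apply: (well_founded_ind wf) => w IH AB.
rewrite !thE; congr (L (w, _)); apply/funext => v; case: pselect => // vw.
apply/funext => i; rewrite /twist (IH v vw); last first.
  by move=> u uv; apply: AB; exact: lt_transitive vw.
have ABv := AB v vw.
by congr (_ + _); case: pselect => Av; case: pselect => Bv //; exfalso; tauto.
Qed.

End Threads.

(** * Automorphisms defined by threads of phases *)

Section OuterAutomorphisms.
Context {R : realType} {H : hilbertType R}.
Implicit Types (x y b : calkin H) (t : H -> R).
Local Open Scope complex_scope.
Variables (I : Type) (I1 : is_aleph1 [set: I]).
Variables (E : set H) (oE : orthonormal_set E) (tE : total_set E).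

Let S : set (calkin H) := JmodK I.
Let autS := star_automorphism (@calkin_mul R H) (@calkin_star R H) S.

Lemma AD_inj t : injective (AD E t).
Proof.
apply: (can_inj (g := AD E (fun e => - t e))) => x.
rewrite -(AD_add oE tE) (_ : (fun e => - t e + t e) = (fun=> 0)) ?(AD0 oE tE)//.
by apply/funext => e; rewrite addNr.
Qed.

Variables (lt : I -> I -> Prop) (wf : well_founded lt).
Hypothesis lt_total : forall u v, [\/ lt u v, u = v | lt v u].
Hypothesis lt_transitive : forall u v w, lt u v -> lt v w -> lt u w.
Hypothesis lt_countable : forall w, countable [set v | lt v w].

Lemma lt_unbounded u : exists w, lt u w.
Proof.
apply: contrapT => nw; apply: I1.1.
apply: (@sub_countable _ _ _ ([set v | lt v u] `|` [set u])).
  apply: subset_card_le => v _.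
  have [uv|->|vu] := lt_total u v; [|by right|by left].
  by case: nw; exists v.
rewrite -bigcup2E; apply: bigcup_countable => // -[|[|i]] _ //=; exact: countable1.
Qed.

Lemma lt_directed u v : exists w, lt u w /\ lt v w.
Proof.
have [uv|->|vu] := lt_total u v.
- by have [w vw] := lt_unbounded v; exists w; split=> //; exact: lt_transitive vw.
- by have [w vw] := lt_unbounded v; exists w.
- by have [w uw] := lt_unbounded u; exists w; split=> //; exact: lt_transitive uw.
Qed.

Definition follows (th : I -> H -> R) (f : calkin H -> calkin H) : Prop :=
  forall x, S x -> exists v, forall w, lt v w -> f x = AD E (th w) x.

Section Follows.
Variables (th : I -> H -> R).
Hypothesis th_stable : forall x, S x -> exists v, forall w w', lt v w -> lt v w' ->
  AD E (fun e => th w e - th w' e) x = x.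

Lemma follows_exists : exists2 f, follows th f & forall x, ~ S x -> f x = 0.
Proof.
have ex x : exists y, (~ S x -> y = 0) /\
    (S x -> exists v, forall w, lt v w -> y = AD E (th w) x).
  have [Sx|Sx] := pselect (S x); last by exists 0; split.
  have [v vP] := th_stable Sx; have [w vw] := lt_unbounded v.
  exists (AD E (th w) x); split=> // _; exists v => w' vw'.
  rewrite -{1}(vP w' w vw' vw) -(AD_add oE tE); congr (AD E _ x).
  by apply/funext => e; rewrite addrC subrK.
have [f fP] := choice ex.
by exists f => x; [exact: (fP x).2|exact: (fP x).1].
Qed.

(** Finitely many elements of J/K are handled by a single w, where f agrees with conjugation by the
    phase at w; the algebraic laws are inherited from there. *)
Lemma follows_automorphism f : follows th f -> autS f.
Proof.
move=> fP; have JS := JmodK_AD oE tE I1.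
have two x y z : S x -> S y -> S z -> exists w,
    [/\ f x = AD E (th w) x, f y = AD E (th w) y & f z = AD E (th w) z].
  move=> /fP[v1 h1] /fP[v2 h2] /fP[v3 h3].
  have [v [v1v v2v]] := lt_directed v1 v2; have [w [vw v3w]] := lt_directed v v3.
  by exists w; split; [apply: h1|apply: h2|apply: h3] => //; exact: lt_transitive vw.
split.
- split=> [x Sx|x y /set_mem Sx /set_mem Sy|y Sy].
  + by have [w [-> _ _]] := two x x x Sx Sx Sx; exact: JS.
  + by have [w [-> -> _]] := two x y x Sx Sy Sx; exact: AD_inj.
  (* Beyond v all phases act on y like [th w0], so conjugating y back by [th w0] gives a
     preimage. *)
  + have [v vP] := th_stable Sy; have [w0 vw0] := lt_unbounded v.
    pose x := AD E (fun e => - th w0 e) y.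
    have Sx : S x by exact: JS.
    exists x => //; have [u ux] := fP x Sx; have [w [uw vw]] := lt_directed u v.
    by rewrite (ux w uw) /x -(AD_add oE tE); exact: vP.
- move=> x y /set_mem Sx /set_mem Sy.
  have Sxy := JmodK_add oE tE I1 Sx Sy.
  by have [w [-> -> ->]] := two x y (x + y) Sx Sy Sxy; rewrite ADD.
- move=> c x /set_mem Sx; have Scx := JmodK_scale oE tE I1 c Sx.
  by have [w [-> -> _]] := two x (c *: x) x Sx Scx Sx; rewrite ADZ.
- move=> x y /set_mem Sx /set_mem Sy.
  have Sxy := JmodK_mul oE tE I1 y Sx.
  by have [w [-> -> ->]] := two x y _ Sx Sy Sxy; rewrite (ADM oE tE).
- move=> x /set_mem Sx; have Ssx := JmodK_star oE tE I1 Sx.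
  by have [w [-> -> _]] := two x (calkin_star x) x Sx Ssx Sx; rewrite (AD_star oE tE).
Qed.

End Follows.

Section Corner.
Variables (N0 : set H) (N0E : N0 `<=` E) (cN0 : countable N0) (iN0 : infinite_set N0).

Let p := corner E N0.

Lemma corner_star : calkin_star p = p.
Proof.
rewrite /p /corner (calkin_star_pi oE tE); congr calkin_pi.
apply: (matrix_ext oE tE) => e f Ee Ef.
rewrite (hdot_corner oE tE)// hdotJ -(hdot_adj oE tE) (hdot_corner oE tE)//.
have [->|ef] := eqVneq e f; first by case: ifP => _; rewrite ?conjc0// -hdotJ.
have d0 : hdot e f = 0 by rewrite oE ?mem_set// (negbTE ef).
by rewrite [hdot f e]hdotJ d0 conjc0 !if_same conjc0.
Qed.

Lemma AD_corner t : AD E t p = p.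
Proof.
rewrite /p /corner AD_pi; congr calkin_pi; apply: opP => x.
apply: (hdot_ext tE) => e Ee; rewrite AdE hdot_dg// !(hdot_corner oE tE)//.
case: ifP => _; last by rewrite mulr0.
by rewrite hdot_dg// mulrA -expiD subrr expi0 mul1r.
Qed.

(* On the corner p (J/K) p, the automorphism implemented by u depends on the
   element u p of J/K only. *)
Lemma inner_on_corner f (u : multiplier) b :
  is_multiplier (@calkin_mul R H) (@calkin_norm R H) S u ->
  {in S, forall a, mult_eq S (mult_embed (@calkin_mul R H) (f a))
     (mult_mul (mult_mul u (mult_embed (@calkin_mul R H) a)) (mult_star (@calkin_star R H) u))} ->
  S b -> calkin_mul p b = b -> calkin_mul b p = b ->
  calkin_mul (f b) p = calkin_mul (u.1 p) (calkin_mul b (calkin_mul (calkin_star (u.1 p)) p)).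
Proof.
move=> [[[u1S _ _ _] [u2S _ _ _]] u1M _ u21] fu Sb pb bp.
have Sp : S p := JmodK_corner oE tE I1 cN0.
have [fb _] := fu b (mem_set Sb).
(* At p the multiplier identity reads (f b) p = u (b y) with y the star of p u. As b = p b, the left
   factor becomes u p; as b = b p, y may be replaced by p y, which is (u p)^* p by the centralizer
   relation. *)
have := fb p (mem_set Sp); rewrite /mult_embed /mult_mul /mult_star /= => ->.
rewrite corner_star; set y := calkin_star _.
have -> : calkin_mul b y = calkin_mul p (calkin_mul b y) by rewrite calkin_mulA pb.
rewrite u1M ?mem_set//; last exact: (JmodK_mul oE tE I1 _ Sb).
congr calkin_mul; rewrite -{1}bp -calkin_mulA; congr calkin_mul.
rewrite -[LHS](calkin_starK oE tE) (calkin_starM oE tE) /y (calkin_starK oE tE).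
rewrite corner_star u21 ?mem_set// (calkin_starM oE tE) corner_star.
done.
Qed.

Section Tree.
Variables (X : I -> calkin H) (SX : forall i, S (X i)) (Xsurj : forall x, S x -> exists i, X i = x).

(** At the least w where A and B differ, the two threads still share their phase; one of them then
    branches off by k_w, which sends b_w to its negative, and all later phases respect b_w. The
    local form [AD E t b] serves to show that (Phi A b) p = Phi A b on the corner. *)
Lemma many_automorphisms : exists Phi : set I -> calkin H -> calkin H,
  [/\ forall A, autS (Phi A), forall A x, ~ S x -> Phi A x = 0,
      forall A b, exists t, S b -> Phi A b = AD E t b &
      forall A B, (forall b, S b -> calkin_mul p b = b -> calkin_mul b p = b ->
        Phi A b = Phi B b) -> A = B].
Proof.
have fam (x : calkin H) : exists W : set {fset H}, S x ->
    [/\ locally_finite W, countable W & forall t, slow W t -> AD E t x = x].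
  have [Sx|Sx] := pselect (S x); last by exists set0.
  by have [W WP] := AD_slow oE tE I1 Sx; exists W.
have [W WP] := choice fam.
have step (wq : I * (I -> calkin H * (H -> R))) : exists bt : calkin H * (H -> R),
    (forall v, lt v wq.1 -> S (wq.2 v).1) ->
    [/\ S bt.1, calkin_mul p bt.1 = bt.1 /\ calkin_mul bt.1 p = bt.1,
      bt.1 != 0, AD E bt.2 bt.1 = - bt.1 &
      forall v, lt v wq.1 -> slow (W (X v) `|` W (wq.2 v).1) bt.2].
  case: wq => w q /=.
  have [Sq|Sq] := pselect (forall v, lt v w -> S (q v).1); last by exists (0, fun=> 0).
  have [[v0 v0w]|nv] := pselect (exists v, lt v w); last first.
    (* At the least w there is nothing earlier to respect, hence the empty families. *)
    have [|b [t [Sb pb b0 tb _]]] :=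
        @split_element _ _ E oE tE I I1 N0 N0E cN0 iN0 (fun=> set0).
      by move=> n i; apply: sub_finite_set (finite_set0 {fset H}) => v [].
    by exists (b, t) => _; split=> // v vw; case: nv; exists v.
  have [g [gw gP]] := countable_enum v0 (lt_countable w).
  have {}gw n : lt (g n) w by have [//|->] := gw n.
  have [|b [t [Sb pb b0 tb st]]] :=
      @split_element _ _ E oE tE I I1 N0 N0E cN0 iN0 (fun n => W (X (g n)) `|` W (q (g n)).1).
    move=> n; apply: locally_finiteU; first by have [] := WP _ (SX (g n)).
    by have [] := WP _ (Sq _ (gw n)).
  by exists (b, t) => _; split=> // v /gP[n <-].
have [G GP] := choice step.
have [Q QE] := well_founded_recursion (0, fun=> 0) (fun w q => G (w, q)) wf.
have QP w : [/\ S (Q w).1, calkin_mul p (Q w).1 = (Q w).1 /\ calkin_mul (Q w).1 p = (Q w).1,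
      (Q w).1 != 0, AD E (Q w).2 (Q w).1 = - (Q w).1 &
      forall v, lt v w -> slow (W (X v) `|` W (Q v).1) (Q w).2].
  move: w; apply: (well_founded_ind wf) => w IH.
  have := GP (w, fun v => if pselect (lt v w) then Q v else (0, fun=> 0)).
  rewrite -QE /=; case=> [v vw|h1 h2 h3 h4 h5].
    by case: pselect => // ?; have [] := IH v vw.
  by split=> // v vw; have := h5 v vw; case: pselect.
(* The blocks of [X v] make threads eventually constant at each element of J/K; those of b_v
   preserve the branching made at v. *)
pose V v := W (X v) `|` W (Q v).1.
have lfV v : locally_finite (V v).
  by apply: locally_finiteU; [have [] := WP _ (SX v)|have [/WP[]] := QP v].
have cV v : countable (V v).
  rewrite /V -bigcup2E; apply: bigcup_countable => // -[|[|i]] _ //=.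
    by have [] := WP _ (SX v).
  by have [/WP[]] := QP v.
have kV v w : lt v w -> slow (V v) (Q w).2 by have [_ _ _ _] := QP w; apply.
have [th [thV thE]] := @thread_tree R H I lt wf lt_total lt_transitive lt_countable
  V lfV cV (fun v => (Q v).2) kV.
pose h A v e := twist (fun v => (Q v).2) A (th A) v e.
have thAD A v w x : S x -> W x `<=` V v -> lt v w -> AD E (th A w) x = AD E (h A v) x.
  move=> Sx xV vw; have [_ _ Wx] := WP x Sx.
  rewrite (_ : th A w = (fun e => h A v e + (th A w e - h A v e))); last first.
    by apply/funext => e; rewrite addrC subrK.
  by rewrite (AD_add oE tE) Wx//; apply: slow_sub xV _; exact: thV.
have th_stable A x : S x -> exists v, forall w w', lt v w -> lt v w' ->
    AD E (fun e => th A w e - th A w' e) x = x.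
  move=> Sx; have [v vx] := Xsurj Sx; exists v => w w' vw vw'.
  have [_ _ Wx] := WP x Sx; apply: Wx; apply: (@slow_sub _ _ (V v)).
    by rewrite /V vx; left.
  rewrite (_ : (fun=> _) = (fun e => (th A w e - h A v e) + - (th A w' e - h A v e))).
    by apply: slowD; [|apply: slowN]; exact: thV.
  by apply/funext => e; rewrite opprB addrA subrK.
have ex A : exists f, follows (th A) f /\ forall x, ~ S x -> f x = 0.
  by have [f f1 f2] := follows_exists (th_stable A); exists f.
have [Phi PhiP] := choice ex.
exists Phi; split.
- by move=> A; apply: (follows_automorphism (th_stable A)); exact: (PhiP A).1.
- by move=> A; exact: (PhiP A).2.
- move=> A b; have [Sb|Sb] := pselect (S b); last by exists (fun=> 0).
  have [v vP] := (PhiP A).1 b Sb; have [w vw] := lt_unbounded v.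
  by exists (th A w); rewrite (vP w).
move=> A B AB; apply: contrapT => nAB.
have [w wAB wmin] : exists2 w, ~ (A w <-> B w) & forall v, lt v w -> ~ ~ (A v <-> B v).
  apply: well_founded_minimal => //; apply: contrapT => nw; apply: nAB.
  apply/seteqP; split=> w; apply: contraPP => hw hw'; apply: nw; exists w; tauto.
have [Sb [pb bp] b0 kb _] := QP w; set b := (Q w).1 in Sb pb bp b0 kb.
have thAB : th A w = th B w by apply: thE => v /wmin; exact: contrapT.
have hAB : AD E (h A w) b = AD E (h B w) b.
  have [v1 v1P] := (PhiP A).1 b Sb; have [v2 v2P] := (PhiP B).1 b Sb.
  have [v [v1v v2v]] := lt_directed v1 v2; have [u [vu wu]] := lt_directed v w.
  have bV : W b `<=` V w by right.
  rewrite -(thAD A w u)// -(thAD B w u)//.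
  rewrite -(v1P u); last exact: lt_transitive vu.
  rewrite -(v2P u); last exact: lt_transitive vu.
  exact: AB.
(* Equal conjugations after the branching would give, by injectivity, that k_w fixes b, that is - b
   = b. *)
have flip (C D : set I) : th C w = th D w -> C w -> ~ D w ->
    AD E (h C w) b = AD E (h D w) b -> False.
  move=> CD Cw Dw.
  rewrite (_ : h C w = (fun e => h D w e + (Q w).2 e)); last first.
    apply/funext => e; rewrite /h /twist CD; case: pselect => // ?.
    by case: pselect => // ?; rewrite addr0.
  rewrite (AD_add oE tE) => /AD_inj; rewrite kb => /eqP.
  rewrite -subr_eq0 -opprD oppr_eq0 -mulr2n -scaler_nat scaler_eq0 pnatr_eq0 /=.
  exact/negP.
have [Aw|Aw] := pselect (A w).
  by apply: (flip A B) => // Bw; apply: wAB.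
by apply: (flip B A) => //; apply: contrapT => Bw; apply: wAB.
Qed.

End Tree.
End Corner.
End OuterAutomorphisms.

(** * Counting the outer automorphisms *)

Section Count.
Context {R : realType} {H : hilbertType R}.
Implicit Types (x y b : calkin H).
Variables (I : Type) (I1 : is_aleph1 [set: I]) (ch : CH).
Variables (E : set H) (oE : orthonormal_set E) (tE : total_set E) (EI : E #= [set: I]).

Let S : set (calkin H) := JmodK I.
Let innS := inner_automorphism (@calkin_mul R H) (@calkin_star R H) (@calkin_norm R H) S.
Let outS := outer_automorphisms (@calkin_mul R H) (@calkin_star R H) (@calkin_norm R H) S.

(** An automorphism is coded by its graph, a subset of I once pairs are coded in I; being 0 outside
    J/K, it is determined by that graph. *)
Lemma outer_automorphisms_le : outS #<= [set: set I].
Proof.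
have [e [_ ei]] := JmodK_inj I1 ch oE tE EI.
have [pr pri] := aleph1_pair_inj I1 ch.
apply: (@inj_into_card_le _ _ (fun f => [set w | exists2 x, S x & w = pr (e x, e (f x))])).
split=> // f g [[[fS _ _] _ _ _ _] _ f0] [[[gS _ _] _ _ _ _] _ g0] fg.
apply/funext => x; have [Sx|Sx] := pselect (S x); last by rewrite f0// g0.
have : [set w | exists2 x, S x & w = pr (e x, e (f x))] (pr (e x, e (f x))) by exists x.
rewrite fg => -[y Sy /pri[/(ei _ _ Sx Sy) xy exy]].
by move: exy; rewrite -xy; apply: ei; [exact: fS|exact: gS].
Qed.

Lemma outer_automorphisms_ge : [set: set I] #<= outS.
Proof.
have [lt [wf lt_total lt_trans lt_countable]] := well_order_aleph1 I1.
have [e [eS ei]] := JmodK_inj I1 ch oE tE EI.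
have [i0 _] := aleph1_inhabited I1.
have [N0 [N0E cN0 iN0]] : exists N0 : set H,
    [/\ N0 `<=` E, countable N0 & infinite_set N0].
  have : infinite_set E.
    move=> /finite_set_countable cE; apply: I1.1; apply: sub_countable cE.
    by move/card_eqPle: EI => [].
  move=> /infiniteP/(card_le_inj_into (0 : H))[z [zE zi]].
  exists (range z); split.
  - by move=> _ [n _ <-]; exact: zE.
  - by apply: (@sub_countable _ _ _ [set: nat]) => //; exact: card_image_le.
  - move=> fz; apply: infinite_nat; rewrite -(eq_finite_set (inj_card_eq (f := z) _))//.
    by move=> m n _ _; exact: zi.
have [X SX Xsurj] : exists2 X : I -> calkin H, (forall i, S (X i)) &
    forall x, S x -> exists i, X i = x.
  exists (fun i => if pselect (exists2 x, S x & e x = i) is left P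
    then s2val (cid2 P) else corner E N0).
    move=> i; case: pselect => [P|_]; first by case: cid2.
    exact: JmodK_corner.
  move=> x Sx; exists (e x); case: pselect => [P|[]]; last by exists x.
  by case: cid2 => y Sy /= /ei; apply.
have [Phi [aut Phi0 PhiAD Phi_inj]] := many_automorphisms I1 oE tE wf lt_total lt_trans
  lt_countable N0E cN0 iN0 SX Xsurj.
set p := corner E N0 in Phi_inj.
(* For an inner [Phi A] this is v = u p; the factor p after [Phi A b] is absorbed because
   conjugation by phases fixes p and b p = b. *)
have ex A : exists v, innS (Phi A) -> S v /\ forall b, S b -> calkin_mul p b = b ->
    calkin_mul b p = b -> Phi A b =
      calkin_mul v (calkin_mul b (calkin_mul (calkin_star v) p)).
  have [[_ [u [um _ _] uP]]|nin] := pselect (innS (Phi A)); last by exists 0.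
  have Sp : S p by exact: JmodK_corner.
  exists (u.1 p) => _; split; first by case: um => [[[uS _ _ _] _] _ _ _]; exact: uS.
  move=> b Sb pb bp.
  rewrite -(inner_on_corner I1 oE tE cN0 um uP Sb pb bp).
  have [t ->//] := PhiAD A b; rewrite -{1}(AD_corner oE tE N0 t) -(ADM oE tE).
  by rewrite bp.
have [v vP] := choice ex.
have [j ji] : exists j : I * bool -> I, injective j.
  have [pr pri] := aleph1_pair_inj I1 ch.
  have [i1 i01] : exists i1, i1 <> i0.
    apply: contrapT => h; apply: I1.1; apply: (@sub_countable _ _ _ [set i0]).
      by apply: subset_card_le => i _; apply: contrapT => ii0; apply: h; exists i.
    exact: countable1.
  exists (fun q => pr (q.1, if q.2 then i1 else i0)) => -[x a] [y a'] /pri[-> /=].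
  by case: a; case: a' => // /esym.
(* Interleaves two subsets of I: B serves to avoid the inner automorphisms, while C still takes
   2^aleph_1 values. *)
pose mix (B C : set I) : set I := [set w | exists i, (w = j (i, true) /\ B i) \/
   (w = j (i, false) /\ C i)].
have mixl B C i : mix B C (j (i, true)) <-> B i.
  split=> [[i' [[/ji[->]]|[/ji]]]//|Bi]; by exists i; left.
have mixr B C i : mix B C (j (i, false)) <-> C i.
  split=> [[i' [[/ji]|[/ji[->]]]]//|Ci]; by exists i; right.
have mixE B C B' C' : mix B C = mix B' C' -> B = B' /\ C = C'.
  move=> mm; split; apply/funext => i; apply/propext.
    by rewrite -(mixl B C i) mm mixl.
  by rewrite -(mixr B C i) mm mixr.
(* Otherwise B |-> c B would select an inner automorphism for each B, and two
   of these agree on the corner as soon as their elements u p are equal. *)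
have [B0 B0P] : exists B, forall C, ~ innS (Phi (mix B C)).
  apply: contrapT => nB.
  have /choice[c cP] : forall B, exists C, innS (Phi (mix B C)).
    move=> B; apply: contrapT => nC; apply: nB; exists B => C inn.
    by apply: nC; exists C.
  apply: (@no_inj_from_powerset I (fun B => e (v (mix B (c B))))) => B B' /ei vv.
  have [Sv vB] := vP _ (cP B); have [Sv' vB'] := vP _ (cP B').
  suff /mixE[] : mix B (c B) = mix B' (c B') by [].
  by apply: Phi_inj => b Sb pb bp; rewrite vB// vB'// vv.
apply: (@inj_into_card_le _ _ (fun C => Phi (mix B0 C))); split.
  by move=> C _; split; [exact: aut|exact: B0P|exact: Phi0].
move=> C C' _ _ PP; suff /mixE[] : mix B0 C = mix B0 C' by [].
by apply: Phi_inj => b _ _ _; rewrite PP.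
Qed.

End Count.

Theorem theorem1p2 (R : realType) (H : hilbertType R) (I : Type)
    (I_aleph1 : is_aleph1 [set: I]) (dimH : hdim_eq [set: H] [set: I])
    (ch : CH) :
  outer_automorphisms (@calkin_mul R H) (@calkin_star R H) (@calkin_norm R H)
    (@JmodK R H I) #= [set: set I].
Proof.
have [E /basis_orthonormal[oE tE] EI] := dimH.
by apply/card_eqPle; split;
  [exact: (outer_automorphisms_le I_aleph1 ch oE tE EI)|
   exact: (outer_automorphisms_ge I_aleph1 ch oE tE EI)].
Qed.
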